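(* Let $\lambda>0$ and let $\Omega=\{x\in\mathbb{R}^3 : |x|\le 1\}$ be the unit ball. For $m=(L+1)^2$, let $V_m^3=\mathrm{span}\{b_{\lambda,l,q} : 0\le l\le L,\ -l\le q\le l\}$ be the $m$-dimensional space spanned by the spherical Fourier-Bessel functions $$b_{\lambda,l,q}(x)=Y_{l,q}\left(\frac{x}{|x|}\right)j_l(\lambda|x|),$$ and let $\nu_\alpha$ be the probability measure $\nu_\alpha=(1-\alpha)\frac{dx}{|\Omega|}+\alpha\frac{d\sigma}{|\partial\Omega|}$ on $\Omega$. Then: (1) (Case $\alpha=0$, the uniform measure.) For every $c_1<1/9$ there is a constant $c_0$, depending on $c_1$ and $\lambda$, such that for all sufficiently large $m=(L+1)^2$, $$K(V_m^3,\nu_0)\ \ge\ c_0+c_1m^{3/2}.$$ (2) (Case $0<\alpha<1$.) There is a constant $C$, depending on $\lambda$ and $\alpha$, such that for all sufficiently large $m=(L+1)^2$, $$K(V_m^3,\nu_\alpha)\ \le\ C+\frac{m}{\alpha}.$$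
   Context: $Y_{l,q}$ ($l\ge 0$, $-l\le q\le l$) are the standard spherical harmonics on the unit sphere of $\mathbb{R}^3$ (for fixed $l$, orthogonal with a common $L^2$ norm), and $j_l(t)=\sqrt{\pi/(2t)}\,J_{l+1/2}(t)$ are the spherical Bessel functions of the first kind, where $J_{l+1/2}$ is the Bessel function of the first kind; the functions $b_{\lambda,l,q}$ are extended by continuity at $x=0$. Spans are over $\mathbb{C}$. $dx$ is Lebesgue measure on $\Omega$, $|\Omega|$ the volume of $\Omega$, $d\sigma$ the surface measure on the boundary $\partial\Omega$ (the unit sphere), and $|\partial\Omega|$ its area; $\nu_0=dx/|\Omega|$ is the uniform measure. The integer $m$ always has the form $m=(L+1)^2$ with $L\ge 0$ an integer. For an $m$-dimensional space $V_m$ of (continuous, complex-valued) functions on $\Omega$ and a probability measure $\nu$ on $\Omega$, define $$K(V_m,\nu)=\max_{x\in\Omega}\sum_{j=1}^m|L_j(x)|^2,$$ where $(L_1,\dots,L_m)$ is any basis of $V_m$ that is orthonormal in $L^2(\Omega,\nu)$ (the quantity does not depend on the choice of orthonormal basis). *)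

(* Defs.v *)
From HB Require Import structures.
From mathcomp Require Import all_boot all_order all_algebra.
From mathcomp Require Import complex ring.
From mathcomp Require Import all_classical all_reals all_analysis.
From mathcomp Require Import measurable_realfun.

Set Implicit Arguments.
Unset Strict Implicit.
Unset Printing Implicit Defensive.

Import Order.TTheory GRing.Theory Num.Theory.
Import numFieldNormedType.Exports.

Local Open Scope classical_set_scope.
Local Open Scope complex_scope.
Local Open Scope ring_scope.

(* R^3 is the iterated product, so that it carries the product sigma-algebra;
   the library norm of a product is the sup norm, hence [norm3] below. *)
Notation R3 R :=
  (measurableTypeR R * measurableTypeR R * measurableTypeR R)%type
  (only parsing).

Section space.
Variable R : realType.
Implicit Types x : R3 R.

Definition norm3 x : R := Num.sqrt (x.1.1 ^+ 2 + x.1.2 ^+ 2 + x.2 ^+ 2).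
Definition ball3 : set (R3 R) := [set x | norm3 x <= 1].
Definition sphere3 : set (R3 R) := [set x | norm3 x = 1].

Lemma measurable_norm3 : measurable_fun [set: R3 R] norm3.
Proof.
apply: measurableT_comp.
  by apply: continuous_measurable_fun; exact: sqrt_continuous.
have m1 : measurable_fun [set: R3 R] (fun x => x.1.1 : R).
  exact: (measurableT_comp measurable_fst measurable_fst).
have m2 : measurable_fun [set: R3 R] (fun x => x.1.2 : R).
  exact: (measurableT_comp measurable_snd measurable_fst).
apply: measurable_funD; first by apply: measurable_funD; exact: measurable_funX.
by apply: measurable_funX; exact: measurable_snd.
Qed.

Lemma measurable_ball3 : measurable ball3.
Proof.
have := measurable_norm3 measurableT (measurable_itv `]-oo, 1%R]).
by rewrite setTI; congr measurable; apply/seteqP; split => x;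
  rewrite /ball3/= in_itv.
Qed.

Definition lebesgue3 : {measure set (R3 R) -> \bar R} :=
  (lebesgue_measure \x lebesgue_measure \x lebesgue_measure)%E.

(* p.1 is the colatitude theta and p.2 the longitude phi; the area element on
   the unit sphere is sin theta dtheta dphi *)
Definition spherical (p : measurableTypeR R * measurableTypeR R) : R3 R :=
  (sin p.1 * cos p.2, sin p.1 * sin p.2, cos p.1).

Definition angles : set (measurableTypeR R * measurableTypeR R) :=
  `[0, pi] `*` `[0, pi *+ 2].

Definition surface_measure (A : set (R3 R)) : \bar R :=
  (\int[lebesgue_measure \x lebesgue_measure]_(p in
     angles `&` spherical @^-1` A) (sin p.1)%:E)%E.

Lemma measurable_spherical :
  measurable_fun [set: measurableTypeR R * measurableTypeR R] spherical.
Proof.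
have ms (h : R -> R) : continuous h ->
    measurable_fun [set: measurableTypeR R * measurableTypeR R]
      (fun p => h p.1 : R).
  by move=> ch; apply: measurableT_comp => //; exact: continuous_measurable_fun.
have ms2 (h : R -> R) : continuous h ->
    measurable_fun [set: measurableTypeR R * measurableTypeR R]
      (fun p => h p.2 : R).
  by move=> ch; apply: measurableT_comp => //; exact: continuous_measurable_fun.
have [cs cc] : continuous (@sin R) /\ continuous (@cos R).
  by split; [exact: continuous_sin|exact: continuous_cos].
apply/measurable_fun_pairP; split; first apply/measurable_fun_pairP; first split.
- by apply: measurable_funM; [exact: ms|exact: ms2].
- by apply: measurable_funM; [exact: ms|exact: ms2].
- exact: ms.
Qed.

Lemma measurable_angles : measurable angles.
Proof. by apply: measurableX; exact: measurable_itv. Qed.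

Lemma surface_measure0 : surface_measure set0 = 0%E.
Proof. by rewrite /surface_measure preimage_set0 setI0 integral_set0. Qed.

Lemma sin_angles_ge0 p : angles p -> 0 <= sin p.1.
Proof.
by move=> -[/=]; rewrite !in_itv/= => ? _; apply: sin_ge0_pi.
Qed.

Lemma surface_measure_ge0 A : (0 <= surface_measure A)%E.
Proof.
by apply: integral_ge0 => p [/sin_angles_ge0 ? _]; rewrite lee_fin.
Qed.

Lemma surface_measure_semi_sigma_additive :
  semi_sigma_additive surface_measure.
Proof.
move=> F mF tF mUF; rewrite /surface_measure preimage_bigcup setI_bigcupr.
rewrite ge0_integral_bigcup//=.
- apply: is_cvg_ereal_nneg_natsum_cond => n _ _; exact: surface_measure_ge0.
- move=> k; apply: measurableI; first exact: measurable_angles.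
  by rewrite -[X in measurable X]setTI; apply: measurable_spherical.
- apply/measurable_EFinP/measurable_funTS.
  apply: measurableT_comp; last exact: measurable_fst.
  by apply: continuous_measurable_fun; exact: continuous_sin.
- by move=> p [k _ [/sin_angles_ge0 ? _]]; rewrite lee_fin.
- apply/trivIsetP => i j _ _ ij; rewrite setIACA setIid -preimage_setI.
  by move/trivIsetP : tF => /(_ i j I I ij) ->; rewrite preimage_set0 setI0.
Qed.

HB.instance Definition _ := isMeasure.Build _ _ _ surface_measure
  surface_measure0 surface_measure_ge0 surface_measure_semi_sigma_additive.

Definition ball_volume : R := fine (lebesgue3 ball3).
Definition sphere_area : R := fine (surface_measure sphere3).

Lemma ball_volumeV_ge0 : 0 <= ball_volume^-1.
Proof. by rewrite invr_ge0 fine_ge0. Qed.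

Lemma sphere_areaV_ge0 : 0 <= sphere_area^-1.
Proof. by rewrite invr_ge0 fine_ge0. Qed.

(* nu_alpha, as a measure on R^3 concentrated on the ball *)
Definition nu (alpha : {i01 R}) : {measure set (R3 R) -> \bar R} :=
  measure_add
    (mscale (1 - alpha%:num)%:nng
       (mscale (NngNum ball_volumeV_ge0) (mrestr lebesgue3 measurable_ball3)))
    (mscale alpha%:num%:nng
       (mscale (NngNum sphere_areaV_ge0) surface_measure)).

End space.

Section special_functions.
Variable R : realType.
Local Notation C := R[i].
Implicit Types (l : nat) (q : int) (s t v : R).

Definition Gamma s : R :=
  \int[lebesgue_measure]_(t in `]0, +oo[) (t `^ (s - 1) * expR (- t)).

Definition bessel_J v t : R :=
  limn (series (fun k : nat =>
    (-1) ^+ k / (k`!%:R * Gamma (k%:R + v + 1)) * (t / 2) `^ (k%:R *+ 2 + v))).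

Definition sph_bessel l t : R :=
  Num.sqrt (pi / (2 * t)) * bessel_J (l%:R + 1 / 2) t.

(* [legendre_deriv l k] is the k-th derivative of the Legendre polynomial P_l,
   by Rodrigues' formula *)
Definition legendre_deriv l k : {poly R} :=
  ((2 ^ l * l`!)%:R)^-1 *: (('X^2 - 1) ^+ l)^`(l + k).

Definition assoc_legendre l k t : R :=
  (-1) ^+ k * Num.sqrt (1 - t ^+ 2) ^+ k * (legendre_deriv l k).[t].

Definition sph_harm_norm l k : R :=
  Num.sqrt ((2 * l + 1)%:R / (4 * pi) * ((l - k)`!%:R / (l + k)`!%:R)).

(* On the unit sphere x + i y = sin theta * e^(i phi), which gives the Cartesian
   form of  norm * P_l^k(cos theta) * e^(i k phi)  (k >= 0);
   see [sph_harm_spherical] *)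
Definition sph_harm_nat l k (x : R3 R) : C :=
  (sph_harm_norm l k * (-1) ^+ k * (legendre_deriv l k).[x.2])%:C
  * (x.1.1 +i* x.1.2) ^+ k.

(* Y_{l,-k} = (-1)^k * conj Y_{l,k};  [Negz n] is - (n + 1) *)
Definition sph_harm l q (x : R3 R) : C :=
  match q with
  | Posz k => sph_harm_nat l k x
  | Negz n => (-1) ^+ n.+1 * (sph_harm_nat l n.+1 x)^*
  end.

Lemma sph_harm_spherical l (k : nat) (theta phi : R) : 0 <= theta <= pi ->
  sph_harm l k (spherical (theta, phi)) =
  (sph_harm_norm l k * assoc_legendre l k (cos theta))%:C
  * (cos (k%:R * phi) +i* sin (k%:R * phi)).
Proof.
move=> th; rewrite /sph_harm /sph_harm_nat /assoc_legendre /=.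
have -> : 1 - cos theta ^+ 2 = sin theta ^+ 2 by rewrite sin2cos2.
rewrite sqrtr_sqr ger0_norm ?sin_ge0_pi//.
have -> : (sin theta * cos phi) +i* (sin theta * sin phi) =
    (sin theta)%:C * (cos phi +i* sin phi) by simpc.
have -> : (cos (k%:R * phi) +i* sin (k%:R * phi)) = (cos phi +i* sin phi) ^+ k.
  elim: k => [|k IH]; first by rewrite mul0r cos0 sin0 expr0.
  rewrite exprSr -IH -natr1 mulrDl mul1r cosD sinD; simpc.
  by congr (_ +i* _); rewrite addrC.
by rewrite exprMn -rmorphXn mulrA -rmorphM/=; congr (_%:C * _); ring.
Qed.

Definition fourier_bessel (lambda : R) l q (x : R3 R) : C :=
  let f (y : R * R * R) : C^o :=
    sph_harm l q ((norm3 y)^-1 *: y) * (sph_bessel l (lambda * norm3 y))%:C in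
  if (x : R * R * R) == 0 then lim (f @ (0 : R * R * R)%type^') else f x.

End special_functions.

Section christoffel.
Context (R : realType) (d : measure_display) (T : measurableType d).
Local Notation C := R[i].
Variable Om : set T.
Implicit Types (f g : T -> C) (V : set (T -> C)).
Implicit Type mu : {measure set T -> \bar R}.

(* Functions on [Om] are represented by functions on [T], of which only the
   values on [Om] matter *)
Definition span (S : set (T -> C)) : set (T -> C) :=
  [set f | exists n (g : 'I_n -> T -> C) (c : 'I_n -> C),
     (forall i, S (g i)) /\ forall x, Om x -> f x = \sum_i c i * g i x].

Definition inner mu f g : C :=
  (\int[mu]_(x in Om) complex.Re (f x * (g x)^* )) +i*
  (\int[mu]_(x in Om) complex.Im (f x * (g x)^* )).

(* [L] is a basis of [V] that is orthonormal in L^2(Om, mu); linear independence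
   follows from orthonormality *)
Definition orthonormal_basis V mu m (L : 'I_m -> T -> C) : Prop :=
  [/\ forall j, V (L j),
      forall i j, inner mu (L i) (L j) = (i == j)%:R
    & forall f, V f -> exists c : 'I_m -> C,
        forall x, Om x -> f x = \sum_j c j * L j x].

Definition christoffel_sum m (L : 'I_m -> T -> C) (x : T) : R :=
  \sum_j ComplexField.Normc.normc (L j x) ^+ 2.

(* K(V, mu) = K: an orthonormal basis with m elements exists, and for each of
   them K is the maximum over [Om] of the sum of the squared moduli *)
Definition is_christoffel_max V mu m (K : R) : Prop :=
  (exists L : 'I_m -> T -> C, orthonormal_basis V mu L) /\
  forall L : 'I_m -> T -> C, orthonormal_basis V mu L ->
    (forall x, Om x -> christoffel_sum L x <= K) /\
    (exists2 x, Om x & christoffel_sum L x = K).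

End christoffel.

Definition V3 (R : realType) (lambda : R) (L : nat) : set (R3 R -> R[i]) :=
  span (@ball3 R) [set b | exists (l : nat) (q : int),
    [/\ (l <= L)%N, `|q| <= l%:Z & b = fourier_bessel lambda l q]].

(* Main.v *)
Require Import Defs.
From HB Require Import structures.
From mathcomp Require Import all_boot all_order all_algebra.
From mathcomp Require Import complex ring lra zify.
From mathcomp Require Import all_classical all_reals all_analysis.
From mathcomp Require Import measurable_realfun.

(** In spherical coordinates every b_(l,q) separates: it is a positive constant
    times f_l (r) Y_(l,q) (x / |x|), where f_l (r) = r^l p_l (r^2) ([radial])
    and p_l ([profile]) is the power series of the Bessel function, normalised
    by p_l (0) = 1.  The measure nu_alpha is rotation invariant, so the b_(l,q)
    are orthogonal for it, and 4 pi times the squared norm of f_l Y_(l,q) is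
      N_l = 3 (1 - alpha) int_0^1 f_l (r)^2 r^2 dr + alpha f_l (1)^2  ([mass]).
    By the addition theorem the squares |Y_(l,q)|^2, -l <= q <= l, add up to
    (2 l + 1) / (4 pi), so the Christoffel sum is the radial function
      S (r) = sum_(l <= L) (2 l + 1) f_l (r)^2 / N_l
    ([christoffel_sum_radial]), and K is the maximum of S on [0, 1].

    The k-th coefficient of p_l is at most x^k / k! in absolute value, with x of
    order 1 / l.  So the Lipschitz constant of p_l on [0, 1] tends to 0, and for
    large l the function f_l behaves like r^l: its square is largest at r = 1
    ([radial_le_boundary]), and int f_l^2 r^2 dr <= 4 f_l (1)^2 / (2 l + 3)
    ([radial_mass_le]).

    If alpha = 0, the term of large degree l in S (1) is therefore at least
    (2 l + 1) (2 l + 3) / 12, and the sum of these lower bounds is at least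
    (L + 1)^3 / 9 = m^(3/2) / 9.  The true growth of S (1) is 4 (L + 1)^3 / 9, so
    the factor 4 lost in [radial_mass_le] is affordable.  If alpha > 0, then
    N_l >= alpha f_l (1)^2 >= alpha f_l (r)^2 for large l, and the terms
    are at most (2 l + 1) / alpha, which add up to m / alpha.  The finitely many
    small degrees contribute only to the constants.

    Three classical facts are built on the way.  Spherical coordinates are
    composed from substitutions in one variable ([half_plane_polar_vertical],
    [space_polar]).  The addition theorem, the orthogonality of the associated
    Legendre functions and their norms all follow from Legendre's equation
    ([deriv_addition_sum], [cos_integral_legendreS]).  The functional equation
    of Gamma comes from Tonelli's theorem ([gamma_integralS]). *)

Set Implicit Arguments.
Unset Strict Implicit.
Unset Printing Implicit Defensive.

Import Order.TTheory GRing.Theory Num.Theory.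
Import numFieldNormedType.Exports.

Local Open Scope classical_set_scope.
Local Open Scope ring_scope.

(** * Change of variables on the line *)

Section weighted_pushforward.
Local Open Scope ereal_scope.
Context d1 d2 (X : measurableType d1) (Y : measurableType d2) (R : realType).
Variable mu : {measure set X -> \bar R}.
Variable phi : X -> Y.
Hypothesis mphi : measurable_fun [set: X] phi.
Variable w : X -> R.
Hypothesis mw : measurable_fun [set: X] w.
Hypothesis w0 : forall x, (0 <= w x)%R.

Let mpre A : measurable A -> measurable (phi @^-1` A).
Proof. by move=> mA; rewrite -[X in measurable X]setTI; exact: mphi. Qed.

Let mwS D : measurable_fun D (fun x => (w x)%:E).
Proof. by apply/measurable_EFinP; exact: measurable_funTS. Qed.

Import HBNNSimple.

(** The hypothesis is the conclusion for indicator functions; it extends to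
    simple functions by linearity and to nonnegative measurable functions by
    monotone convergence. *)
Lemma integral_weighted_pushforward (m : {measure set Y -> \bar R}) :
  (forall A, measurable A -> m A = \int[mu]_(x in phi @^-1` A) (w x)%:E) ->
  forall f : Y -> \bar R, measurable_fun [set: Y] f -> (forall y, 0 <= f y) ->
  \int[m]_y f y = \int[mu]_x (f (phi x) * (w x)%:E).
Proof.
move=> mE f mf f0; pose f_ := nnsfun_approx measurableT mf.
have cf y : (f_ n y)%:E @[n --> \oo] --> f y by apply: cvg_nnsfun_approx.
have indicE (A : set Y) : measurable A ->
    m A = \int[mu]_x ((\1_A (phi x) * w x)%R)%:E.
  move=> mA; rewrite mE// [LHS]integral_mkcond; apply: eq_integral => x _.
  rewrite patchE /indic -[x \in _]/(phi x \in A).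
  by case: (phi x \in A); rewrite ?mul1r ?mul0r.
have step n : \int[m]_y (f_ n y)%:E = \int[mu]_x ((f_ n (phi x) * w x)%R)%:E.
  under eq_integral do rewrite fimfunE -fsumEFin//.
  rewrite ge0_integral_fsum//; last 2 first.
  - by move=> r; exact/measurable_EFinP/measurable_funM.
  - by move=> r x _; rewrite nnfun_muleindic_ge0.
  under [RHS]eq_integral do rewrite fimfunE mulr_fsuml// -fsumEFin//.
  rewrite ge0_integral_fsum//; last 2 first.
  - move=> r; apply/measurable_EFinP/measurable_funM => //.
    apply: measurable_funM => //; exact: measurableT_comp.
  - move=> r x _; rewrite EFinM mule_ge0// ?lee_fin//.
    exact: nnfun_muleindic_ge0.
  apply: eq_fsbigr => r /[!inE] -[y _ fy].
  have r0 : (0 <= r)%R by rewrite -fy.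
  under eq_integral do rewrite EFinM.
  under [RHS]eq_integral do rewrite -mulrA EFinM.
  rewrite !ge0_integralZl_EFin//.
  - by rewrite integral_indic// setIT indicE.
  - move=> x _; rewrite lee_fin mulr_ge0//.
  - apply/measurable_EFinP/measurable_funM => //; exact: measurableT_comp.
  - exact/measurable_EFinP.
rewrite [LHS](_ : _ = limn (fun n => \int[m]_y (f_ n y)%:E)); last first.
  rewrite -monotone_convergence//.
  - by apply: eq_integral => y _; apply/esym/cvg_lim.
  - by move=> n; exact/measurable_EFinP.
  - by move=> n y _; rewrite lee_fin.
  - by move=> y _ a b ab; rewrite lee_fin; exact/lefP/nd_nnsfun_approx.
rewrite (_ : (fun _ => _) =
  (fun n => \int[mu]_x ((f_ n (phi x) * w x)%R)%:E)); last exact/funext.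
rewrite -monotone_convergence//.
- apply: eq_integral => x _; apply/cvg_lim => //.
  under eq_fun do rewrite EFinM.
  apply: cvgeZr => //.
- move=> n; apply/measurable_EFinP/measurable_funM => //.
  exact: measurableT_comp.
- by move=> n x _; rewrite lee_fin mulr_ge0.
- move=> x _ a b ab; rewrite lee_fin ler_wpM2r//.
  exact/lefP/nd_nnsfun_approx.
Qed.

Definition wpush (A : set Y) : \bar R := \int[mu]_(x in phi @^-1` A) (w x)%:E.

Let wpush0 : wpush set0 = 0.
Proof. by rewrite /wpush preimage_set0 integral_set0. Qed.

Let wpush_ge0 A : 0 <= wpush A.
Proof. by apply: integral_ge0 => x _; rewrite lee_fin. Qed.

Let wpush_sigma : semi_sigma_additive wpush.
Proof.
move=> F mF tF mUF; rewrite /wpush preimage_bigcup.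
rewrite ge0_integral_bigcup//=.
- by apply: is_cvg_ereal_nneg_natsum_cond => n _ _; exact: wpush_ge0.
- by move=> k; exact: mpre.
- by move=> x _; rewrite lee_fin.
- apply/trivIsetP => i j _ _ ij; rewrite -preimage_setI.
  by move/trivIsetP : tF => /(_ i j I I ij) ->; rewrite preimage_set0.
Qed.

HB.instance Definition _ := isMeasure.Build _ _ _ wpush
  wpush0 wpush_ge0 wpush_sigma.

Definition wpush_measure : {measure set Y -> \bar R} := wpush.

End weighted_pushforward.

Section line_change_of_variables.
Local Open Scope ereal_scope.
Context {R : realType}.
Local Notation mu := (@lebesgue_measure R).

(** Lebesgue measure is determined by its values on the intervals ]u, v], so
    that a substitution only has to be checked there. *)
Lemma lebesgue_change_of_variables (phi w : measurableTypeR R -> measurableTypeR R) :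
  measurable_fun [set: measurableTypeR R] phi -> measurable_fun [set: measurableTypeR R] w ->
  (forall x, (0 <= w x)%R) ->
  (forall u v : R, (u < v)%R ->
    \int[mu]_(x in phi @^-1` `]u, v]) (w x)%:E = (v - u)%:E) ->
  forall f : measurableTypeR R -> \bar R, measurable_fun [set: measurableTypeR R] f -> (forall y, 0 <= f y) ->
  \int[mu]_y f y = \int[mu]_x (f (phi x) * (w x)%:E).
Proof.
move=> mphi mw w0 H f mf f0; apply: integral_weighted_pushforward => //.
move=> A mA.
apply: (@lebesgue_measure_unique R (wpush_measure mu mphi mw w0)) A mA.
move=> _ [[u v] _ <-]; rewrite lebesgue_measure_itv/= lte_fin.
case: ltP => uv; first by rewrite /wpush_measure/= /wpush H.
rewrite /wpush_measure/= /wpush set_itv_ge ?preimage_set0 ?integral_set0//.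
by rewrite bnd_simp -leNgt.
Qed.

End line_change_of_variables.

Section line_substitutions.
Context {R : realType}.
Local Notation mu := (@lebesgue_measure R).
Local Notation M := (measurableTypeR R).

Lemma FTC2_is_derive (F f : R -> R) (a b : R) : a <= b ->
  (forall x, a <= x <= b -> is_derive x (1 : R) F (f x)) ->
  {within `[a, b], continuous f} ->
  (\int[mu]_(x in `[a, b]) (f x)%:E = (F b - F a)%:E)%E.
Proof.
rewrite le_eqVlt => /predU1P[<- _ _|ab dF cf].
  by rewrite set_itv1 integral_set1 subrr.
have cF x : a <= x <= b -> {for x, continuous F}.
  move=> /dF dFx; apply: differentiable_continuous; apply/derivable1_diffP.
  exact: ex_derive.
rewrite (@continuous_FTC2 _ f F a b ab cf) ?EFinB//.
- split.
  + by move=> x /[!in_itv]/= /andP[/ltW ax /ltW xb]; apply: ex_derive; apply: dF; rewrite ax.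
  + by apply: cvg_at_right_filter; apply: cF; rewrite lexx ltW.
  + by apply: cvg_at_left_filter; apply: cF; rewrite lexx ltW.
- move=> x /[!in_itv]/= /andP[/ltW ax /ltW xb]; rewrite derive1E.
  by apply: derive_val; apply: dF; rewrite ax.
Qed.

Lemma measurable_funV d (T : measurableType d) (f : T -> R) :
  measurable_fun setT f -> measurable_fun setT (fun x => (f x)^-1).
Proof.
move=> mf; apply: (@measurableT_comp _ _ _ _ _ _ (@GRing.inv R : M -> M)) => //.
have mN0 : measurable (~` [set (0 : R)]) by exact: measurableC.
rewrite -(setUv [set (0 : R)]); apply/measurable_funU => //; split.
  exact: measurable_fun_set1.
apply: open_continuous_measurable_fun.
  by apply: closed_openC; exact: closed_eq.
by move=> x; rewrite inE/= => /eqP x0; exact: inv_continuous.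
Qed.

Lemma integral_affine (a b : R) (f : M -> \bar R) : a != 0 ->
  measurable_fun [set: M] f -> (forall y, 0 <= f y)%E ->
  (\int[mu]_y f y = \int[mu]_x (f (a * x + b)%R * (`|a|)%:E))%E.
Proof.
move=> a0 mf f0.
apply: (@lebesgue_change_of_variables R (fun x => a * x + b : M) (cst `|a| : M -> M)) => //.
  apply: measurable_funD => //; exact: measurable_funM.
move=> u v uv.
rewrite [LHS](@integral_cst _ _ _ mu _ _ (`|a|%:E)%E); last first.
  rewrite -[X in measurable X]setTI.
  by apply: (@measurable_funD _ _ _ _ (fun x : M => a * x) (cst b)) => //;
    exact: measurable_funM.
have [ap|an|/eqP] := ltrgt0P a; last by rewrite (negbTE a0).
- transitivity (a%:E * mu `]((u - b) / a)%R, ((v - b) / a)%R]%classic)%E.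
    congr (_ * mu _)%E; apply/seteqP; split => x /=; rewrite !in_itv/= ltr_pdivrMr// ler_pdivlMr//.
      by rewrite ltrBlDr lerBrDr mulrC.
    by rewrite ltrBlDr lerBrDr mulrC.
  rewrite lebesgue_measure_itv/= lte_fin ltr_pM2r ?invr_gt0// ltrD2r uv.
  by rewrite -EFinB -EFinM; congr EFin; field.
- transitivity ((- a)%R%:E * mu `[((v - b) / a)%R, ((u - b) / a)%R[%classic)%E.
    congr (_ * mu _)%E; apply/seteqP; split => x /=; rewrite !in_itv/= ltr_ndivlMr// ler_ndivrMr//.
      by rewrite ltrBlDr lerBrDr mulrC andbC.
    by rewrite ltrBlDr lerBrDr mulrC andbC.
  rewrite lebesgue_measure_itv/= lte_fin ltr_nM2r ?invr_lt0// ltrD2r uv.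
  by rewrite -EFinB -EFinM; congr EFin; field.
Qed.

(** The derivative of [tan] on the period that it maps onto the line. *)
Definition tan_weight : M -> M :=
  fun t => (cos t ^+ 2)^-1 * \1_(`](- (pi / 2)), (pi / 2)[ : set M) t.

Lemma integral_tan (f : M -> \bar R) :
  measurable_fun [set: M] f -> (forall y, 0 <= f y)%E ->
  (\int[mu]_y f y = \int[mu]_t (f (tan t) * (tan_weight t)%:E))%E.
Proof.
move=> mf f0.
have mcos : measurable_fun [set: M] (cos : M -> M).
  by apply: continuous_measurable_fun; exact: continuous_cos.
have msin : measurable_fun [set: M] (sin : M -> M).
  by apply: continuous_measurable_fun; exact: continuous_sin.
apply: (@lebesgue_change_of_variables R (tan : M -> M) tan_weight) => //.
- by apply: measurable_funM => //; exact: measurable_funV.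
- apply: measurable_funM; first by apply: measurable_funV; exact: measurable_funX.
  by apply: measurable_indic; exact: measurable_itv.
- by move=> t; rewrite mulr_ge0// invr_ge0 sqr_ge0.
move=> u v uv.
have auv : atan u < atan v by exact: lt_atan.
have mD : {in `[atan u, atan v], forall x, cos x != 0}.
  move=> x /[!in_itv]/= /andP[ux xv]; rewrite gt_eqF//; apply: cos_gt0_pihalf.
  by rewrite (lt_le_trans (atan_gtNpi2 u))//= (le_lt_trans xv)// atan_ltpi2.
transitivity (\int[mu]_(t in `]atan u, atan v]) ((cos t ^+ 2)^-1)%:E)%E.
  rewrite /tan_weight; under eq_integral do rewrite EFinM.
  rewrite -__deprecated__integral_setI_indic//; last 1 first.
  - rewrite -[X in measurable X]setTI.
    by apply: (measurable_funM msin (measurable_funV mcos)).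
  congr (integral _ _ _); apply/seteqP; split => t /=; rewrite !in_itv/=.
    move=> [/andP[ut tv] tp]; rewrite -(@tanK _ t); last by rewrite in_itv.
    by rewrite lt_atan//= le_atan.
  move=> /andP[ut tv].
  have tp : - (pi / 2) < t < pi / 2.
    by rewrite (lt_trans (atan_gtNpi2 u))//= (le_lt_trans tv)// atan_ltpi2.
  have tK : atan (tan t) = t by rewrite tanK// in_itv.
  split => //; apply/andP; split.
    by rewrite ltNge; apply/negP => h; move: (le_atan h); rewrite tK leNgt ut.
  by rewrite leNgt; apply/negP => h; move: (lt_atan h); rewrite tK ltNge tv.
rewrite integral_itv_obnd_cbnd; last first.
  apply/measurable_EFinP; apply: measurable_funTS; apply: measurable_funV.
  exact: measurable_funX.
transitivity (tan (atan v) - tan (atan u))%:E; last by rewrite !atanK.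
apply: (@FTC2_is_derive tan (fun t => cos t ^- 2)); first exact: ltW.
  by move=> x xuv; apply: is_derive_tan; apply: mD; rewrite in_itv.
apply/continuous_in_subspaceT => x /[!inE] /= xuv.
apply: (@continuousV _ _ (fun t => cos t ^+ 2)); first by rewrite expf_neq0// mD.
apply: (@continuous_comp _ _ _ cos (fun y => y ^+ 2) x); first exact: continuous_cos.
exact: exprn_continuous.
Qed.

End line_substitutions.

(** * Polar coordinates in the plane *)

Section polar.
Context {R : realType}.
Local Notation mu := (@lebesgue_measure R).
Local Notation M := (measurableTypeR R).

Definition half_turn : M -> M := \1_(`](- (pi / 2)), (pi / 2)[ : set M).

(** The weight r dr of polar coordinates, extended by 0 to negative r, so that
    all integrals run over the whole line. *)
Definition pos_part (y : M) : M := Num.max y 0.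

Lemma measurable_pos_part : measurable_fun [set: M] pos_part.
Proof. exact: measurable_maxr. Qed.

Lemma pos_part_ge0 y : 0 <= pos_part y.
Proof. by rewrite /pos_part le_max lexx orbT. Qed.

Lemma pos_partZ (c y : R) : 0 <= c -> pos_part (y * c) = pos_part y * c.
Proof. by move=> c0; rewrite /pos_part maxr_pMl// mul0r. Qed.

Lemma measurable_sin : measurable_fun [set: M] (sin : M -> M).
Proof. by apply: continuous_measurable_fun; exact: continuous_sin. Qed.

Lemma measurable_cos : measurable_fun [set: M] (cos : M -> M).
Proof. by apply: continuous_measurable_fun; exact: continuous_cos. Qed.

Lemma measurable_half_turn : measurable_fun [set: M] half_turn.
Proof. by apply: measurable_indic; exact: measurable_itv. Qed.

Definition upper : M -> M := \1_(`]0, +oo[ : set M).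

(** Three substitutions in one variable: x = y u for fixed y > 0, u = tan t, and
    y = r cos t for fixed t.  Their factors y, 1 / cos^2 t and cos t multiply to
    r.  The angle is measured from the vertical axis, because the slope x / y is
    then its tangent. *)
Lemma half_plane_polar_vertical (f : M * M -> \bar R) :
  measurable_fun [set: M * M] f -> (forall p, 0 <= f p)%E ->
  (\int[mu]_x \int[mu]_y (f (x, y) * (upper y)%:E) =
   \int[mu]_r \int[mu]_t
     (f (r * sin t, r * cos t)%R * (pos_part r)%:E * (half_turn t)%:E))%E.
Proof.
move=> mf f0.
have mup : measurable_fun [set: M] upper.
  by apply: measurable_indic; exact: measurable_itv.
have mtan : measurable_fun [set: M] (tan : M -> M).
  by apply: measurable_funM; [exact: measurable_sin|apply: measurable_funV; exact: measurable_cos].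
have mfst : measurable_fun [set: M * M] (fst : M * M -> M) := measurable_fst.
have msnd : measurable_fun [set: M * M] (snd : M * M -> M) := measurable_snd.
rewrite (fubini_tonelli (fun p => f p * (upper p.2)%:E)%E)/=; last 2 first.
- apply: emeasurable_funM => //; apply/measurable_EFinP.
  exact: measurableT_comp.
- by move=> p; rewrite mule_ge0// lee_fin.
pose g (p : M * M) : \bar R := (f ((p.1 * p.2)%R : M, p.1) * (pos_part p.1)%:E)%E.
have g0 p : (0 <= g p)%E by rewrite mule_ge0// lee_fin pos_part_ge0.
have mg : measurable_fun [set: M * M] g.
  apply: emeasurable_funM.
    apply: (measurableT_comp mf); apply: measurable_fun_pair => //.
    exact: measurable_funM.
  apply/measurable_EFinP; apply: measurableT_comp => //; exact: measurable_pos_part.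
transitivity (\int[mu]_y \int[mu]_u g (y, u))%E.
  apply: eq_integral => y _; rewrite /g/=.
  have [y0|y0] := ltP 0 y; last first.
    rewrite !integral0_eq// => u _.
      by rewrite /pos_part max_r// mule0.
    by rewrite /upper indicE memNset ?mule0//= in_itv/= andbT; apply/negP; rewrite -leNgt.
  rewrite (@integral_affine _ y 0) ?gt_eqF//; last 2 first.
  - apply: emeasurable_funM => //.
    exact: (measurableT_comp mf (measurable_fun_pair _ _)).
  - by move=> x; rewrite mule_ge0// lee_fin.
  apply: eq_integral => u _; rewrite addr0 gtr0_norm// /pos_part max_l ?ltW//.
  by rewrite /upper indicE mem_set/= ?mule1// in_itv/= y0.
rewrite fubini_tonelli//.
rewrite (@integral_tan _ (fun u => \int[mu]_y g (y, u)))%E; last 2 first.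
- exact: measurable_fun_fubini_tonelli_G.
- by move=> u; apply: integral_ge0.
pose h (p : M * M) : \bar R := (f (p.1 * sin p.2, p.1 * cos p.2)%R * (pos_part p.1)%:E * (half_turn p.2)%:E)%E.
have mh : measurable_fun [set: M * M] h.
  apply: emeasurable_funM; last first.
    apply/measurable_EFinP; apply: measurableT_comp => //; exact: measurable_half_turn.
  apply: emeasurable_funM.
    apply: (measurableT_comp mf); apply: measurable_fun_pair; apply: measurable_funM => //.
      by apply: measurableT_comp => //; exact: measurable_sin.
    by apply: measurableT_comp => //; exact: measurable_cos.
  apply/measurable_EFinP; apply: measurableT_comp => //; exact: measurable_pos_part.
have h0 p : (0 <= h p)%E.
  by rewrite !mule_ge0 ?lee_fin ?pos_part_ge0 /half_turn ?indicE ?ler0n.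
transitivity (\int[mu]_t \int[mu]_r h (r, t))%E; last by rewrite (fubini_tonelli h).
apply: eq_integral => t _.
have [tp|tp] := boolP (t \in `](- (pi / 2)), (pi / 2)[); last first.
  have t0 : (\1_(`](- (pi / 2)), (pi / 2)[ : set M) t : R) = 0.
    by rewrite indicE memNset//; apply/negP.
  rewrite /tan_weight t0 mulr0 mule0 integral0_eq// => r _.
  by rewrite /h /half_turn t0 mule0.
have c0 : 0 < cos t by apply: cos_gt0_pihalf; move: tp; rewrite in_itv.
have t1 : (\1_(`](- (pi / 2)), (pi / 2)[ : set M) t : R) = 1.
  by rewrite indicE mem_set.
rewrite (@integral_affine _ (cos t) 0) ?gt_eqF//; last first.
  exact: (measurableT_comp mg (measurable_fun_pair _ _)).
rewrite -ge0_integralZr//=; last 3 first.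
- apply: emeasurable_funM => //; apply: (measurableT_comp mg).
  apply: measurable_fun_pair => //; apply: measurable_funD => //.
- by move=> r _; rewrite mule_ge0// lee_fin.
- by rewrite lee_fin /tan_weight t1 mulr1 invr_ge0 sqr_ge0.
apply: eq_integral => r _; rewrite /g /h /half_turn /= t1 mule1 addr0.
rewrite /tan_weight t1 mulr1 gtr0_norm// (mulrC (cos t) r) pos_partZ ?ltW//.
have -> : r * cos t * tan t = r * sin t by rewrite /tan; field; rewrite gt_eqF.
rewrite -!muleA -!EFinM; congr (_ * _%:E)%E; field; by rewrite gt_eqF.
Qed.

End polar.

Section polar3.
Context {R : realType}.
Local Notation mu := (@lebesgue_measure R).
Local Notation M := (measurableTypeR R).

Definition turn : M -> M := \1_(`]0, pi[ : set M).

Lemma measurable_turn : measurable_fun [set: M] turn.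
Proof. by apply: measurable_indic; exact: measurable_itv. Qed.

Lemma turn_ge0 t : 0 <= turn t.
Proof. by rewrite /turn indicE ler0n. Qed.

Lemma measurable_upper : measurable_fun [set: M] (@upper R).
Proof. by apply: measurable_indic; exact: measurable_itv. Qed.

Lemma upper_ge0 t : 0 <= @upper R t.
Proof. by rewrite /upper indicE ler0n. Qed.

Lemma half_turnE (t : R) : half_turn (- 1 * t + pi / 2) = turn t.
Proof.
rewrite /half_turn /turn !indicE; congr (_%:R); congr nat_of_bool.
apply/idP/idP; rewrite !inE/= !in_itv/= => /andP[? ?]; apply/andP; split; lra.
Qed.

(** The angle is now measured from the horizontal axis, by t -> pi / 2 - t. *)
Lemma half_plane_polar (f : M * M -> \bar R) :
  measurable_fun [set: M * M] f -> (forall p, 0 <= f p)%E ->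
  (\int[mu]_x \int[mu]_y (f (x, y) * (upper y)%:E) =
   \int[mu]_r \int[mu]_t
     (f (r * cos t, r * sin t)%R * (pos_part r)%:E * (turn t)%:E))%E.
Proof.
move=> mf f0; rewrite (half_plane_polar_vertical mf f0); apply: eq_integral => r _.
rewrite (@integral_affine _ (-1) (pi / 2)) ?oppr_eq0 ?oner_neq0//; last 2 first.
- apply: emeasurable_funM; last by apply/measurable_EFinP; exact: measurable_half_turn.
  apply: emeasurable_funM => //; apply: (measurableT_comp mf).
  apply: measurable_fun_pair; apply: measurable_funM => //.
    exact: measurable_sin.
  exact: measurable_cos.
- by move=> t; rewrite !mule_ge0 ?lee_fin ?pos_part_ge0 /half_turn ?indicE ?ler0n.
apply: eq_integral => t _; rewrite half_turnE normrN1 mule1.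
by rewrite !mulN1r sinDpihalf cosDpihalf cosN sinN opprK.
Qed.

Lemma integral_opp (f : M -> \bar R) :
  measurable_fun [set: M] f -> (forall y, 0 <= f y)%E ->
  (\int[mu]_y f y = \int[mu]_y f (- y)%R)%E.
Proof.
move=> mf f0; rewrite (@integral_affine _ (-1) 0) ?oppr_eq0 ?oner_neq0//.
by apply: eq_integral => y _; rewrite normrN1 mule1 mulN1r addr0.
Qed.

Lemma integral_upper_lower (f : M -> \bar R) :
  measurable_fun [set: M] f -> (forall y, 0 <= f y)%E ->
  (\int[mu]_y f y = \int[mu]_y (f y * (upper y)%:E) + \int[mu]_y (f (- y)%R * (upper y)%:E))%E.
Proof.
move=> mf f0; have mN : measurable_fun [set: M] (-%R : M -> M) by exact: oppr_measurable.
rewrite [X in (_ + X)%E]integral_opp; last 2 first.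
- apply: emeasurable_funM; first exact: measurableT_comp.
  apply/measurable_EFinP; exact: measurable_upper.
- by move=> y; rewrite mule_ge0// lee_fin upper_ge0.
rewrite -ge0_integralD//=; last 4 first.
- by move=> y _; rewrite mule_ge0// lee_fin upper_ge0.
- apply: emeasurable_funM => //; apply/measurable_EFinP; exact: measurable_upper.
- by move=> y _; rewrite mule_ge0// lee_fin upper_ge0.
- apply: emeasurable_funM; first by do 2 apply: measurableT_comp => //.
  by apply/measurable_EFinP; apply: measurableT_comp => //; exact: measurable_upper.
have mr : measurable_fun [set: M] (fun y => f y * (upper y)%:E +
    f (- - y)%R * (upper (- y)%R)%:E)%E.
  apply: emeasurable_funD; apply: emeasurable_funM => //.
  - apply/measurable_EFinP; exact: measurable_upper.
  - by do 2 apply: measurableT_comp => //.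
  - by apply/measurable_EFinP; apply: measurableT_comp => //; exact: measurable_upper.
have mD : measurable ([set: M] `\ (0 : R)) by exact: measurableD.
rewrite -(@integral_setD1 _ f 0)//; last exact: measurable_funTS.
rewrite -[RHS](@integral_setD1 _ _ 0)//; last exact: measurable_funTS.
apply: eq_integral => y; rewrite inE/= => -[_ /eqP y0].
rewrite opprK /upper !indicE.
have [y1|y1] := ltP 0 y.
  rewrite mem_set/= ?in_itv/= ?y1// memNset/= ?mule1 ?mule0 ?adde0//.
  by rewrite in_itv/= oppr_gt0 andbT; apply/negP; rewrite -leNgt ltW.
rewrite memNset/= ?in_itv/= ?andbT; last by apply/negP; rewrite -leNgt.
by rewrite mem_set/= ?mule1 ?mule0 ?add0e// in_itv/= oppr_gt0 lt_neqAle y0 y1.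
Qed.

End polar3.

Section polar3.
Context {R : realType}.
Local Notation mu := (@lebesgue_measure R).
Local Notation M := (measurableTypeR R).

Lemma emeasurable_funEFinr d (T : measurableType d) (f : T -> \bar R) (w : T -> R) :
  measurable_fun setT f -> measurable_fun setT w ->
  measurable_fun setT (fun x => f x * (w x)%:E)%E.
Proof. by move=> mf mw; apply: emeasurable_funM => //; exact/measurable_EFinP. Qed.

(** The lower half-plane is the image of the upper one under the central
    symmetry; the second summand stands for the angles t + pi. *)
Lemma plane_polar (f : M * M -> \bar R) :
  measurable_fun [set: M * M] f -> (forall p, 0 <= f p)%E ->
  (\int[mu]_x \int[mu]_y f (x, y) =
   \int[mu]_r (\int[mu]_t ((f (r * cos t, r * sin t)%R + f (- (r * cos t), - (r * sin t))%R) *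
      (turn t)%:E) * (pos_part r)%:E))%E.
Proof.
move=> mf f0.
have mN : measurable_fun [set: M] (-%R : M -> M) by exact: oppr_measurable.
have mup := @measurable_upper R.
have mfst : measurable_fun [set: M * M] (fst : M * M -> M) := measurable_fst.
have msnd : measurable_fun [set: M * M] (snd : M * M -> M) := measurable_snd.
pose fN (p : M * M) := f (- p.1, - p.2)%R.
have mfN : measurable_fun [set: M * M] fN.
  by apply: (measurableT_comp mf); apply: measurable_fun_pair; exact: measurableT_comp.
have mfy x : measurable_fun [set: M] (fun y => f (x, y)).
  exact: (measurableT_comp mf (measurable_fun_pair _ _)).
have mfu (g : M * M -> \bar R) : measurable_fun [set: M * M] g ->
    measurable_fun [set: M * M] (fun p => g p * (upper p.2)%:E)%E.
  by move=> mg; apply: emeasurable_funEFinr => //; exact: measurableT_comp.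
have pu0 (g : M * M -> \bar R) : (forall p, 0 <= g p)%E -> forall p, (0 <= g p * (upper p.2)%:E)%E.
  by move=> g0 p; rewrite mule_ge0// lee_fin upper_ge0.
have fN0 p : (0 <= fN p)%E by exact: f0.
have mfN1 : measurable_fun [set: M * M] (fun p : M * M => fN (- p.1, p.2)%R).
  by apply: (measurableT_comp mfN); apply: measurable_fun_pair => //; exact: measurableT_comp.
transitivity (\int[mu]_x \int[mu]_y (f (x, y) * (upper y)%:E) +
    \int[mu]_x \int[mu]_y (fN (x, y) * (upper y)%:E))%E.
  rewrite [X in (_ + X)%E]integral_opp; last 2 first.
  - exact: (measurable_fun_fubini_tonelli_F _ (mfu _ mfN) (pu0 _ fN0)).
  - by move=> x; apply: integral_ge0 => y _; exact: (pu0 fN fN0 (x, y)).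
  rewrite -ge0_integralD//=; last 4 first.
  - by move=> x _; apply: integral_ge0 => y _; exact: (pu0 f f0 (x, y)).
  - exact: (measurable_fun_fubini_tonelli_F _ (mfu _ mf) (pu0 _ f0)).
  - by move=> x _; apply: integral_ge0 => y _; exact: (pu0 fN fN0 (- x, y)%R).
  - exact: (measurable_fun_fubini_tonelli_F _ (mfu _ mfN1) (pu0 _ (fun p => f0 _))).
  apply: eq_integral => x _; rewrite integral_upper_lower// /fN /=.
  by under [X in (_ = _ + X)%E]eq_integral do rewrite opprK.
rewrite (half_plane_polar mf f0) (half_plane_polar mfN) /=; last by move=> p; exact: f0.
have mc (g : M * M -> \bar R) : measurable_fun [set: M * M] g ->
  measurable_fun [set: M * M] (fun q : M * M =>
    g (q.1 * cos q.2, q.1 * sin q.2)%R * (pos_part q.1)%:E * (turn q.2)%:E)%E.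
  move=> mg; apply: emeasurable_funEFinr; last by apply: measurableT_comp => //; exact: measurable_turn.
  apply: emeasurable_funEFinr; last by apply: measurableT_comp => //; exact: measurable_pos_part.
  apply: (measurableT_comp mg); apply: measurable_fun_pair; apply: measurable_funM => //.
    by apply: measurableT_comp => //; exact: measurable_cos.
  by apply: measurableT_comp => //; exact: measurable_sin.
have pc (g : M * M -> \bar R) : (forall p, 0 <= g p)%E -> forall q : M * M,
    (0 <= g (q.1 * cos q.2, q.1 * sin q.2)%R * (pos_part q.1)%:E * (turn q.2)%:E)%E.
  by move=> g0 q; rewrite !mule_ge0 ?g0 ?lee_fin ?pos_part_ge0 ?turn_ge0.
rewrite -ge0_integralD//=; last 4 first.
- by move=> r _; apply: integral_ge0 => t _; exact: (pc f f0 (r, t)).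
- exact: (measurable_fun_fubini_tonelli_F _ (mc _ mf) (pc _ f0)).
- by move=> r _; apply: integral_ge0 => t _; exact: (pc fN fN0 (r, t)).
- exact: (measurable_fun_fubini_tonelli_F _ (mc _ mfN) (pc _ fN0)).
have ms (g : M * M -> \bar R) r : measurable_fun [set: M * M] g ->
    measurable_fun [set: M] (fun t => g (r * cos t, r * sin t)%R).
  move=> mg; apply: (measurableT_comp mg); apply: measurable_fun_pair; apply: measurable_funM => //.
    exact: measurable_cos.
  exact: measurable_sin.
have mcs (g : M * M -> \bar R) r : measurable_fun [set: M * M] g ->
    measurable_fun [set: M] (fun t => g (r * cos t, r * sin t)%R * (pos_part r)%:E * (turn t)%:E)%E.
  move=> mg; apply: emeasurable_funEFinr; last exact: measurable_turn.
  by apply: emeasurable_funEFinr => //; exact: ms.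
apply: eq_integral => r _; rewrite -ge0_integralD//=; last 4 first.
- by move=> t _; exact: (pc f f0 (r, t)).
- exact: mcs.
- by move=> t _; exact: (pc fN fN0 (r, t)).
- exact: (mcs fN).
rewrite -ge0_integralZr//=; last 3 first.
- apply: emeasurable_funEFinr; last exact: measurable_turn.
  by apply: emeasurable_funD; [exact: ms|exact: (ms fN)].
- by move=> t _; rewrite mule_ge0 ?adde_ge0 ?lee_fin ?turn_ge0.
- by rewrite lee_fin pos_part_ge0.
apply: eq_integral => t _; rewrite /fN/= -!muleA (muleC (turn t)%:E).
by rewrite -ge0_muleDl.
Qed.

End polar3.

(** * Spherical coordinates *)

Section lebesgue2.
Context (R : realType).
Local Notation mu := (@lebesgue_measure R).
Local Notation M := (measurableTypeR R).

(** A name for the product measure, to which sigma-finiteness is attached for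
    the use of Tonelli's theorem with the third variable. *)
Definition lebesgue2 : set (M * M)%type -> \bar R := (mu \x mu)%E.

HB.instance Definition _ := Measure.on lebesgue2.

Let sigma_finite_lebesgue2 : sigma_finite setT lebesgue2.
Proof.
have /sigma_finiteP[F [TF ndF Foo]] := sigma_finiteT mu.
exists (fun n => F n `*` F n).
  rewrite -setXTT TF predeqE => -[x y]; split.
    move=> [/= [n _ Fnx] [k _ Fky]]; exists (maxn n k) => //; split.
      by move: x Fnx; exact/subsetPset/ndF/leq_maxl.
    by move: y Fky; exact/subsetPset/ndF/leq_maxr.
  by move=> [n _ []/= ? ?]; split; exists n.
move=> k; have [? ?] := Foo k; split; first exact: measurableX.
by rewrite [ltLHS]product_measure1E// lte_mul_pinfty// ge0_fin_numE.
Qed.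

HB.instance Definition _ := Measure_isSigmaFinite.Build _ _ _ lebesgue2
  sigma_finite_lebesgue2.

Lemma space_fubini (F : M * M * M -> \bar R) :
  measurable_fun [set: M * M * M] F -> (forall x, 0 <= F x)%E ->
  (\int[@lebesgue3 R]_x F x = \int[mu]_z \int[mu]_x \int[mu]_y F (x, y, z))%E.
Proof.
move=> mF F0.
transitivity (\int[lebesgue2 \x mu]_x F x)%E; first by [].
rewrite (fubini_tonelli2 F mF F0); apply: eq_integral => z _.
have mFz : measurable_fun [set: M * M] (fun p => F (p, z)).
  exact: (measurableT_comp mF (measurable_fun_pair _ _)).
exact: (fubini_tonelli1 (m1 := mu) (m2 := mu) (fun p => F (p, z)) mFz (fun p => F0 (p, z))).
Qed.
End lebesgue2.

Section polar3.
Context {R : realType}.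
Local Notation mu := (@lebesgue_measure R).
Local Notation M := (measurableTypeR R).

(** The integral over the horizontal circle of radius p.2 at height p.1; the two
    summands are its two halves. *)
Definition azimuth_integral (F : M * M * M -> \bar R) (p : M * M) : \bar R :=
  (\int[mu]_t ((F (p.2 * cos t, p.2 * sin t, p.1)%R +
                F (- (p.2 * cos t), - (p.2 * sin t), p.1)%R) * (turn t)%:E))%E.

Lemma azimuth_integral_ge0 F p : (forall x, 0 <= F x)%E -> (0 <= azimuth_integral F p)%E.
Proof.
move=> F0; apply: integral_ge0 => t _.
by rewrite mule_ge0 ?adde_ge0 ?F0 ?lee_fin ?turn_ge0.
Qed.

Lemma measurable_azimuth_integral F : measurable_fun [set: M * M * M] F ->
  (forall x, 0 <= F x)%E -> measurable_fun [set: M * M] (azimuth_integral F).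
Proof.
move=> mF F0.
pose G (q : (M * M) * M) : \bar R :=
  ((F (q.1.2 * cos q.2, q.1.2 * sin q.2, q.1.1)%R +
                F (- (q.1.2 * cos q.2), - (q.1.2 * sin q.2), q.1.1)%R) * (turn q.2)%:E)%E.
have mfst : measurable_fun [set: M * M * M] (fun q => q.1.1 : M) by exact: (measurableT_comp measurable_fst measurable_fst).
have msnd : measurable_fun [set: M * M * M] (fun q => q.1.2 : M) by exact: (measurableT_comp measurable_snd measurable_fst).
have mc : measurable_fun [set: M * M * M] (fun q => q.1.2 * cos q.2 : M).
  by apply: measurable_funM => //; apply: measurableT_comp => //; exact: measurable_cos.
have ms : measurable_fun [set: M * M * M] (fun q => q.1.2 * sin q.2 : M).
  by apply: measurable_funM => //; apply: measurableT_comp => //; exact: measurable_sin.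
have mN : measurable_fun [set: M] (-%R : M -> M) by exact: oppr_measurable.
have mG : measurable_fun [set: (M * M) * M] G.
  apply: emeasurable_funEFinr; last by apply: measurableT_comp => //; exact: measurable_turn.
  apply: emeasurable_funD; apply: (measurableT_comp mF).
    by apply: measurable_fun_pair => //; exact: measurable_fun_pair.
  by apply: measurable_fun_pair => //; apply: measurable_fun_pair; exact: (measurableT_comp mN).
apply: (measurable_fun_fubini_tonelli_F G mG) => q.
by rewrite /G mule_ge0 ?adde_ge0 ?F0 ?lee_fin ?turn_ge0.
Qed.

(** Polar coordinates in the horizontal plane, followed by polar coordinates in
    the half-plane of the pairs (z, rho), rho > 0, with rho the distance to the
    vertical axis.  The factor sin t comes from rho = r sin t. *)
Lemma space_polar (F : M * M * M -> \bar R) :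
  measurable_fun [set: M * M * M] F -> (forall x, 0 <= F x)%E ->
  (\int[@lebesgue3 R]_x F x =
   \int[mu]_r ((\int[mu]_t (azimuth_integral F (r * cos t, r * sin t)%R *
       (sin t * turn t)%:E)) * (pos_part r ^+ 2)%:E))%E.
Proof.
move=> mF F0.
rewrite (space_fubini mF F0).
pose H (p : M * M) := (azimuth_integral F p * (pos_part p.2)%:E)%E.
have mH : measurable_fun [set: M * M] H.
  apply: emeasurable_funEFinr; first exact: measurable_azimuth_integral.
  by apply: measurableT_comp => //; exact: measurable_pos_part.
have H0 p : (0 <= H p)%E.
  by rewrite mule_ge0 ?azimuth_integral_ge0 ?lee_fin ?pos_part_ge0.
transitivity (\int[mu]_z \int[mu]_y (H (z, y) * (upper y)%:E))%E.
  apply: eq_integral => z _.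
  have mFz : measurable_fun [set: M * M] (fun p => F (p, z)).
    exact: (measurableT_comp mF (measurable_fun_pair _ _)).
  rewrite (plane_polar mFz)//.
  apply: eq_integral => r _; rewrite /H/= -muleA -EFinM; congr (_ * _%:E)%E.
  rewrite /pos_part /upper indicE; have [r0|r0] := ltP 0 r; last first.
    by rewrite mul0r.
  by rewrite mem_set ?mulr1//= in_itv/= r0.
rewrite (half_plane_polar mH H0); apply: eq_integral => r _.
have sinT t : 0 <= sin t * turn t.
  have [tp|tp] := boolP (t \in `]0, pi[).
    rewrite mulr_ge0 ?turn_ge0// sin_ge0_pi//.
    by move: tp; rewrite in_itv/= => /andP[/ltW -> /ltW ->].
  rewrite /turn indicE memNset/= ?mulr0//; exact/negP.
rewrite -ge0_integralZr//=; last 3 first.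
- apply: emeasurable_funEFinr; last first.
    by apply: measurable_funM; [exact: measurable_sin|exact: measurable_turn].
  apply: (measurableT_comp (measurable_azimuth_integral mF F0)).
  apply: measurable_fun_pair; apply: measurable_funM => //.
    exact: measurable_cos.
  exact: measurable_sin.
- by move=> t _; rewrite mule_ge0 ?azimuth_integral_ge0 ?lee_fin ?sinT.
- by rewrite lee_fin sqr_ge0.
apply: eq_integral => t _; rewrite /H/= -!muleA -!EFinM; congr (_ * _%:E)%E.
have [tp|tp] := boolP (t \in `]0, pi[); last first.
  by rewrite /turn indicE memNset/= ?mulr0 ?mul0r//; exact/negP.
rewrite pos_partZ; first by ring.
by rewrite sin_ge0_pi//; move: tp; rewrite in_itv/= => /andP[/ltW -> /ltW ->].
Qed.

End polar3.

(** * Integrals of separated functions over the ball and the sphere *)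

Section separated.
Context {R : realType}.
Local Notation mu := (@lebesgue_measure R).
Local Notation M := (measurableTypeR R).

Lemma continuous_itv_integrable (c : R -> R) (a b : R) : continuous c ->
  mu.-integrable `[a, b] (EFin \o c).
Proof.
move=> cc; apply: continuous_compact_integrable; first exact: segment_compact.
exact: continuous_subspaceT.
Qed.

Lemma integral_continuous_itv (c : R -> R) (a b : R) : continuous c ->
  (\int[mu]_(t in `[a, b]) (c t)%:E = (\int[mu]_(t in `[a, b]) c t)%:E)%E.
Proof.
move=> cc; rewrite fineK//.
by apply: integrable_fin_num => //; exact: continuous_itv_integrable.
Qed.

(** The weights of the coordinate systems vanish on one or the other side of
    the end points of their intervals; the end points do not affect the
    integral. *)
Lemma integral_indic_itv (f : M -> \bar R) (c : R -> R) (a b : R) (b0 b1 : bool) :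
  continuous c -> a <= b ->
  (forall t, t \in `]a, b[ -> f t = (c t)%:E) ->
  (forall t, t \notin Interval (BSide b0 a) (BSide b1 b) -> f t = 0%E) ->
  (\int[mu]_t f t = (\int[mu]_(t in `[a, b]) c t)%:E)%E.
Proof.
move=> cc ab fc f0.
have mc : measurable_fun [set: M] (fun t => (c t)%:E).
  by apply/measurable_EFinP; apply: continuous_measurable_fun.
rewrite -integral_continuous_itv// (integral_itv_bndoo true false); last exact: measurable_funTS.
transitivity (\int[mu]_(t in [set` Interval (BSide b0 a) (BSide b1 b)]) f t)%E.
  rewrite [RHS]integral_mkcond; apply: eq_integral => t _.
  rewrite patchE; case: ifPn => //; rewrite mem_setE => tn.
  by rewrite f0.
rewrite integral_itv_bndoo; last first.
  apply: (eq_measurable_fun (fun t => (c t)%:E)); last exact: measurable_funTS.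
  by move=> t; rewrite mem_setE => /fc.
by apply: eq_integral => t; rewrite mem_setE => /fc.
Qed.

Lemma measurable_sphere_weight : measurable_fun [set: M * M]
  (fun p => sin p.1 * \1_(@angles R) p).
Proof.
apply: measurable_funM; first by apply: measurableT_comp => //; exact: measurable_sin.
by apply: measurable_indic; exact: measurable_angles.
Qed.

Lemma integral_surface (f : R3 R -> \bar R) :
  measurable_fun [set: R3 R] f -> (forall x, 0 <= f x)%E ->
  (\int[@surface_measure R]_x f x =
   \int[mu]_t \int[mu]_s (f (spherical (t, s)) * (sin t * \1_(@angles R) (t, s))%:E))%E.
Proof.
move=> mf f0.
have w0 p : 0 <= sin p.1 * \1_(@angles R) p.
  rewrite indicE; have [pa|_] := boolP (p \in @angles R); last by rewrite mulr0.
  by rewrite mulr1 sin_angles_ge0//; rewrite inE in pa.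
have mE A : measurable A -> (@surface_measure R A =
    \int[mu \x mu]_(p in @spherical R @^-1` A) (sin p.1 * \1_(@angles R) p)%:E)%E.
  move=> mA; rewrite [LHS]integral_mkcondl; apply: eq_integral => p _.
  by rewrite patchE indicE; case: (p \in _); rewrite ?mulr1 ?mulr0.
rewrite (@integral_weighted_pushforward _ _ _ _ R _ (@spherical R)
  (@measurable_spherical R) _ measurable_sphere_weight w0 _ mE f mf f0).
rewrite (fubini_tonelli1 (m1 := mu) (m2 := mu) (fun p => f (spherical p) *
  (sin p.1 * \1_(@angles R) p)%:E)%E)//.
  apply: emeasurable_funEFinr; last exact: measurable_sphere_weight.
  by apply: measurableT_comp => //; exact: measurable_spherical.
by move=> p; rewrite mule_ge0// lee_fin.
Qed.

End separated.

Section separated.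
Context {R : realType}.
Local Notation mu := (@lebesgue_measure R).

Lemma continuous_shift (f : R -> R) (c : R) : continuous f -> continuous (fun x => f (x + c)).
Proof.
move=> cf x; apply: continuous_comp; last exact: cf.
by apply: continuousD => //; exact: cst_continuous.
Qed.

Lemma continuous_mulr (f g : R -> R) : continuous f -> continuous g -> continuous (fun x => f x * g x).
Proof. by move=> cf cg x; apply: continuousM; [exact: cf|exact: cg]. Qed.

Lemma continuous_addr (f g : R -> R) : continuous f -> continuous g -> continuous (fun x => f x + g x).
Proof. by move=> cf cg x; apply: continuousD; [exact: cf|exact: cg]. Qed.

Lemma continuous_cstr (c : R) : continuous (fun _ : R => c : R).
Proof. by move=> x; exact: cst_continuous. Qed.

Lemma Rintegral_lin (x y : R) (f h : R -> R) (a b : R) : continuous f -> continuous h ->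
  \int[mu]_(t in `[a, b]) (x * f t + y * h t) =
  x * (\int[mu]_(t in `[a, b]) f t) + y * (\int[mu]_(t in `[a, b]) h t).
Proof.
move=> cf ch; have if_ := continuous_itv_integrable a b cf.
have ih := continuous_itv_integrable a b ch.
rewrite RintegralD// ?RintegralZl//.
- by apply: continuous_itv_integrable; apply: continuous_mulr => //; exact: continuous_cstr.
- by apply: continuous_itv_integrable; apply: continuous_mulr => //; exact: continuous_cstr.
Qed.

Lemma Rintegral_FTC2 (F f : R -> R) (a b v : R) : a <= b -> continuous f ->
  (forall x, is_derive x (1 : R) F (f x)) -> F b - F a = v ->
  \int[mu]_(x in `[a, b]) f x = v.
Proof.
move=> ab cf dF <-; apply: EFin_inj; rewrite -integral_continuous_itv//.
by apply: FTC2_is_derive => //; exact: continuous_subspaceT.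
Qed.

Lemma Rintegral_sin : \int[mu]_(t in `[0, pi]) sin t = 2 :> R.
Proof.
apply: (@Rintegral_FTC2 (fun t => - cos t)).
- exact: pi_ge0.
- exact: continuous_sin.
- by move=> x; rewrite -[X in is_derive _ _ _ X]opprK; exact: is_deriveN.
- by rewrite cospi cos0 opprK; ring.
Qed.

Lemma Rintegral_sqr : \int[mu]_(t in `[0, 1]) t ^+ 2 = 3^-1 :> R.
Proof.
apply: (@Rintegral_FTC2 (fun t => 3^-1 * t ^+ 3)).
- exact: ler01.
- exact: exprn_continuous.
- move=> x; apply: is_derive_eq.
  rewrite /GRing.scale/=. by field.
- by ring.
Qed.

Lemma norm3_polar (r t s : R) : 0 <= r ->
  norm3 (r * sin t * cos s, r * sin t * sin s, r * cos t) = r.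
Proof.
move=> r0; rewrite /norm3/= [X in Num.sqrt X](_ : _ = r ^+ 2); first by rewrite sqrtr_sqr ger0_norm.
rewrite !exprMn -mulrDr cos2Dsin2 mulr1 -mulrDr addrC; by rewrite cos2Dsin2 mulr1.
Qed.

End separated.

Section separated.
Context {R : realType}.
Local Notation mu := (@lebesgue_measure R).

Variables (F : R3 R -> R) (K : R) (G A B BB : R -> R).
Hypothesis mF : measurable_fun (@ball3 R) F.
Hypothesis F_le : forall x, ball3 x -> `|F x| <= K.
Hypotheses (cG : continuous G) (cA : continuous A) (cB : continuous B).
Hypothesis dBB : forall x, is_derive x (1 : R) BB (B x).
Hypothesis sepF : forall r t s, 0 < r <= 1 -> 0 <= t <= pi ->
  F (r * sin t * cos s, r * sin t * sin s, r * cos t) = G r * A t * B s.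

(** Tonelli's theorem needs nonnegative integrands: F is shifted by its bound K
    and extended by 0 off the ball. *)
Let FK : R3 R -> \bar R := (fun x => (F x + K)%:E) \_ (@ball3 R).

(** The polar, azimuthal and radial factors of the integral of F. *)
Let a : R := \int[mu]_(t in `[0, pi]) (A t * sin t).
Let be : R := BB (pi *+ 2) - BB 0.
Let g : R := \int[mu]_(r in `[0, 1]) (G r * r ^+ 2).

Lemma measurable_shifted : measurable_fun [set: R3 R] FK.
Proof.
apply/(measurable_restrictT _ (@measurable_ball3 R)).
by apply/measurable_EFinP/measurable_funD.
Qed.

Lemma shifted_ge0 x : (0 <= FK x)%E.
Proof.
rewrite /FK patchE; case: ifPn => // /[!inE] /F_le.
by rewrite ler_norml lee_fin -lerBlDr sub0r => /andP[].
Qed.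

Lemma shiftedE x : ball3 x -> FK x = (F x + K)%:E.
Proof. by move=> bx; rewrite /FK patchE mem_set. Qed.

Lemma shifted_out x : ~ ball3 x -> FK x = 0%E.
Proof. by move=> bx; rewrite /FK patchE memNset. Qed.

Lemma ball3_polar r t s : 0 <= r ->
  @ball3 R (r * sin t * cos s, r * sin t * sin s, r * cos t) <-> r <= 1.
Proof. by move=> r0; rewrite /ball3/= norm3_polar. Qed.

Let cBpi : continuous (fun s => B (s + pi)).
Proof. exact: continuous_shift. Qed.

Let azimuthE r t : 0 < r <= 1 -> 0 < t < pi ->
  azimuth_integral FK (r * cos t, r * sin t) = (G r * A t * be + 2 * pi * K)%:E.
Proof.
move=> r01 /andP[t0 tp].
have r0 : 0 <= r by case/andP: r01 => /ltW.
have tpi : 0 <= t <= pi by rewrite !ltW.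
pose c s := G r * A t * (B s + B (s + pi)) + 2 * K * 1.
have cc : continuous c.
  apply: continuous_addr; apply: continuous_mulr; try exact: continuous_cstr.
  exact: continuous_addr.
rewrite /azimuth_integral/= (@integral_indic_itv _ _ c 0 pi false true)//; first last.
- by move=> s sn; rewrite /turn indicE memNset ?mule0//=; exact/negP.
- move=> s sp; rewrite /turn indicE mem_set// mule1.
  have -> : (- (r * sin t * cos s), - (r * sin t * sin s), r * cos t) =
     (r * sin t * cos (s + pi), r * sin t * sin (s + pi), r * cos t).
    by rewrite cosDpi sinDpi !mulrN.
  rewrite !shiftedE; [|by apply/ball3_polar; case/andP: r01..].
  by rewrite !sepF// -EFinD /c; congr EFin; ring.
- exact: pi_ge0.
congr EFin; rewrite /c Rintegral_lin//; last 2 first.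
- exact: continuous_addr.
- exact: continuous_cstr.
congr (_ * _ + _).
  apply: (@Rintegral_FTC2 _ (fun s => BB s + BB (s + pi))).
  - exact: pi_ge0.
  - exact: continuous_addr.
  - move=> x; apply: is_deriveD.
    have := @is_derive1_comp _ BB (fun s => s + pi) x (B (x + pi)) 1 (dBB _).
    rewrite mulr1; apply.
    by apply: is_derive_eq; rewrite addr0.
  - by rewrite add0r /be mulr2n; ring.
rewrite (@Rintegral_FTC2 _ id (fun=> 1) 0 pi pi) ?subr0 ?pi_ge0//; first by ring.
exact: continuous_cstr.
Qed.

Lemma integral_ball_shifted :
  (\int[@lebesgue3 R]_x FK x = (a * be * g + 4 * pi / 3 * K)%:E)%E.
Proof.
rewrite space_polar; [|exact: measurable_shifted|exact: shifted_ge0].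
pose c r := a * be * (G r * r ^+ 2) + 4 * pi * K * r ^+ 2.
have cr2 : continuous (fun r : R => r ^+ 2) by exact: exprn_continuous.
have cGr : continuous (fun r : R => G r * r ^+ 2) by exact: continuous_mulr.
have cAs : continuous (fun t => A t * sin t).
  by apply: continuous_mulr => //; exact: continuous_sin.
have cc : continuous c.
  by apply: continuous_addr; apply: continuous_mulr => //; exact: continuous_cstr.
rewrite (@integral_indic_itv _ _ c 0 1 false false)//; first last.
- move=> r; rewrite in_itv/= negb_and -leNgt -ltNge => /orP[r0|r1].
    by rewrite /pos_part max_r// expr0n/= mule0.
  rewrite integral0_eq ?mul0e// => t _.
  rewrite /azimuth_integral integral0_eq ?mul0e// => s _ /=.
  have r0 : 0 <= r by rewrite (le_trans ler01)// ltW.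
  rewrite !shifted_out ?adde0 ?mul0e//.
    have -> : (- (r * sin t * cos s), - (r * sin t * sin s), r * cos t) =
       (r * sin t * cos (s + pi), r * sin t * sin (s + pi), r * cos t).
      by rewrite cosDpi sinDpi !mulrN.
    by rewrite ball3_polar//; apply/negP; rewrite -ltNge.
  by rewrite ball3_polar//; apply/negP; rewrite -ltNge.
- move=> r; rewrite in_itv/= => /andP[r0 r1].
  rewrite /pos_part max_l ?ltW//.
  pose d t := G r * be * (A t * sin t) + 2 * pi * K * sin t.
  have cd : continuous d.
    apply: continuous_addr; apply: continuous_mulr => //; try exact: continuous_cstr.
    exact: continuous_sin.
  rewrite (@integral_indic_itv _ _ d 0 pi false true)//; first last.
  + by move=> s sn; rewrite /turn indicE memNset ?mulr0 ?mule0//=; exact/negP.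
  + move=> t tp; have tp' : 0 < t < pi by move: tp; rewrite in_itv.
    have r01 : 0 < r <= 1 by rewrite r0 ltW.
    rewrite (azimuthE r01 tp').
    by rewrite /turn indicE mem_set// mulr1 -EFinM /d; congr EFin; ring.
  + exact: pi_ge0.
  rewrite -EFinM; congr EFin; rewrite /d Rintegral_lin//; last exact: continuous_sin.
  by rewrite Rintegral_sin /c -/a; ring.
congr EFin; rewrite /c Rintegral_lin// Rintegral_sqr -/g; by field.
Qed.

Lemma integral_surface_shifted :
  (\int[@surface_measure R]_x FK x = (a * be * G 1 + 4 * pi * K)%:E)%E.
Proof.
rewrite integral_surface; [|exact: measurable_shifted|exact: shifted_ge0].
have cAs : continuous (fun t => A t * sin t).
  by apply: continuous_mulr => //; exact: continuous_sin.
pose d t := G 1 * be * (A t * sin t) + 2 * pi * K * sin t.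
have cd : continuous d.
  apply: continuous_addr; apply: continuous_mulr => //; try exact: continuous_cstr.
  exact: continuous_sin.
rewrite (@integral_indic_itv _ _ d 0 pi true false)//; first last.
- move=> t tn; rewrite integral0_eq// => s _.
  by rewrite indicE memNset ?mulr0 ?mule0// => -[/= ti _]; move: tn; rewrite ti.
- move=> t tp.
  have tpi : 0 <= t <= pi by move: tp; rewrite in_itv/= => /andP[/ltW -> /ltW ->].
  have sE s : spherical (t, s) = (1 * sin t * cos s, 1 * sin t * sin s, 1 * cos t).
    by rewrite !mul1r.
  pose c s := G 1 * A t * sin t * B s + K * sin t * 1.
  have cc : continuous c.
    by apply: continuous_addr; apply: continuous_mulr => //; exact: continuous_cstr.
  have pi2_ge0 : 0 <= pi *+ 2 :> R by rewrite mulrn_wge0// pi_ge0.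
  rewrite (@integral_indic_itv _ _ c 0 (pi *+ 2) true false)//; first last.
  + by move=> s sn; rewrite indicE memNset ?mulr0 ?mule0// => -[/= _ si]; move: sn; rewrite si.
  + move=> s sp; rewrite indicE mem_set; last first.
      split; rewrite /= ?in_itv//=.
      by move: sp; rewrite in_itv/= => /andP[/ltW -> /ltW ->].
    rewrite mulr1 sE shiftedE; last by apply/ball3_polar.
    by rewrite sepF ?ltr01 ?lexx// -EFinM /c; congr EFin; ring.
  congr EFin; rewrite /c Rintegral_lin//; last exact: continuous_cstr.
  rewrite (@Rintegral_FTC2 _ BB B _ _ be)//.
  rewrite (@Rintegral_FTC2 _ id (fun=> 1) 0 (pi *+ 2) (pi *+ 2)) ?subr0//; last first.
    exact: continuous_cstr.
  by rewrite /d mulr2n; ring.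
- exact: pi_ge0.
congr EFin; rewrite /d Rintegral_lin//; last exact: continuous_sin.
by rewrite Rintegral_sin -/a; ring.
Qed.

End separated.

Section nu_integral.
Context {R : realType}.
Local Notation mu := (@lebesgue_measure R).
Local Notation M := (measurableTypeR R).

Let is_derive_cst0 (x : R) : is_derive x (1 : R) (fun _ : R => 0 : R) 0.
Proof. exact: is_derive_cst. Qed.

Let zero_le1 (x : R3 R) : ball3 x -> `|0 : R| <= 1.
Proof. by move=> _; rewrite normr0 ler01. Qed.

Let zero_sep (r t s : R) : 0 < r <= 1 -> 0 <= t <= pi -> 0 = 0 * 0 * 0 :> R.
Proof. by move=> _ _; rewrite !mul0r. Qed.

Lemma lebesgue3_ball : @lebesgue3 R (@ball3 R) = (4 * pi / 3)%:E.
Proof.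
have E := @integral_ball_shifted R (fun=> 0) 1 (fun=> 0) (fun=> 0) (fun=> 0) (fun=> 0)
  (measurable_cst _) zero_le1 (@continuous_cstr R 0) (@continuous_cstr R 0)
  (@continuous_cstr R 0) is_derive_cst0 zero_sep.
move: E; rewrite subrr !mulr0 ?mul0r !add0r mulr1 => <-.
rewrite -integral_mkcond.
by rewrite integral_cst ?mul1e//; exact: measurable_ball3.
Qed.

Lemma surface_ball : @surface_measure R (@ball3 R) = (4 * pi)%:E.
Proof.
have E := @integral_surface_shifted R (fun=> 0) 1 (fun=> 0) (fun=> 0) (fun=> 0) (fun=> 0)
  (measurable_cst _) zero_le1 (@continuous_cstr R 0)
  (@continuous_cstr R 0) is_derive_cst0 zero_sep.
move: E; rewrite subrr !mulr0 ?mul0r !add0r mulr1 => <-.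
rewrite -integral_mkcond.
by rewrite integral_cst ?mul1e//; exact: measurable_ball3.
Qed.

Lemma ball_volumeE : ball_volume R = 4 * pi / 3.
Proof. by rewrite /ball_volume lebesgue3_ball. Qed.

Lemma norm3_spherical (p : M * M) : norm3 (@spherical R p) = 1.
Proof.
have := @norm3_polar R 1 p.1 p.2 ler01; rewrite !mul1r => <-; by [].
Qed.

Lemma sphere_areaE : sphere_area R = 4 * pi.
Proof.
rewrite /sphere_area -[RHS]/(fine (4 * pi)%:E) -surface_ball /= /surface_measure.
congr (fine (integral _ (_ `&` _) _)).
by apply/seteqP; split => p _; rewrite /preimage/= ?/sphere3 ?/ball3/= norm3_spherical.
Qed.

Let EFin_mulE1 (x : R) (I J : \bar R) : I = J -> (x%:E * I = x%:E * J)%E.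
Proof. by move=> ->. Qed.

Let EFin_mulE (x y z : R) (I J : \bar R) : (I = y%:E * J)%E -> x * y = z ->
  (x%:E * I = z%:E * J)%E.
Proof. by move=> -> <-; rewrite muleA EFinM. Qed.

Let EFin_addE (I J K L : \bar R) : I = K -> J = L -> (I + J = K + L)%E.
Proof. by move=> -> ->. Qed.

Let pi_neq0 : pi != 0 :> R.
Proof. by rewrite gt_eqF ?pi_gt0. Qed.

Let volume_inv (x p : R) : p != 0 -> x * (4 * p / 3)^-1 = x * (3 / (4 * p)).
Proof. by move=> p0; field. Qed.

Let total_mass (x p : R) : p != 0 ->
  (1 - x) * (3 / (4 * p)) * (4 * p / 3) + x / (4 * p) * (4 * p) = 1.
Proof. by move=> p0; field. Qed.

Let nu_average (x p c g h K : R) : p != 0 ->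
  (1 - x) * (3 / (4 * p)) * (c * g + 4 * p / 3 * K) +
  x / (4 * p) * (c * h + 4 * p * K) =
  c / (4 * p) * ((1 - x) * 3 * g + x * h) + K.
Proof. by move=> p0; field. Qed.

Lemma integral_nu (al : {i01 R}) (f : R3 R -> \bar R) :
  measurable_fun (@ball3 R) f -> (forall x, ball3 x -> 0 <= f x)%E ->
  (\int[nu al]_(x in @ball3 R) f x =
   ((1 - al%:num) * (3 / (4 * pi)))%:E * \int[@lebesgue3 R]_(x in @ball3 R) f x +
   (al%:num / (4 * pi))%:E * \int[@surface_measure R]_(x in @ball3 R) f x)%E.
Proof.
move=> mf f0; have mb := @measurable_ball3 R.
have mr : (\int[mrestr (@lebesgue3 R) mb]_(x in @ball3 R) f x =
    \int[@lebesgue3 R]_(x in @ball3 R) f x)%E.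
  apply: eq_measure_integral => A mA Ab.
  by rewrite -[LHS]/(lebesgue3 R (A `&` @ball3 R)) (setIidl Ab).
rewrite /nu (ge0_integral_measure_add _ _ mb f0 mf).
apply: EFin_addE.
  rewrite ge0_integral_mscale; [|exact: mb|exact: mf|exact: f0].
  apply: EFin_mulE.
    rewrite ge0_integral_mscale; [|exact: mb|exact: mf|exact: f0].
    apply: EFin_mulE1; exact: mr.
  rewrite /= ball_volumeE; exact: volume_inv pi_neq0.
rewrite ge0_integral_mscale; [|exact: mb|exact: mf|exact: f0].
apply: EFin_mulE.
  rewrite ge0_integral_mscale; [|exact: mb|exact: mf|exact: f0].
  apply: EFin_mulE1; exact: erefl.
rewrite /= sphere_areaE; exact: erefl.
Qed.

Lemma nu_ball (al : {i01 R}) : nu al (@ball3 R) = 1%E.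
Proof.
have mb := @measurable_ball3 R.
rewrite -[LHS]mul1e -integral_cst; last exact: mb.
rewrite integral_nu; [|exact: measurable_cst|by move=> x _; rewrite lee_fin ler01].
rewrite !(integral_cst _ mb) !mul1e [X in (_ * X + _)%E]lebesgue3_ball [X in (_ + _ * X)%E]surface_ball.
by rewrite -!EFinM -EFinD; congr EFin; exact: total_mass pi_neq0.
Qed.

Lemma nu_integrable (al : {i01 R}) (F : R3 R -> R) (K : R) :
  measurable_fun (@ball3 R) F -> (forall x, ball3 x -> `|F x| <= K) ->
  (nu al).-integrable (@ball3 R) (EFin \o F).
Proof.
move=> mF FK; apply: measurable_bounded_integrable => //.
- exact: measurable_ball3.
- by rewrite [ltLHS](nu_ball al) ltry.
- exists K; split; first exact: num_real.
  by move=> k Kk x bx; exact: le_trans (FK x bx) (ltW Kk).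
Qed.

(** Separation is required for r > 0 only: a function of the direction has no
    natural value at the origin.  The primitive BB of B gives the azimuthal
    factor as an increment over the full circle.  The factor 3 is the ratio of
    the area 4 pi to the volume 4 pi / 3. *)
Lemma nu_integral_separated (al : {i01 R}) (F : R3 R -> R) (K : R) (G A B BB : R -> R) :
  measurable_fun (@ball3 R) F -> (forall x, ball3 x -> `|F x| <= K) ->
  continuous G -> continuous A -> continuous B ->
  (forall x, is_derive x (1 : R) BB (B x)) ->
  (forall r t s, 0 < r <= 1 -> 0 <= t <= pi ->
    F (r * sin t * cos s, r * sin t * sin s, r * cos t) = G r * A t * B s) ->
  \int[nu al]_(x in @ball3 R) F x =
  (\int[mu]_(t in `[0, pi]) (A t * sin t)) * (BB (pi *+ 2) - BB 0) / (4 * pi) *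
  ((1 - al%:num) * 3 * (\int[mu]_(r in `[0, 1]) (G r * r ^+ 2)) + al%:num * G 1).
Proof.
move=> mF FK cG cA cB dBB sepF; have mb := @measurable_ball3 R.
have iF := nu_integrable al mF FK.
have iK : (nu al).-integrable (@ball3 R) (EFin \o fun=> K).
  by apply: (@nu_integrable al _ `|K|).
(* as nu al has mass 1, the shift adds K to the integral *)
apply: (@addIr _ K).
transitivity (\int[nu al]_(x in @ball3 R) F x + \int[nu al]_(x in @ball3 R) K).
  congr (_ + _); rewrite Rintegral_cst; last exact: mb.
  by rewrite [X in fine X](nu_ball al) mulr1.
rewrite -(RintegralD mb iF iK) /Rintegral integral_nu; last 2 first.
- by apply/measurable_EFinP/measurable_funD.
- by move=> x /FK; rewrite ler_norml lee_fin -lerBlDr sub0r => /andP[].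
have := integral_ball_shifted mF FK cG cA cB dBB sepF.
rewrite -integral_mkcond => ->.
have := integral_surface_shifted mF FK cA cB dBB sepF.
rewrite -integral_mkcond => ->.
rewrite -!EFinM -EFinD.
exact: nu_average pi_neq0.
Qed.

End nu_integral.

(** * Addition theorem and orthogonality for Legendre functions *)

(** Turns a proof of a = b from an equation c = d into a ring identity. *)
Lemma eq_of_sub (V : zmodType) (a b c d : V) : c = d -> a - b = c - d -> a = b.
Proof. by move=> -> /eqP; rewrite subrr subr_eq0 => /eqP. Qed.

Section legendre.
Variable R : realType.
Implicit Types l k n : nat.
Local Notation P := (@legendre_deriv R).

Lemma deriv_legendre l k : (P l k)^`() = P l k.+1.
Proof. by rewrite /legendre_deriv derivZ -derivnS addnS. Qed.

Lemma legendre_deriv0 l : P l l.+1 = 0.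
Proof.
rewrite /legendre_deriv; apply/eqP; rewrite scaler_eq0; apply/orP; right.
rewrite derivn_poly0//.
rewrite (leq_trans (size_exp_leq _ _))// addnS ltnS.
by rewrite size_XnsubC//= mul2n addnn leqnn.
Qed.

Let u l : {poly R} := ('X^2 - 1) ^+ l.

Let rodrigues_ode0 l : ('X^2 - 1) * (u l)^`() = 'X * u l *+ (2 * l).
Proof.
rewrite /u deriv_exp !poly.derivE subr0 mulrnAr -mulrnAl.
case: l => [|l]; first by rewrite muln0 !mulr0n mul0r.
by rewrite /= (exprS ('X^2 - 1) l); ring.
Qed.

(** The derivative of order n + 1 of the equation [rodrigues_ode0] for
    (X^2 - 1)^l. *)
Lemma rodrigues_ode l n :
  ('X^2 - 1) * (u l)^`(n.+2) + 'X * (u l)^`(n.+1) *+ (2 * n.+1)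
    + (u l)^`(n) *+ (n.+1 * n) =
  'X * (u l)^`(n.+1) *+ (2 * l) + (u l)^`(n) *+ (2 * l * n.+1).
Proof.
elim: n => [|n IH].
  have := congr1 deriv (rodrigues_ode0 l).
  rewrite !poly.derivE !derivnS derivn0 => E.
  by apply: (eq_of_sub E); ring.
have := congr1 deriv IH; rewrite !poly.derivE -!derivnS => E.
by apply: (eq_of_sub E); ring.
Qed.

(** Legendre's equation, differentiated k times: [rodrigues_ode] at n = l + k. *)
Lemma legendre_ode l k : (k <= l)%N ->
  (1 - 'X^2) * P l k.+2 =
  'X * P l k.+1 *+ (2 * k.+1) - P l k *+ ((l - k) * (l + k).+1).
Proof.
move=> kl; rewrite /legendre_deriv -!scalerAr !addnS.
have E := rodrigues_ode l (l + k).
rewrite !scalerMnr -scalerBr; congr (_ *: _).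
rewrite -/(u l); move: (u l)^`((l + k).+2) (u l)^`((l + k).+1) (u l)^`(l + k) E.
move=> a b c; rewrite -(subnKC kl) addKn => E.
have E2 := esym E.
apply: (eq_of_sub E2); ring.
Qed.

(** The factor by which the squared normalisation of the harmonics of order k
    differs from that of order 0. *)
Definition legendre_ratio l k : R := (l - k)`!%:R / (l + k)`!%:R.

Lemma legendre_ratio0 l : legendre_ratio l 0 = 1.
Proof. by rewrite /legendre_ratio subn0 addn0 divff// pnatr_eq0 -lt0n fact_gt0. Qed.

Lemma legendre_ratioS l k : (k < l)%N ->
  legendre_ratio l k.+1 *+ ((l - k) * (l + k).+1) = legendre_ratio l k.
Proof.
move=> kl; rewrite /legendre_ratio addnS -(subnSK kl) !factS !natrM -mulr_natr.
have f0 n : n`!%:R != 0 :> R by rewrite pnatr_eq0 -lt0n fact_gt0.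
by field; rewrite f0 /= -natrD addrC natr1 pnatr_eq0.
Qed.

(** The sum over -l <= q <= l of |Y_(l,q)|^2, up to the factor (2 l + 1) / (4 pi),
    as a polynomial in the third coordinate of a point on the unit sphere.  The
    orders k and - k contribute equally, and the square root of 1 - X^2 occurs to
    an even power. *)
Definition addition_sum l : {poly R} :=
  P l 0 ^+ 2 +
  (\sum_(k < l) legendre_ratio l k.+1 *: ((1 - 'X^2) ^+ k.+1 * P l k.+1 ^+ 2)) *+ 2.

(** By Legendre's equation the derivative of the term of order k + 1 is a
    difference A (k + 1) - A k.  The sum telescopes to - A 0, which cancels the
    derivative of the term of order 0. *)
Lemma deriv_addition_sum l : (addition_sum l)^`() = 0.
Proof.
pose A k := legendre_ratio l k *: ((1 - 'X^2) ^+ k * P l k * P l k.+1).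
have step k : (k < l)%N ->
    (legendre_ratio l k.+1 *: ((1 - 'X^2) ^+ k.+1 * P l k.+1 ^+ 2))^`() = A k.+1 - A k.
  move=> kl; rewrite /A -(legendre_ratioS kl) -[legendre_ratio l k.+1 *+ _]mulr_natr -scalerA.
  rewrite scaler_nat derivZ -scalerBr.
  congr (_ *: _); rewrite derivM !deriv_exp deriv_legendre derivB derivXn -polyC1 derivC.
  have E := congr1 (fun p => (1 - 'X^2) ^+ k * P l k.+1 * p) (legendre_ode (ltnW kl)).
  apply: (eq_of_sub E); rewrite /= polyC1 expr1 (exprS (1 - 'X^2)); ring.
rewrite /addition_sum derivD derivMn raddf_sum /=.
rewrite (eq_bigr (fun k : 'I_l => A k.+1 - A k)); last by move=> k _; exact: step.
rewrite -(big_mkord xpredT (fun k => A k.+1 - A k)) telescope_sumr//.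
have -> : A l = 0 by rewrite /A legendre_deriv0 mulr0 scaler0.
rewrite sub0r /A legendre_ratio0 scale1r expr0 mul1r deriv_exp deriv_legendre /=; ring.
Qed.

End legendre.

Section addition_theorem.
Variable R : realType.
Implicit Types l k n : nat.
Local Notation P := (@legendre_deriv R).

Lemma poly_deriv_eq0 (p : {poly R}) : p^`() = 0 -> p = (p.[1])%:P.
Proof.
move=> dp; have /size1_polyC pE : (size p <= 1)%N.
  apply/leq_sizeP => -[|i]//= _; apply/eqP; have /eqP := congr1 (coefp i) dp.
  by rewrite /= coef_deriv coef0 mulrn_eq0.
by rewrite [in RHS]pE hornerC.
Qed.

(** At the root only the term of the Leibniz formula survives in which all
    derivatives fall on the power. *)
Lemma derivn_root_exp l (q : {poly R}) (a : R) :
  ((('X - a%:P) ^+ l * q)^`(l)).[a] = l`!%:R * q.[a].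
Proof.
elim: l q => [|l IH] q; first by rewrite expr0 !mul1r.
rewrite derivSn derivM deriv_exp derivXsubC mul1r /=.
have -> : ('X - a%:P) ^+ l *+ l.+1 * q + ('X - a%:P) ^+ l.+1 * q^`() =
  ('X - a%:P) ^+ l * (q *+ l.+1 + ('X - a%:P) * q^`()) by rewrite exprS; ring.
rewrite IH !hornerE subrr mul0r addr0 factS natrM hornerMn -mulr_natr; ring.
Qed.

Lemma legendre_at1 l : (P l 0).[1] = 1.
Proof.
rewrite /legendre_deriv addn0 hornerZ.
have -> : ('X^2 - 1 : {poly R}) = ('X - 1%:P) * ('X + 1) by rewrite polyC1; ring.
rewrite exprMn derivn_root_exp horner_exp.
have -> : ('X + 1 : {poly R}).[1] = 2 by rewrite !hornerE.
by rewrite natrM natrX [_ * 2 ^+ l]mulrC mulVf// mulf_neq0 ?expf_neq0 ?pnatr_eq0//.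
Qed.

(** The polynomial is constant, and at 1 the factors 1 - X^2 vanish. *)
Lemma addition_sumE l : addition_sum R l = 1.
Proof.
rewrite (poly_deriv_eq0 (deriv_addition_sum R l)) /addition_sum hornerD hornerMn horner_sum.
rewrite big1 ?mul0rn ?addr0 ?horner_exp ?legendre_at1 ?expr1n ?polyC1// => k _.
rewrite hornerZ hornerM horner_exp.
have -> : (1 - 'X^2 : {poly R}).[1] = 0 by rewrite !hornerE ?expr1n subrr.
by rewrite exprS !mul0r mulr0.
Qed.

Lemma addition_theorem l (t : R) :
  (P l 0).[t] ^+ 2 + (\sum_(k < l)
    legendre_ratio R l k.+1 * ((1 - t ^+ 2) ^+ k.+1 * (P l k.+1).[t] ^+ 2)) *+ 2 = 1.
Proof.
have E : (addition_sum R l).[t] = 1 by rewrite addition_sumE hornerC.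
apply: etrans E; rewrite /addition_sum hornerD hornerMn horner_sum horner_exp.
congr (_ + _ *+ 2); apply: eq_bigr => k _.
by rewrite [RHS]hornerZ hornerM !horner_exp hornerD hornerN hornerXn hornerC.
Qed.

End addition_theorem.

Section legendre_integrals.
Variable R : realType.
Implicit Types l k n : nat.
Local Notation P := (@legendre_deriv R).
Local Notation mu := (@lebesgue_measure R).

(** The integral of Q over [-1, 1], in the colatitude t. *)
Definition cos_integral (Q : {poly R}) : R :=
  \int[mu]_(t in `[0, pi]) (Q.[cos t] * sin t).

Lemma continuous_cos_horner (Q : {poly R}) : continuous (fun t : R => Q.[cos t]).
Proof.
move=> t; apply: (@continuous_comp _ _ _ cos (horner Q)); first exact: continuous_cos.
exact: continuous_horner.
Qed.

Lemma cos_integral_lin (a b : R) (Q S : {poly R}) :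
  cos_integral (a *: Q + b *: S) = a * cos_integral Q + b * cos_integral S.
Proof.
rewrite /cos_integral -Rintegral_lin; last 2 first.
- by apply: continuous_mulr; [exact: continuous_cos_horner|exact: continuous_sin].
- by apply: continuous_mulr; [exact: continuous_cos_horner|exact: continuous_sin].
by congr Rintegral; apply/funext => t; rewrite hornerD !hornerZ mulrDl !mulrA.
Qed.

Lemma cos_integralD (Q S : {poly R}) :
  cos_integral (Q + S) = cos_integral Q + cos_integral S.
Proof. by have := cos_integral_lin 1 1 Q S; rewrite !scale1r !mul1r. Qed.

Lemma cos_integralZ (a : R) (Q : {poly R}) : cos_integral (a *: Q) = a * cos_integral Q.
Proof. by have := cos_integral_lin a 0 Q 0; rewrite scaler0 addr0 mul0r addr0. Qed.

Lemma cos_integral_deriv (Q : {poly R}) : cos_integral Q^`() = Q.[1] - Q.[-1].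
Proof.
apply: (@Rintegral_FTC2 _ (fun t => - Q.[cos t])).
- exact: pi_ge0.
- by apply: continuous_mulr; [exact: continuous_cos_horner|exact: continuous_sin].
- move=> x; rewrite -[X in is_derive _ _ _ X]opprK; apply: is_deriveN.
  rewrite -mulrN; apply: (@is_derive1_comp _ (horner Q) cos).
- by rewrite cospi cos0; ring.
Qed.

Lemma cos_integral1 : cos_integral 1 = 2.
Proof.
by rewrite /cos_integral -(@Rintegral_sin R); congr Rintegral; apply/funext => t;
  rewrite hornerC mul1r.
Qed.

Let w : {poly R} := 1 - 'X^2.

(** Integration by parts: by Legendre's equation the two integrands differ by the
    derivative of a polynomial that vanishes at 1 and at -1. *)
Lemma cos_integral_legendreS l l' k : (k <= l)%N ->
  cos_integral (w ^+ k.+1 * P l k.+1 * P l' k.+1) =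
  ((l - k) * (l + k).+1)%:R * cos_integral (w ^+ k * P l k * P l' k).
Proof.
move=> kl; have dw : w^`() = - 'X *+ 2.
  by rewrite /w derivB derivXn -polyC1 derivC sub0r expr1 mulNrn.
apply/eqP; rewrite -subr_eq0 -mulNr -cos_integralZ -cos_integralD.
have -> : w ^+ k.+1 * P l k.+1 * P l' k.+1 +
    (- ((l - k) * (l + k).+1)%:R) *: (w ^+ k * P l k * P l' k) =
    (w ^+ k.+1 * P l k.+1 * P l' k)^`().
  rewrite scaleNr scaler_nat !derivM !deriv_exp !deriv_legendre dw.
  have E := congr1 (fun p => w ^+ k * P l' k * p) (legendre_ode R kl).
  apply: (eq_of_sub (esym E)); rewrite /= (exprS w) -/w; ring.
rewrite cos_integral_deriv !hornerM !horner_exp.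
have -> : w.[1] = 0 by rewrite /w !hornerE ?expr1n subrr.
have -> : w.[-1] = 0 by rewrite /w hornerD hornerN hornerXn hornerC sqrrN expr1n subrr.
by rewrite exprS !mul0r subrr.
Qed.

(** Passing from order k to k + 1 multiplies the integral by
    (l - k) (l + k + 1), and by symmetry also by (l' - k) (l' + k + 1).  These
    numbers differ if l and l' do. *)
Lemma legendre_orthogonal l l' k : (k <= l)%N -> (k <= l')%N -> l != l' ->
  cos_integral (w ^+ k * P l k * P l' k) = 0.
Proof.
move=> kl kl' ll'.
have E1 := cos_integral_legendreS l' kl.
have E2 := cos_integral_legendreS l kl'.
rewrite mulrAC [in RHS]mulrAC in E2; rewrite E2 in E1.
have : (((l' - k) * (l' + k).+1)%:R - ((l - k) * (l + k).+1)%:R) *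
    cos_integral (w ^+ k * P l k * P l' k) = 0 by rewrite mulrBl E1 subrr.
move=> /eqP; rewrite mulf_eq0 => /orP[|/eqP//]; rewrite subr_eq0 eqr_nat.
move: ll' kl kl' {E1 E2}; case: (ltngtP l l') => // ll' _ kl kl' /eqP E; exfalso.
- suff : ((l - k) * (l + k).+1 < (l' - k) * (l' + k).+1)%N by rewrite E ltnn.
  by rewrite ltn_mul// ?ltn_sub2r ?ltnS ?ltn_add2r// (leq_ltn_trans kl).
- suff : ((l' - k) * (l' + k).+1 < (l - k) * (l + k).+1)%N by rewrite E ltnn.
  by rewrite ltn_mul// ?ltn_sub2r ?ltnS ?ltn_add2r// (leq_ltn_trans kl').
Qed.

Lemma legendre_sqr_ratio l k : (k <= l)%N ->
  legendre_ratio R l k * cos_integral (w ^+ k * P l k * P l k) = cos_integral (P l 0 * P l 0).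
Proof.
elim: k => [|k IH] kl; first by rewrite legendre_ratio0 mul1r expr0 mul1r.
rewrite (cos_integral_legendreS _ (ltnW kl)) mulrA mulr_natr legendre_ratioS//.
exact/IH/ltnW.
Qed.

(** The addition theorem is integrated over [-1, 1]: its terms for the orders
    from - l to l have equal integrals, and these add up to 2. *)
Lemma legendre_sqr0 l : cos_integral (P l 0 * P l 0) = 2 / (2 * l + 1)%:R.
Proof.
have := congr1 cos_integral (addition_sumE R l); rewrite cos_integral1 /addition_sum.
rewrite cos_integralD expr2 -scaler_nat cos_integralZ.
have -> : cos_integral (\sum_(k < l) legendre_ratio R l k.+1 *: ((1 - 'X^2) ^+ k.+1 * P l k.+1 ^+ 2)) =
   \sum_(k < l) cos_integral (P l 0 * P l 0).
  have c0 : cos_integral 0 = 0 by have := cos_integralZ 0 0; rewrite scale0r mul0r.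
  rewrite (big_morph _ cos_integralD c0); apply: eq_bigr => k _.
  by rewrite cos_integralZ expr2 mulrA -/w legendre_sqr_ratio.
rewrite sumr_const card_ord -[_ *+ l]mulr_natr => <-.
rewrite natrD natrM; field.
by rewrite -natrM natr1 pnatr_eq0.
Qed.

Lemma legendre_sqr l k : (k <= l)%N ->
  legendre_ratio R l k * cos_integral (w ^+ k * P l k * P l k) = 2 / (2 * l + 1)%:R.
Proof. by move=> kl; rewrite legendre_sqr_ratio// legendre_sqr0. Qed.

End legendre_integrals.

(** * The Gamma function at half-integers *)

Section gamma.
Context {R : realType}.
Local Notation mu := (@lebesgue_measure R).

Lemma continuous_powR (a x : R) : 0 < x -> {for x, continuous (fun u : R => u `^ a)}.
Proof.
move=> x0; apply: differentiable_continuous; apply/derivable1_diffP.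
by apply: derivable_powR; rewrite in_itv/= x0.
Qed.

Lemma powR_right0 (a : R) : 0 < a -> u `^ a @[u --> 0^'+] --> 0 `^ a.
Proof. by move=> a0; rewrite powR0 ?gt_eqF//; exact: powR_cvg0. Qed.

Lemma integral_powR (p t : R) : 1 < p -> 0 < t ->
  (\int[mu]_(u in `[0%R, t]) (p * u `^ (p - 1))%:E = (t `^ p)%:E)%E.
Proof.
move=> p1 t0; have p0 : 0 < p by rewrite (lt_trans ltr01).
have cpm (x : R) : 0 < x -> {for x, continuous (fun u : R => p * u `^ (p - 1))}.
  by move=> x0; apply: continuousM; [exact: cst_continuous|exact: continuous_powR].
rewrite (@continuous_FTC2 _ (fun u => p * u `^ (p - 1)) (@powR R ^~ p))//.
- by rewrite powR0 ?gt_eqF// sube0.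
- apply/continuous_within_itvP => //; split.
  + move=> x; rewrite in_itv/= => /andP[x0 _].
    exact: cpm.
  + by apply: cvgM; [exact: cvg_cst|apply: powR_right0; rewrite subr_gt0].
  + by apply: cvg_at_left_filter; exact: cpm.
- split.
  + by move=> x; rewrite in_itv/= => /andP[x0 _]; apply: derivable_powR; rewrite in_itv/= x0.
  + exact: powR_right0.
  + by apply: cvg_at_left_filter; exact: continuous_powR.
- move=> x; rewrite in_itv/= => /andP[x0 _]; apply: powR_derive1.
  by rewrite in_itv/= x0.
Qed.

Lemma integral_expR_tail (c u : R) : 0 < c ->
  (\int[mu]_(t in `[u, +oo[) (expR (- (c * t)))%:E = (expR (- (c * u)) / c)%:E)%E.
Proof.
move=> c0.
have dlin (x : R) : is_derive x (1 : R) (fun t => - (c * t)) (- c).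
  have -> : (fun t => - (c * t)) = (fun t => (- c) *: (t : R^o)).
    by apply/funext => t; rewrite /GRing.scale/= mulNr.
  by rewrite -[X in is_derive _ _ _ X]mulr1; exact: is_deriveZ.
have dexp x : is_derive x (1 : R) (fun t => expR (- (c * t))) (expR (- (c * x)) * - c).
  exact: (@is_derive1_comp _ expR (fun t => - (c * t)) x _ _ (is_derive_expR _) (dlin x)).
have dF x : is_derive x (1 : R) (fun t => (- c^-1) *: (expR (- (c * t)) : R^o)) (expR (- (c * x))).
  have := @is_deriveZ _ _ _ _ (- c^-1) x _ _ (dexp x).
  rewrite [X in is_derive _ _ _ X -> _](_ : _ = expR (- (c * x)))//.
  by rewrite /GRing.scale/= !mulrN !mulNr opprK mulrCA mulVf ?mulr1// gt_eqF.
have cexp : continuous (fun t => expR (- (c * t))).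
  move=> x; apply: differentiable_continuous; apply/derivable1_diffP.
  by case: (dexp x).
have cF : continuous (fun t => (- c^-1) *: (expR (- (c * t)) : R^o)).
  move=> x; apply: differentiable_continuous; apply/derivable1_diffP.
  by case: (dF x).
rewrite (@ge0_continuous_FTC2y _ _ (fun t => (- c^-1) *: (expR (- (c * t)) : R^o)) _ 0).
- by rewrite -EFinB sub0r /GRing.scale/= mulNr opprK mulrC.
- by move=> x _; exact: expR_ge0.
- exact: continuous_subspaceT.
- rewrite -[X in _ --> X](scaler0 _ (- c^-1)); apply: cvgZr.
  apply: (@cvg_comp _ _ _ (fun t => c * t) (fun y => expR (- y)) _ +oo); last exact: cvgr_expR.
  exact: gt0_cvgMry.
- by move=> x _; case: (dF x).
- by apply: cvg_at_right_filter; exact: cF.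
- by move=> x _; rewrite derive1E; case: (dF x).
Qed.

End gamma.

Section gamma.
Context {R : realType}.
Local Notation mu := (@lebesgue_measure R).
Local Notation M := (measurableTypeR R).

Definition gamma_integral (s : R) : \bar R :=
  (\int[mu]_(t in `]0%R, +oo[) (t `^ (s - 1) * expR (- t))%:E)%E.

Lemma upperE (t : R) : @upper R t = (0 < t)%R%:R.
Proof.
rewrite /upper indicE; congr (nat_of_bool _)%:R.
by apply/idP/idP; rewrite inE/= in_itv/= andbT.
Qed.

Lemma measurable_powRl (a : R) : measurable_fun [set: M] (fun u : M => u `^ a : M).
Proof. exact: measurable_powR. Qed.

Lemma measurable_expRN : measurable_fun [set: M] (fun t : M => expR (- t) : M).
Proof.
apply: continuous_measurable_fun => t.
apply: continuous_comp; [exact: oppr_continuous|exact: continuous_expR].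
Qed.

Lemma gamma_integralE (s : R) :
  gamma_integral s = (\int[mu]_t (t `^ (s - 1) * expR (- t) * upper t)%:E)%E.
Proof.
rewrite /gamma_integral integral_mkcond; apply: eq_integral => t _.
rewrite patchE upperE mem_setE in_itv/= andbT.
by case: (0 < t); rewrite ?mulr1 ?mulr0.
Qed.

Lemma gamma_integral_ge0 s : (0 <= gamma_integral s)%E.
Proof. by apply: integral_ge0 => t _; rewrite lee_fin mulr_ge0 ?powR_ge0 ?expR_ge0. Qed.

(** Tonelli's theorem for p u^(p - 1) e^(- t) on the region 0 < u < t: the
    integral in u gives t^p, the integral in t gives e^(- u). *)
Lemma gamma_integralS (p : R) : 1 < p ->
  (gamma_integral (p + 1) = p%:E * gamma_integral p)%E.
Proof.
move=> p1; have p0 : 0 < p by rewrite (lt_trans ltr01).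
pose k (q : M * M) : R :=
  p * (q.2 `^ (p - 1)) * upper q.2 * upper (q.1 - q.2) * expR (- q.1).
have mfst : measurable_fun [set: M * M] (fst : M * M -> M) := measurable_fst.
have msnd : measurable_fun [set: M * M] (snd : M * M -> M) := measurable_snd.
have mup := @measurable_upper R.
have mk : measurable_fun [set: M * M] (EFin \o k).
  apply/measurable_EFinP; apply: measurable_funM; last first.
    by apply: (measurableT_comp measurable_expRN).
  apply: measurable_funM; last first.
    by apply: (measurableT_comp mup); apply: measurable_funB.
  apply: measurable_funM; last exact: (measurableT_comp mup).
  apply: measurable_funM => //.
  exact: (measurableT_comp (measurable_powRl (p - 1))).
have k0 q : (0 <= (EFin \o k) q)%E.
  by rewrite lee_fin !mulr_ge0 ?upper_ge0 ?powR_ge0 ?expR_ge0// ltW.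
have := fubini_tonelli (m1 := mu) (m2 := mu) (EFin \o k) mk k0.
have -> : (\int[mu]_t \int[mu]_u (EFin \o k) (t, u) = gamma_integral (p + 1))%E.
  rewrite gamma_integralE; apply: eq_integral => t _; rewrite addrK.
  have [t0|t0] := ltP 0 t; last first.
    rewrite upperE ltNge t0 mulr0 integral0_eq// => u _.
    rewrite /k/= !upperE; have [u0|] := ltP 0 u; last by rewrite mulr0 !mul0r.
    by rewrite [_ < _ - _](_ : _ = false) ?mulr0 ?mul0r//; apply/negbTE; rewrite -leNgt subr_le0 (le_trans t0)// ltW.
  have pm : measurable_fun [set: M] (fun u : M => p * u `^ (p - 1) : M).
    by apply: measurable_funM => //; exact: measurable_powRl.
  transitivity (\int[mu]_(u in `]0%R, t[) (expR (- t) * (p * u `^ (p - 1)))%:E)%E.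
    rewrite [RHS]integral_mkcond; apply: eq_integral => u _.
    rewrite patchE mem_setE in_itv/= /k/= !upperE subr_gt0.
    by case: (0 < u); case: (u < t); rewrite ?mulr1 ?mulr0 ?mul0r// mulrC.
  rewrite -(integral_itv_bndoo true false); last first.
    apply/measurable_EFinP; apply: measurable_funTS; exact: measurable_funM.
  under eq_integral do rewrite EFinM.
  rewrite ge0_integralZl_EFin ?expR_ge0//; last 2 first.
  - by move=> u _; rewrite lee_fin mulr_ge0 ?powR_ge0// ltW.
  - by apply/measurable_EFinP; exact: measurable_funTS.
  by rewrite integral_powR// -EFinM upperE t0 mulr1 mulrC.
move=> ->; rewrite gamma_integralE -ge0_integralZl_EFin//; last 3 first.
- by move=> u _; rewrite lee_fin !mulr_ge0 ?upper_ge0 ?powR_ge0 ?expR_ge0.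
- apply/measurable_EFinP; apply: measurable_funM => //.
  by apply: measurable_funM; [exact: measurable_powRl|exact: measurable_expRN].
- exact: ltW.
apply: eq_integral => u _.
transitivity (\int[mu]_t ((p * u `^ (p - 1) * upper u)%:E * (expR (- t) * upper (t - u))%:E))%E.
  by apply: eq_integral => t _; rewrite -EFinM /k/=; congr EFin; ring.
have me : measurable_fun [set: M] (fun t : M => expR (- t) * upper (t - u) : M).
  apply: measurable_funM; first exact: measurable_expRN.
  by apply: (measurableT_comp mup); apply: measurable_funB.
rewrite ge0_integralZl_EFin//; last 3 first.
- by move=> t _; rewrite lee_fin mulr_ge0 ?upper_ge0 ?expR_ge0.
- exact/measurable_EFinP.
- by rewrite !mulr_ge0 ?upper_ge0 ?powR_ge0// ltW.
have -> : (\int[mu]_t (expR (- t) * upper (t - u))%:E = (expR (- u))%:E)%E.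
  have := integral_expR_tail u (@ltr01 R); rewrite mul1r divr1 => <-.
  rewrite -integral_itv_obnd_cbnd; last first.
    apply/measurable_EFinP; apply: measurable_funTS.
    under eq_fun do rewrite mul1r; exact: measurable_expRN.
  rewrite [RHS]integral_mkcond; apply: eq_integral => t _.
  rewrite patchE mem_setE in_itv/= andbT upperE subr_gt0 mul1r.
  by case: (u < t); rewrite ?mulr1 ?mulr0.
by rewrite -!EFinM; congr EFin; ring.
Qed.

(** sqrt t <= 1 + t / 2 <= e^(t / 2), so the integrand is at most e^(- t / 2). *)
Lemma gamma_integral_half_lty : (gamma_integral (3 / 2) < +oo)%E.
Proof.
apply: (@le_lt_trans _ _ (\int[mu]_(t in `]0%R, +oo[) (expR (- (2^-1 * t)))%:E)%E).
  apply: ge0_le_integral => //.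
  - by move=> t _; rewrite lee_fin mulr_ge0 ?powR_ge0 ?expR_ge0.
  - apply/measurable_EFinP; apply: measurable_funTS.
    by apply: measurable_funM; [exact: measurable_powRl|exact: measurable_expRN].
  - apply/measurable_EFinP; apply: measurable_funTS; apply: (measurableT_comp measurable_expRN).
    exact: measurable_funM.
  - move=> t; rewrite /= in_itv/= andbT lee_fin => t0.
    have -> : 3 / 2 - 1 = 2^-1 :> R by lra.
    rewrite powR12_sqrt; last exact: ltW.
    rewrite -(ler_pdivlMr _ _ (expR_gt0 (- t))) -expRN opprK -expRD.
    have -> : - (2^-1 * t) + t = t / 2 by lra.
    apply: (le_trans _ (expR_ge1Dx _)).
    have := sqr_ge0 (Num.sqrt t - 1); have := sqr_sqrtr (ltW t0).
    by set r := Num.sqrt t; nra.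
rewrite integral_itv_obnd_cbnd; last first.
  apply/measurable_EFinP; apply: measurable_funTS; apply: (measurableT_comp measurable_expRN).
  exact: measurable_funM.
by rewrite integral_expR_tail ?ltry// invr_gt0.
Qed.

Lemma gamma_integral_half_gt0 : (0 < gamma_integral (3 / 2))%E.
Proof.
apply: (@lt_le_trans _ _ (\int[mu]_(t in `[1%R, 2%R]) (expR (- 2))%:E)%E).
  have -> : (\int[mu]_(t in `[1%R, 2%R]) (expR (- 2))%:E = (expR (- 2))%:E * mu `[1%R, 2%R]%classic)%E.
    by rewrite -integral_cst.
  rewrite lebesgue_measure_itv/= lte_fin ltr1n -EFinB -EFinM lte_fin.
  rewrite mulr_gt0 ?expR_gt0//; lra.
apply: (@le_trans _ _ (\int[mu]_(t in `[1%R, 2%R]) (t `^ (3 / 2 - 1) * expR (- t))%:E)%E).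
  apply: ge0_le_integral => //.
  - apply/measurable_EFinP; apply: measurable_funTS.
    by apply: measurable_funM; [exact: measurable_powRl|exact: measurable_expRN].
  - move=> t; rewrite /= in_itv/= => /andP[t1 t2]; rewrite lee_fin.
    rewrite -[leLHS]mul1r ler_pM ?expR_ge0 ?ler_expR ?lerN2//.
    have -> : 3 / 2 - 1 = 2^-1 :> R by lra.
    by rewrite powR12_sqrt ?(le_trans ler01)// -[leLHS]sqrtr1 ler_sqrt ?(le_trans ler01)//.
apply: ge0_subset_integral => //.
- apply/measurable_EFinP; apply: measurable_funTS.
  by apply: measurable_funM; [exact: measurable_powRl|exact: measurable_expRN].
- by move=> t _; rewrite lee_fin mulr_ge0 ?powR_ge0 ?expR_ge0.
- by move=> t; rewrite /= !in_itv/= andbT => /andP[t1 _]; rewrite (lt_le_trans ltr01).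
Qed.

(** The Gamma values in the series of the Bessel function of order l + 1/2, whose
    k-th term contains Gamma (k + (l + 1/2) + 1). *)
Definition half_gamma (n : nat) : R := Gamma (n%:R + 3 / 2).

Lemma half_gammaE n : gamma_integral (n%:R + 3 / 2) = (half_gamma n)%:E /\ 0 < half_gamma n.
Proof.
elim: n => [|n [IH IH0]].
  rewrite add0r /half_gamma add0r; split; last first.
    rewrite fine_gt0//; apply/andP; split; [exact: gamma_integral_half_gt0|exact: gamma_integral_half_lty].
  by rewrite -[LHS]fineK// ge0_fin_numE ?gamma_integral_ge0 ?gamma_integral_half_lty.
have E : gamma_integral (n.+1%:R + 3 / 2) = ((n%:R + 3 / 2) * half_gamma n)%:E.
  have -> : n.+1%:R + 3 / 2 = n%:R + 3 / 2 + 1 :> R by rewrite -natr1; ring.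
  rewrite gamma_integralS ?IH ?EFinM//.
  by rewrite (@lt_le_trans _ _ (3 / 2))// ?lerDr ?ler0n//; lra.
have hE : half_gamma n.+1 = (n%:R + 3 / 2) * half_gamma n.
  by rewrite /half_gamma /Gamma /Rintegral [X in fine X = _]E.
rewrite E hE; split => //; rewrite mulr_gt0// ltr_wpDl ?ler0n//; lra.
Qed.

Lemma half_gamma_gt0 n : 0 < half_gamma n.
Proof. by have [] := half_gammaE n. Qed.

Lemma half_gammaS n : half_gamma n.+1 = (n%:R + 3 / 2) * half_gamma n.
Proof.
have [En _] := half_gammaE n; have [ESn _] := half_gammaE n.+1.
apply: EFin_inj; rewrite -ESn EFinM -En -gamma_integralS.
  by congr gamma_integral; rewrite -natr1; ring.
by rewrite (@lt_le_trans _ _ (3 / 2))// ?lerDr ?ler0n//; lra.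
Qed.

End gamma.

(** * Power series of the spherical Bessel functions *)

Section lipschitz_series.
Variables (R : realType) (e : R^nat) (D : R).
Hypothesis eD : forall n, \sum_(0 <= k < n) k%:R * `|e k| <= D.

Definition unit_clamp (s : R) : R := Num.min 1 (Num.max 0 s).

Lemma unit_clamp01 s : 0 <= unit_clamp s <= 1.
Proof. by rewrite /unit_clamp le_min ler01 le_max lexx/= ge_min lexx. Qed.

Lemma unit_clamp_id s : 0 <= s <= 1 -> unit_clamp s = s.
Proof. by move=> /andP[s0 s1]; rewrite /unit_clamp max_r// min_r. Qed.

Lemma unit_clamp_lip s t : `|unit_clamp s - unit_clamp t| <= `|s - t|.
Proof.
have h1 := ler_norm (s - t); have h2 := ler_norm (- (s - t)); rewrite normrN in h2.
have m10 : Num.min 1 0 = 0 :> R by rewrite min_r.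
rewrite ler_norml /unit_clamp; apply/andP.
have [s0|s0] := leP 0 s; have [t0|t0] := leP 0 t; rewrite ?m10;
  have [s1|s1] := leP 1 s; have [t1|t1] := leP 1 t; split; lra.
Qed.

Let term s k := e k * unit_clamp s ^+ k.

Lemma subrX_le (s t : R) k : 0 <= s <= 1 -> 0 <= t <= 1 ->
  `|s ^+ k - t ^+ k| <= k%:R * `|s - t|.
Proof.
move=> /andP[s0 s1] /andP[t0 t1].
rewrite subrXX normrM mulrC ler_wpM2r//.
apply: (le_trans (ler_norm_sum _ _ _)).
rewrite -[k in leRHS](card_ord k) -sumr_const; apply: ler_sum => i _.
rewrite ger0_norm ?mulr_ge0 ?exprn_ge0//.
by rewrite mulr_ile1 ?exprn_ge0 ?exprn_ile1.
Qed.

Lemma series_term_lip s t n :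
  `|series (term s) n - series (term t) n| <= D * `|s - t|.
Proof.
rewrite /series/= -sumrB.
apply: (le_trans (ler_norm_sum _ _ _)).
apply: (le_trans _ (ler_wpM2r (normr_ge0 _) (eD n))); rewrite mulr_suml.
apply: ler_sum => k _; rewrite /term -mulrBr normrM mulrC mulrAC.
rewrite ler_wpM2r//; apply: le_trans (subrX_le _ (unit_clamp01 s) (unit_clamp01 t)) _.
by rewrite ler_wpM2l// unit_clamp_lip.
Qed.

Lemma is_cvg_series_term s : cvgn (series (term s)).
Proof.
apply: normed_cvg; apply: nondecreasing_is_cvgn.
  by apply: nondecreasing_series => n _ _ /=.
exists (`|e 0%N| + D) => _ [n _ <-].
rewrite -[X in X <= _]/(\sum_(0 <= k < n) `|term s k|).
have [->|n0] := posnP n.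
  rewrite big_geq// addr_ge0//.
  by apply: le_trans (eD 0); rewrite big_geq.
rewrite big_ltn// {1}/term expr0 mulr1 lerD2l.
apply: le_trans (eD n); rewrite [leRHS]big_ltn// mul0r add0r.
rewrite big_nat_cond [leRHS]big_nat_cond; apply: ler_sum => k; rewrite andbT => /andP[k1 _].
have /andP[c0 c1] := unit_clamp01 s.
rewrite normrM mulrC ler_wpM2r// ger0_norm ?exprn_ge0//.
by apply: (@le_trans _ _ 1); [exact: exprn_ile1|rewrite ler1n].
Qed.

(** Clamping the variable to [0, 1] makes the sum of a power series D-Lipschitz,
    hence continuous, on the whole line. *)
Definition clamped_series s : R := limn (series (term s)).

Lemma clamped_series_lip s t : `|clamped_series s - clamped_series t| <= D * `|s - t|.
Proof.
rewrite /clamped_series -limB; [|exact: is_cvg_series_term..].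
have cB : cvgn (series (term s) - series (term t)).
  by apply: is_cvgB; exact: is_cvg_series_term.
rewrite -lim_norm//.
apply: limr_le; first exact: is_cvg_norm.
by near=> n; exact: series_term_lip.
Unshelve. all: by end_near. Qed.

Lemma clamped_series0 : clamped_series 0 = e 0%N.
Proof.
rewrite /clamped_series; apply/cvg_lim => //; apply: cvg_near_cst.
near=> n; rewrite -[LHS]/(\sum_(0 <= k < n) term 0 k).
have n0 : (0 < n)%N by near: n; exact: nbhs_infty_gt.
rewrite big_ltn// {1}/term expr0 mulr1 big_nat_cond big1 ?addr0// => k; rewrite andbT => /andP[k0 _].
by rewrite /term unit_clamp_id ?lexx ?ler01// expr0n gtn_eqF// mulr0.
Unshelve. all: by end_near. Qed.

Lemma clamped_series_continuous : continuous clamped_series.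
Proof.
move=> s; apply/cvgrPdist_le => /= eps eps0.
have D0 : 0 <= D by apply: le_trans (eD 0); rewrite big_geq.
have D1 : 0 < D + 1 by rewrite ltr_wpDl.
near=> t; apply: (le_trans (clamped_series_lip s t)).
have : `|s - t| <= eps / (D + 1).
  near: t; apply/nbhs_normP; exists (eps / (D + 1)); first exact: divr_gt0.
  by move=> y /ltW.
rewrite ler_pdivlMr// mulrC => st; apply: le_trans st.
by rewrite ler_wpM2r// lerDl.
Unshelve. all: by end_near. Qed.

End lipschitz_series.

Section bessel_profile.
Variables (R : realType) (lambda : R).
Hypothesis lambda_gt0 : 0 < lambda.
Implicit Types l k : nat.

(** The coefficients of the Bessel series of order l + 1/2 in powers of r^2,
    divided by the leading one. *)
Definition profile_coef l k : R :=
  (-1) ^+ k / k`!%:R * (half_gamma l / half_gamma (k + l)) * (lambda ^+ 2 / 4) ^+ k.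

Definition profile l : R -> R := clamped_series (profile_coef l).

Definition profile_ratio l : R := lambda ^+ 2 / 4 / (l%:R + 3 / 2).

(** With x = [profile_ratio l] the coefficients are at most x^k / k!, so that
    x e^x bounds the sum of k times the k-th coefficient. *)
Definition profile_lip l : R := profile_ratio l * expR (profile_ratio l).

Lemma profile_ratio_ge0 l : 0 <= profile_ratio l.
Proof.
rewrite /profile_ratio divr_ge0 ?divr_ge0 ?sqr_ge0// addr_ge0 ?ler0n//; lra.
Qed.

(** The inverse of the quotient is the product of j + 3/2 over l <= j < k + l,
    and each of these factors is at least l + 3/2. *)
Lemma half_gamma_ratio l k :
  half_gamma l / half_gamma (k + l) <= (l%:R + 3 / 2 : R)^-1 ^+ k.
Proof.
have l0 : 0 < l%:R + 3 / 2 :> R by rewrite ltr_wpDl ?ler0n//; lra.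
elim: k => [|k IH]; first by rewrite expr0 divff// gt_eqF// half_gamma_gt0.
have kl0 : 0 < (k + l)%:R + 3 / 2 :> R by rewrite ltr_wpDl ?ler0n//; lra.
rewrite addSn half_gammaS invfM mulrCA exprS.
apply: ler_pM; [by rewrite invr_ge0 ltW|by rewrite divr_ge0// ltW// half_gamma_gt0| |exact: IH].
by rewrite lef_pV2 ?posrE// lerD2r ler_nat leq_addl.
Qed.

Lemma profile_coef_le l k : `|profile_coef l k| <= profile_ratio l ^+ k / k`!%:R.
Proof.
have x0 : 0 <= (lambda ^+ 2 / 4) ^+ k by rewrite exprn_ge0// divr_ge0// sqr_ge0.
have h0 : 0 <= half_gamma l / half_gamma (k + l) :> R by rewrite divr_ge0// ltW// half_gamma_gt0.
rewrite /profile_coef -2!mulrA normrM normrX normrN1 expr1n mul1r ger0_norm; last first.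
  by rewrite mulr_ge0 ?invr_ge0 ?ler0n// mulr_ge0.
rewrite [leRHS]mulrC ler_wpM2l ?invr_ge0 ?ler0n// /profile_ratio [leRHS]exprMn [leRHS]mulrC.
by rewrite ler_wpM2r// half_gamma_ratio.
Qed.

Lemma sum_exp_coeff_le (x : R) n : 0 <= x -> \sum_(0 <= k < n) x ^+ k / k`!%:R <= expR x.
Proof.
move=> x0; have nd : nondecreasing_seq (series (exp_coeff x)).
  by apply: nondecreasing_series => k _ _; rewrite /exp_coeff/= divr_ge0 ?exprn_ge0.
exact: (nondecreasing_cvgn_le nd (is_cvg_series_exp_coeff x) n).
Qed.

Lemma profile_coef_sum l n :
  \sum_(0 <= k < n) k%:R * `|profile_coef l k| <= profile_lip l.
Proof.
case: n => [|n].
  by rewrite big_geq// mulr_ge0 ?profile_ratio_ge0 ?expR_ge0.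
rewrite big_nat_recl// mul0r add0r.
apply: (@le_trans _ _ (\sum_(0 <= k < n) profile_ratio l * (profile_ratio l ^+ k / k`!%:R))).
  apply: ler_sum => k _.
  apply: (@le_trans _ _ (k.+1%:R * (profile_ratio l ^+ k.+1 / k.+1`!%:R))).
    by rewrite ler_wpM2l// profile_coef_le.
  rewrite factS natrM exprS le_eqVlt; apply/orP; left; apply/eqP.
  have : k`!%:R != 0 :> R by rewrite pnatr_eq0 -lt0n fact_gt0.
  have : k.+1%:R != 0 :> R by rewrite pnatr_eq0.
  by move: (k.+1%:R) (k`!%:R) => a b a0 b0; field; rewrite a0 b0.
rewrite -mulr_sumr ler_wpM2l ?profile_ratio_ge0// sum_exp_coeff_le//.
exact: profile_ratio_ge0.
Qed.

Lemma profile_lipschitz l s t : `|profile l s - profile l t| <= profile_lip l * `|s - t|.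
Proof. apply: clamped_series_lip; exact: profile_coef_sum. Qed.

Lemma continuous_profile l : continuous (profile l).
Proof. apply: clamped_series_continuous; exact: profile_coef_sum. Qed.

Lemma profile0 l : profile l 0 = 1.
Proof.
rewrite /profile clamped_series0 /profile_coef !expr0 fact0 divr1 mulr1 mul1r.
by rewrite divff// gt_eqF// half_gamma_gt0.
Qed.

Lemma profile_lip_small : exists l0, forall l, (l0 <= l)%N -> profile_lip l <= 1 / 3.
Proof.
(* this degree makes the ratio at most 1 / 6, and its exponential at most 2 *)
exists (Num.truncn (6 * (lambda ^+ 2 / 4))).+1 => l l0l.
have r6 : profile_ratio l <= 1 / 6.
  have : 6 * (lambda ^+ 2 / 4) < l%:R.
    by apply: lt_le_trans (truncnS_gt _) _; rewrite ler_nat.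
  have lp : 0 < l%:R + 3 / 2 :> R by rewrite ltr_wpDl ?ler0n//; lra.
  by rewrite /profile_ratio ler_pdivrMr//; lra.
have e2 : expR (profile_ratio l) <= 2.
  have := expR_ge1Dx (- profile_ratio l); rewrite expRN.
  have := expR_gt0 (profile_ratio l); set e := expR _ => e0 h.
  have : 1 / 2 <= e^-1 by lra.
  by rewrite ler_pdivrMr// mulrC ler_pdivlMr// mul1r.
have := profile_ratio_ge0 l; have := expR_ge0 (profile_ratio l).
rewrite /profile_lip; nra.
Qed.

Definition bessel_scale l : R := Num.sqrt pi / 2 * (lambda / 2) ^+ l / half_gamma l.

Lemma bessel_scale_gt0 l : 0 < bessel_scale l.
Proof.
by rewrite /bessel_scale divr_gt0 ?half_gamma_gt0// mulr_gt0 ?exprn_gt0 ?divr_gt0// sqrtr_gt0 pi_gt0.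
Qed.

(** The factor sqrt (pi / (2 t)) with t = lambda r absorbs the half-integral power
    (t / 2)^(1/2) of the Bessel series, which leaves r^l times a series in r^2. *)
Lemma sph_besselE l (r : R) : 0 < r <= 1 ->
  sph_bessel l (lambda * r) = bessel_scale l * (r ^+ l * profile l (r ^+ 2)).
Proof.
move=> /andP[r0 r1]; have t0 : 0 < lambda * r by rewrite mulr_gt0.
rewrite /sph_bessel /bessel_J.
set u := (fun k => _); pose v := (fun k => profile_coef l k * unit_clamp (r ^+ 2) ^+ k).
pose c := (lambda * r / 2) ^+ l * (lambda * r / 2) `^ (1 / 2) / half_gamma l.
have uE : u = (fun k => c * v k).
  apply/funext => k; rewrite /u /v /c /profile_coef.
  have -> : k%:R + (l%:R + 1 / 2) + 1 = (k + l)%:R + 3 / 2 :> R by rewrite natrD; field.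
  rewrite -/(half_gamma _).
  have t2 : 0 < lambda * r / 2 by rewrite divr_gt0.
  have -> : k%:R *+ 2 + (l%:R + 1 / 2) = (k * 2)%:R + l%:R + 1 / 2 :> R.
    by rewrite natrM mulr_natr addrA.
  have t2n : lambda * r / 2 != 0 by rewrite gt_eqF.
  rewrite !powRD; [|by rewrite t2n implybT..].
  rewrite !powR_mulrn ?ltW//.
  rewrite unit_clamp_id; last by rewrite exprn_ge0 ?exprn_ile1 ?(ltW r0).
  have : half_gamma l != 0 :> R by rewrite gt_eqF// half_gamma_gt0.
  have : half_gamma (k + l) != 0 :> R by rewrite gt_eqF// half_gamma_gt0.
  have : k`!%:R != 0 :> R by rewrite pnatr_eq0 -lt0n fact_gt0.
  move: (half_gamma l) (half_gamma (k + l)) (k`!%:R) ((-1) ^+ k) (_ `^ _) => a b d e f d0 b0 a0.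
  have -> : (lambda * r / 2) ^+ (k * 2) = (lambda ^+ 2 / 4) ^+ k * (r ^+ 2) ^+ k.
    by rewrite mulnC exprM -exprMn; congr (_ ^+ k); field.
  by field; rewrite d0 b0 a0.
have -> : series u = (fun n => c * series v n).
  by rewrite uE; apply/funext => n; rewrite /series/= mulr_sumr.
have cv : cvgn (series v) by apply: is_cvg_series_term; exact: profile_coef_sum.
have -> : limn (fun n => c * series v n) = c * limn (series v).
  by apply/cvg_lim => //; apply: cvgMr.
have sq : Num.sqrt (pi / (2 * (lambda * r))) * (lambda * r / 2) `^ (1 / 2) = Num.sqrt pi / 2.
  rewrite div1r powR12_sqrt ?divr_ge0 ?ltW// -sqrtrM ?divr_ge0 ?pi_ge0 ?mulr_ge0 ?ltW//.
  have -> : pi / (2 * (lambda * r)) * (lambda * r / 2) = pi * (2^-1) ^+ 2.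
    have : lambda * r != 0 by rewrite gt_eqF.
    by move: pi (lambda * r) => p x x0; field; rewrite x0.
  by rewrite sqrtrM ?pi_ge0// sqrtr_sqr ger0_norm// invr_ge0.
have -> : limn (series v) = profile l (r ^+ 2) by [].
move: sq; rewrite /c /bessel_scale [lambda * r / 2]mulrAC exprMn.
move: (Num.sqrt (pi / _)) (_ `^ _) (Num.sqrt pi / 2) (profile _ _) => a b d e <-.
by ring.
Qed.

End bessel_profile.

(** * Radial functions and their masses *)

Section radial.
Variables (R : realType) (lambda : R).
Implicit Types l k : nat.
Local Notation mu := (@lebesgue_measure R).

Lemma Rintegral_monomial n (d : R) : 0 <= d ->
  \int[mu]_(r in `[0, d]) r ^+ n = d ^+ n.+1 / n.+1%:R.
Proof.
move=> d0; apply: (@Rintegral_FTC2 _ (fun r => r ^+ n.+1 / n.+1%:R)) => //.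
- exact: exprn_continuous.
- move=> x.
  have -> : (fun r : R => r ^+ n.+1 / n.+1%:R) = (fun r => (n.+1%:R)^-1 *: (r ^+ n.+1 : R^o)).
    by apply/funext => r; rewrite /GRing.scale/= mulrC.
  have -> : x ^+ n = (n.+1%:R)^-1 *: (n.+1%:R * x ^+ n : R^o).
    by rewrite /GRing.scale/= mulKf// pnatr_eq0.
  apply: is_deriveZ.
  have := @is_deriveX R R id n.+1 x 1 1 (is_derive_id x 1).
  rewrite /GRing.scale/= mulr1.
  by have -> : (id ^+ n.+1 : R -> R) = (fun r => r ^+ n.+1) by apply/funext => r; rewrite exprfctE.
- by rewrite expr0n/= mul0r subr0.
Qed.

Definition radial l (r : R) : R := r ^+ l * profile lambda l (r ^+ 2).

Lemma continuous_radial l : continuous (radial l).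
Proof.
apply: continuous_mulr; first exact: exprn_continuous.
move=> r; apply: (@continuous_comp _ _ _ (fun r : R => r ^+ 2)); first exact: exprn_continuous.
exact: continuous_profile.
Qed.

Lemma continuous_radial_sqr l : continuous (fun r => radial l r ^+ 2 * r ^+ 2).
Proof.
apply: continuous_mulr; last exact: exprn_continuous.
move=> r; apply: (@continuous_comp _ _ _ (radial l) (fun y => y ^+ 2)).
  exact: continuous_radial.
exact: exprn_continuous.
Qed.

Lemma radial_bounded l : exists B, forall r, 0 <= r <= 1 -> radial l r ^+ 2 <= B.
Proof.
exists ((1 + profile_lip lambda l) ^+ 2) => r /andP[r0 r1].
have D0 : 0 <= profile_lip lambda l by rewrite mulr_ge0 ?profile_ratio_ge0 ?expR_ge0.
have p : `|profile lambda l (r ^+ 2)| <= 1 + profile_lip lambda l.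
  have := profile_lipschitz lambda l (r ^+ 2) 0.
  rewrite profile0 subr0 (ger0_norm (sqr_ge0 r)) => h.
  have : profile_lip lambda l * r ^+ 2 <= profile_lip lambda l.
    by rewrite -[leRHS]mulr1 ler_wpM2l// exprn_ile1.
  have := ler_normD (profile lambda l (r ^+ 2) - 1) 1; rewrite subrK normr1; lra.
have r0l : `|radial l r| <= 1 + profile_lip lambda l.
  rewrite /radial normrM ger0_norm ?exprn_ge0// -[leRHS]mul1r.
  by rewrite ler_pM ?exprn_ge0 ?exprn_ile1.
rewrite -[leLHS]real_normK ?num_real// ler_pXn2r ?nnegrE//.
by rewrite addr_ge0.
Qed.

Definition radial_mass l : R := \int[mu]_(r in `[0, 1]) (radial l r ^+ 2 * r ^+ 2).

(** Close to 0 the profile is at least 1/2, because it is Lipschitz and takes the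
    value 1 at 0. *)
Lemma radial_mass_gt0 l : 0 < radial_mass l.
Proof.
have D0 : 0 <= profile_lip lambda l by rewrite mulr_ge0 ?profile_ratio_ge0 ?expR_ge0.
(* profile_lip * d <= 1 / 2 keeps the profile above 1 / 2 on [0, d] *)
pose d := (2 * profile_lip lambda l + 2)^-1.
have c0 : 0 < 2 * profile_lip lambda l + 2 by lra.
have d0 : 0 < d by rewrite invr_gt0.
have d1 : d <= 1 by rewrite invf_le1//; lra.
have Dd : profile_lip lambda l * d <= 1 / 2 by rewrite ler_pdivrMr//; lra.
have cp : continuous (fun r : R => 1 / 4 * (r ^+ (2 * l + 2))).
  by apply: continuous_mulr; [exact: continuous_cstr|exact: exprn_continuous].
have i1 : 0 < \int[mu]_(r in `[0, d]) (1 / 4 * (r ^+ (2 * l + 2))).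
  rewrite RintegralZl//; last by apply: continuous_itv_integrable; exact: exprn_continuous.
  by rewrite Rintegral_monomial ?ltW// mulr_gt0 ?divr_gt0 ?exprn_gt0// ltr0n.
apply: lt_le_trans i1 _; rewrite -lee_fin /radial_mass -(integral_continuous_itv 0 d cp).
rewrite -(integral_continuous_itv 0 1 (@continuous_radial_sqr l)).
have mr : measurable_fun [set: measurableTypeR R] (fun r => (radial l r ^+ 2 * r ^+ 2)%:E).
  by apply/measurable_EFinP; apply: continuous_measurable_fun; exact: continuous_radial_sqr.
apply: (@le_trans _ _ (\int[mu]_(r in `[0%R, d]) (radial l r ^+ 2 * r ^+ 2)%:E)%E).
  apply: ge0_le_integral => //.
  - by move=> r; rewrite /= in_itv/= => /andP[r0 _]; rewrite lee_fin mulr_ge0 ?exprn_ge0//; lra.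
  - by apply/measurable_EFinP; apply: measurable_funTS; apply: continuous_measurable_fun.
  - exact: measurable_funTS.
  - move=> r; rewrite /= in_itv/= lee_fin => /andP[r0 rd].
    have p : 1 / 2 <= profile lambda l (r ^+ 2).
      have := profile_lipschitz lambda l 0 (r ^+ 2).
      rewrite profile0 sub0r normrN (ger0_norm (sqr_ge0 r)) => h.
      have : profile_lip lambda l * r ^+ 2 <= 1 / 2.
        apply: le_trans Dd; rewrite ler_wpM2l// expr2 -[leRHS]mul1r.
        by rewrite ler_pM// (le_trans rd).
      have := ler_norm (1 - profile lambda l (r ^+ 2)); lra.
    rewrite /radial; have -> : (r ^+ l * profile lambda l (r ^+ 2)) ^+ 2 * r ^+ 2 =
        r ^+ (2 * l + 2) * profile lambda l (r ^+ 2) ^+ 2.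
      by rewrite exprD mulnC exprM; ring.
    by rewrite [leLHS]mulrC ler_wpM2l ?exprn_ge0//; nra.
apply: ge0_subset_integral => //.
- exact: measurable_funTS.
- by move=> r _; rewrite lee_fin mulr_ge0 ?sqr_ge0.
- by move=> r; rewrite /= !in_itv/= => /andP[-> /le_trans->].
Qed.

Section large_degree.
Variable l : nat.
Hypothesis l2 : (2 <= l)%N.
Hypothesis lip3 : profile_lip lambda l <= 1 / 3.

Let profile_close (r : R) : 0 <= r <= 1 -> `|profile lambda l (r ^+ 2) - profile lambda l 1| <= 1 / 3 * (1 - r ^+ 2).
Proof.
move=> /andP[r0 r1]; apply: le_trans (profile_lipschitz lambda l (r ^+ 2) 1) _.
have r2 : r ^+ 2 <= 1 by rewrite exprn_ile1.
by rewrite distrC ger0_norm ?subr_ge0// ler_wpM2r// subr_ge0.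
Qed.

Let profile_near1 (s : R) : 0 <= s <= 1 -> 2 / 3 <= profile lambda l s <= 4 / 3.
Proof.
move=> /andP[s0 s1]; have := profile_lipschitz lambda l s 0.
rewrite profile0 subr0 (ger0_norm s0) ler_norml => /andP[h1 h2].
have h3 : profile_lip lambda l * s <= 1 / 3.
  apply: le_trans lip3; rewrite -[leRHS]mulr1 ler_wpM2l//.
  by rewrite mulr_ge0 ?profile_ratio_ge0 ?expR_ge0.
by apply/andP; split; lra.
Qed.

Lemma radial1_gt0 : 0 < radial l 1.
Proof.
rewrite /radial !expr1n mul1r; have := @profile_near1 1.
by rewrite ler01 lexx => /(_ isT) /andP[h _]; lra.
Qed.

(** From 1 to r the factor r^l drops to at most r^2, as l >= 2, whereas the
    profile gains at most (1 - r^2) / 3; since the profile is at least 2/3 at 1,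
    the product does not increase. *)
Lemma radial_le_boundary (r : R) : 0 <= r <= 1 -> radial l r ^+ 2 <= radial l 1 ^+ 2.
Proof.
move=> r01; have /andP[r0 r1] := r01.
have r2 : r ^+ 2 <= 1 by rewrite exprn_ile1.
have /andP[h1 h2] : 2 / 3 <= profile lambda l (r ^+ 2) <= 4 / 3.
  by apply: profile_near1; rewrite sqr_ge0.
have /andP[k1 k2] : 2 / 3 <= profile lambda l 1 <= 4 / 3.
  by apply: profile_near1; rewrite ler01 lexx.
have := profile_close r01; rewrite ler_norml => /andP[_ h3].
have rl : r ^+ l <= r ^+ 2 by rewrite ler_wiXn2l.
have rl0 : 0 <= r ^+ l by rewrite exprn_ge0.
have p0 : 0 <= radial l r by rewrite /radial mulr_ge0//; lra.
rewrite ler_pXn2r ?nnegrE//; last exact/ltW/radial1_gt0.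
rewrite /radial !expr1n mul1r.
apply: (@le_trans _ _ (r ^+ 2 * profile lambda l (r ^+ 2))).
  by rewrite ler_wpM2r//; lra.
have r20 := sqr_ge0 r; move: (r ^+ 2) (profile _ _ (r ^+ 2)) (profile _ _ 1) r2 h1 h2 k1 k2 h3 r20.
move=> s p q s1 ? ? ? ? h s0.
have : s * p <= s * (q + 1 / 3 * (1 - s)) by rewrite ler_wpM2l//; lra.
nra.
Qed.

(** The profile stays between 2/3 and 4/3, so that its value at r^2 is at most
    twice its value at 1; hence the 4.  The integral of r^(2 l + 2) over [0, 1]
    is 1 / (2 l + 3). *)
Lemma radial_mass_le : radial_mass l <= 4 * radial l 1 ^+ 2 / (2 * l + 3)%:R.
Proof.
have /andP[k1 k2] : 2 / 3 <= profile lambda l 1 <= 4 / 3.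
  by apply: profile_near1; rewrite ler01 lexx.
rewrite /radial_mass.
apply: (@le_trans _ _ (\int[mu]_(r in `[0, 1]) (4 * radial l 1 ^+ 2 * r ^+ (2 * l + 2)))).
  apply: le_Rintegral => //.
  - by apply: continuous_itv_integrable; exact: continuous_radial_sqr.
  - apply: continuous_itv_integrable; apply: continuous_mulr; first exact: continuous_cstr.
    exact: exprn_continuous.
  - move=> r; rewrite /= in_itv/= => /andP[r0 r1].
    have /andP[h1 h2] : 2 / 3 <= profile lambda l (r ^+ 2) <= 4 / 3.
      by apply: profile_near1; rewrite sqr_ge0 exprn_ile1.
    rewrite /radial; have -> : (r ^+ l * profile lambda l (r ^+ 2)) ^+ 2 * r ^+ 2 =
        profile lambda l (r ^+ 2) ^+ 2 * r ^+ (2 * l + 2).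
      by rewrite exprD mulnC exprM; ring.
    by rewrite ler_wpM2r ?exprn_ge0// !expr1n mul1r; nra.
rewrite RintegralZl//; last by apply: continuous_itv_integrable; exact: exprn_continuous.
by rewrite Rintegral_monomial// expr1n mul1r -addnS.
Qed.

End large_degree.

Lemma large_degree_exists : exists l0, forall l, (l0 <= l)%N ->
  (2 <= l)%N /\ profile_lip lambda l <= 1 / 3.
Proof.
have [l0 h] := profile_lip_small lambda; exists (maxn 2 l0) => l.
by rewrite geq_max => /andP[l2 /h].
Qed.

End radial.

(** * Spherical harmonics *)

Local Open Scope complex_scope.

Section spherical_harmonics.
Variable R : realType.
Implicit Types l k n : nat.
Local Notation P := (@legendre_deriv R).
Local Notation normc := ComplexField.Normc.normc.
Local Notation C := R[i].

Lemma normc_sqr (z : C) : normc z ^+ 2 = complex.Re z ^+ 2 + complex.Im z ^+ 2.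
Proof. by case: z => a b /=; rewrite sqr_sqrtr// addr_ge0// sqr_ge0. Qed.

Lemma normc_sqrM (z1 z2 : C) : normc (z1 * z2) ^+ 2 = normc z1 ^+ 2 * normc z2 ^+ 2.
Proof. by rewrite ComplexField.Normc.normcM exprMn. Qed.

Lemma normc_sqrX (z : C) k : normc (z ^+ k) ^+ 2 = (normc z ^+ 2) ^+ k.
Proof.
elim: k => [|k IH]; last by rewrite (exprS z) normc_sqrM IH -exprS.
by rewrite !expr0 normc_sqr/= expr0n addr0 expr1n.
Qed.

Lemma normc_sqr_real (a : R) : normc (a%:C) ^+ 2 = a ^+ 2.
Proof. by rewrite normc_sqr/= expr0n addr0. Qed.

Lemma normc_sqr_conj (z : C) : normc (z^* ) ^+ 2 = normc z ^+ 2.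
Proof. by rewrite !normc_sqr; case: z => a b /=; rewrite sqrrN. Qed.

Lemma sph_harm_norm_sqr l k : (k <= l)%N ->
  sph_harm_norm R l k ^+ 2 = (2 * l + 1)%:R / (4 * pi) * legendre_ratio R l k.
Proof.
move=> kl; rewrite /sph_harm_norm sqr_sqrtr//.
by rewrite mulr_ge0 ?divr_ge0 ?ler0n// mulr_ge0 ?pi_ge0// ler0n.
Qed.

Lemma normc_sph_harm_nat l k (x : R3 R) : (k <= l)%N -> norm3 x = 1 ->
  normc (sph_harm_nat l k x) ^+ 2 = (2 * l + 1)%:R / (4 * pi) *
    (legendre_ratio R l k * ((1 - x.2 ^+ 2) ^+ k * (P l k).[x.2] ^+ 2)).
Proof.
move=> kl x1; rewrite /sph_harm_nat normc_sqrM normc_sqrX normc_sqr_real.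
rewrite normc_sqr/= !exprMn sph_harm_norm_sqr// sqrr_sign.
have -> : x.1.1 ^+ 2 + x.1.2 ^+ 2 = 1 - x.2 ^+ 2.
  apply/eqP; rewrite eq_sym subr_eq; apply/eqP.
  have := congr1 (fun r => r ^+ 2) x1; rewrite /norm3 expr1n sqr_sqrtr//.
  by rewrite !addr_ge0// sqr_ge0.
move: (_ / (4 * pi)) (legendre_ratio R l k) (P l k).[x.2] ((1 - _) ^+ k) => a b c d.
by ring.
Qed.

Lemma normc_sph_harm l (q : int) (x : R3 R) :
  normc (sph_harm l q x) ^+ 2 = normc (sph_harm_nat l `|q|%N x) ^+ 2.
Proof.
case: q => k //=; rewrite normc_sqrM normc_sqr_conj normc_sqrX.
by rewrite normc_sqr/= oppr0 expr0n addr0 sqrrN expr1n expr1n mul1r.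
Qed.

Lemma sum_centered (f : nat -> R) l :
  \sum_(j < (2 * l).+1) f `|j%:Z - l%:Z|%N = f 0%N + (\sum_(k < l) f k.+1) *+ 2.
Proof.
rewrite -(big_mkord xpredT (fun j => f `|j%:Z - l%:Z|%N)) (@big_cat_nat _ _ _ l)//=; last lia.
rewrite [X in _ + X]big_ltn; last lia.
rewrite subrr absz0 addrCA mulr2n; congr (_ + (_ + _)).
  rewrite big_mkord (reindex_inj rev_ord_inj)/=; apply: eq_bigr => i _.
  congr f; have := ltn_ord i; lia.
rewrite -[l.+1]addn0 addnC big_addn (_ : (2 * l).+1 - l.+1 = l)%N; last lia.
rewrite big_mkord; apply: eq_bigr => i _; congr f; lia.
Qed.

(** The addition theorem on the diagonal: the sum does not depend on the point,
    which makes the Christoffel sum radial. *)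
Lemma sum_normc_sph_harm l (x : R3 R) : norm3 x = 1 ->
  \sum_(j < (2 * l).+1) normc (sph_harm l (j%:Z - l%:Z) x) ^+ 2 =
  (2 * l + 1)%:R / (4 * pi).
Proof.
move=> x1.
under eq_bigr do rewrite normc_sph_harm.
rewrite (sum_centered (fun k => normc (sph_harm_nat l k x) ^+ 2)).
rewrite normc_sph_harm_nat// legendre_ratio0 expr0 !mul1r.
under eq_bigr do rewrite normc_sph_harm_nat//.
by rewrite -mulr_sumr -mulrnAr -mulrDr addition_theorem mulr1.
Qed.

End spherical_harmonics.

Section angular.
Variable R : realType.
Implicit Types l k n : nat.
Local Notation P := (@legendre_deriv R).
Local Notation mu := (@lebesgue_measure R).
Local Notation C := R[i].

(** The sign (-1)^k in the relation of Y_(l,-k) to the conjugate of Y_(l,k). *)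
Definition negative_sign (q : int) : R := if q is Negz n then (-1) ^+ n.+1 else 1.

Definition polar_part l (q : int) (t : R) : R :=
  negative_sign q * (sph_harm_norm R l `|q|%N * assoc_legendre l `|q|%N (cos t)).

Lemma sph_harm_polar l (q : int) (t s : R) : 0 <= t <= pi ->
  sph_harm l q (spherical (t, s)) =
  (polar_part l q t)%:C * (cos (q%:~R * s) +i* sin (q%:~R * s)).
Proof.
move=> tpi; case: q => k; first by rewrite sph_harm_spherical// /polar_part mul1r.
rewrite /sph_harm -[sph_harm_nat l k.+1 _]/(sph_harm l k.+1 _) sph_harm_spherical//.
rewrite /polar_part /negative_sign NegzE mulrNz -pmulrn mulNr cosN sinN.
have -> : (-1 : C) ^+ k.+1 = ((-1) ^+ k.+1 : R)%:C by rewrite rmorphXn rmorphN1.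
rewrite abszN absz_nat.
move: (sph_harm_norm R l k.+1 * assoc_legendre l k.+1 (cos t)) ((-1) ^+ k.+1 : R) (cos (k.+1%:R * s)) (sin (k.+1%:R * s)) => a b c d.
by simpc; congr (_ +i* _); ring.
Qed.

Lemma sph_harm_product l l' (q q' : int) (t s : R) : 0 <= t <= pi ->
  sph_harm l q (spherical (t, s)) * (sph_harm l' q' (spherical (t, s)))^* =
  (polar_part l q t * polar_part l' q' t * cos ((q - q')%:~R * s)) +i*
  (polar_part l q t * polar_part l' q' t * sin ((q - q')%:~R * s)).
Proof.
move=> tpi; rewrite !sph_harm_polar// rmorphB/= mulrBl cosB sinB.
move: (polar_part _ _ _) (polar_part _ _ _) (cos _) (sin _) (cos _) (sin _) => a b c d e f.
by simpc; congr (_ +i* _); ring.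
Qed.

Lemma continuous_polar_part l q : continuous (polar_part l q).
Proof.
do 2! [apply: continuous_mulr; first exact: continuous_cstr].
apply: continuous_mulr; last exact: continuous_cos_horner.
apply: continuous_mulr; first exact: continuous_cstr.
move=> t; apply: (@continuous_comp _ _ _ (fun t => Num.sqrt (1 - cos t ^+ 2)) (fun x => x ^+ `|q|%N)); last exact: exprn_continuous.
apply: (@continuous_comp _ _ _ (fun t => 1 - cos t ^+ 2) Num.sqrt); last exact: sqrt_continuous.
apply: continuousB; first exact: cst_continuous.
by apply: (@continuous_comp _ _ _ cos (fun y => y ^+ 2)); [exact: continuous_cos|exact: exprn_continuous].
Qed.

Lemma negative_sign_sqr q : negative_sign q * negative_sign q = 1.
Proof. by case: q => n; rewrite /= ?mulr1// -expr2 sqrr_sign. Qed.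

Lemma polar_part_orthonormal l l' (q : int) : (`|q| <= l)%N -> (`|q| <= l')%N ->
  \int[mu]_(t in `[0, pi]) (polar_part l q t * polar_part l' q t * sin t) =
  (l == l')%:R / (2 * pi).
Proof.
move=> ql ql'; set k := `|q|%N in ql ql'.
transitivity (\int[mu]_(t in `[0, pi])
   ((sph_harm_norm R l k * sph_harm_norm R l' k) *
   (((1 - 'X^2) ^+ k * P l k * P l' k).[cos t] * sin t) + 0 * 1)).
  congr Rintegral; apply/funext => t; rewrite mul0r addr0 [RHS]mulrA; congr (_ * _).
  rewrite /polar_part -/k /assoc_legendre.
  have -> : ((1 - 'X^2) ^+ k * P l k * P l' k).[cos t] =
      Num.sqrt (1 - cos t ^+ 2) ^+ k * Num.sqrt (1 - cos t ^+ 2) ^+ k * ((P l k).[cos t] * (P l' k).[cos t]).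
    rewrite !hornerM horner_exp hornerD hornerN hornerXn hornerC -!mulrA.
    by rewrite [RHS]mulrA -exprMn -expr2 sqr_sqrtr// -sin2cos2 sqr_ge0.
  have := negative_sign_sqr q; have := sqrr_sign R k; rewrite expr2.
  move: (negative_sign q) ((-1) ^+ k) (sph_harm_norm R l k) (sph_harm_norm R l' k) (Num.sqrt _ ^+ k) (P l k).[_] (P l' k).[_].
  move=> a b c d e f g bb aa.
  transitivity ((a * a) * (b * b) * (c * d * (e * e * (f * g)))); first by ring.
  by rewrite aa bb !mul1r.
rewrite Rintegral_lin; last exact: continuous_cstr; last first.
  by apply: continuous_mulr; [exact: continuous_cos_horner|exact: continuous_sin].
rewrite mul0r addr0 -/(cos_integral _).
have [<-|ll'] := eqVneq l l'; last by rewrite legendre_orthogonal// mulr0 mul0r.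
rewrite -expr2 sph_harm_norm_sqr// -[_ * legendre_ratio R l k * _]mulrA legendre_sqr//.
have : (2 * l + 1)%:R != 0 :> R by rewrite addn1 pnatr_eq0.
have : pi != 0 :> R by rewrite gt_eqF// pi_gt0.
rewrite mulr1n; move: pi (2 * l + 1)%:R => p n p0 n0.
by field; rewrite p0 n0.
Qed.

(** Of the primitives of cos (n s) and sin (n s), only the one of cos (0 s) = 1
    has a nonzero increment over the full circle. *)
Definition cos_primitive (n : int) (s : R) : R :=
  if n == 0 then s else sin (n%:~R * s) / n%:~R.

Definition sin_primitive (n : int) (s : R) : R :=
  if n == 0 then 0 else - (cos (n%:~R * s) / n%:~R).

Let is_derive_lin (c s : R) : is_derive s (1 : R) (fun x => c * x) c.
Proof.
have := @is_deriveZ _ _ _ id c s 1 1 (is_derive_id s 1).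
by rewrite /GRing.scale/= mulr1.
Qed.

Lemma is_derive_cos_primitive (n : int) (s : R) :
  is_derive s (1 : R) (cos_primitive n) (cos (n%:~R * s)).
Proof.
have [->|n0] := eqVneq n 0.
  by rewrite mul0r cos0; exact: is_derive_id.
have nR : n%:~R != 0 :> R by rewrite intr_eq0.
have -> : cos_primitive n = fun s => (n%:~R)^-1 *: (sin (n%:~R * s) : R^o).
  by apply/funext => x; rewrite /cos_primitive (negbTE n0) mulrC.
have -> : cos (n%:~R * s) = (n%:~R)^-1 *: (cos (n%:~R * s) * n%:~R : R^o).
  by rewrite /GRing.scale/= mulrCA mulVf ?mulr1.
apply: is_deriveZ.
exact: (@is_derive1_comp _ sin (fun x => n%:~R * x) s _ _ (is_derive_sin _) (is_derive_lin _ _)).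
Qed.

Lemma is_derive_sin_primitive (n : int) (s : R) :
  is_derive s (1 : R) (sin_primitive n) (sin (n%:~R * s)).
Proof.
have [->|n0] := eqVneq n 0.
  by rewrite mul0r sin0; exact: is_derive_cst.
have nR : n%:~R != 0 :> R by rewrite intr_eq0.
have -> : sin_primitive n = fun s => (- (n%:~R)^-1) *: (cos (n%:~R * s) : R^o).
  by apply/funext => x; rewrite /sin_primitive (negbTE n0) mulrC /GRing.scale/= mulNr.
have -> : sin (n%:~R * s) = (- (n%:~R)^-1) *: (- sin (n%:~R * s) * n%:~R : R^o).
  by rewrite /GRing.scale/= mulrCA !mulNr mulrN opprK mulVf ?mulr1.
apply: is_deriveZ.
exact: (@is_derive1_comp _ cos (fun x => n%:~R * x) s _ _ (is_derive_cos _) (is_derive_lin _ _)).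
Qed.

Lemma sincos_intr2pi (n : int) : sin (n%:~R * (pi *+ 2)) = 0 :> R /\ cos (n%:~R * (pi *+ 2)) = 1 :> R.
Proof.
have nat_case k : sin (k%:R * (pi *+ 2)) = 0 :> R /\ cos (k%:R * (pi *+ 2)) = 1 :> R.
  elim: k => [|k [IHs IHc]]; first by rewrite mul0r sin0 cos0.
  rewrite -natr1 mulrDl mul1r (sinD (k%:R * _)) (cosD (k%:R * _)) IHs IHc sin2pi cos2pi.
  by split; ring.
case: n => k; first exact: nat_case.
have [s c] := nat_case k.+1.
by rewrite NegzE mulrNz -pmulrn mulNr sinN cosN s c oppr0.
Qed.

Lemma cos_primitive_period (n : int) :
  cos_primitive n (pi *+ 2) - cos_primitive n 0 = if n == 0 then pi *+ 2 else 0.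
Proof.
rewrite /cos_primitive; case: eqP => _; first by rewrite subr0.
by rewrite (sincos_intr2pi n).1 mulr0 sin0 !mul0r subrr.
Qed.

Lemma sin_primitive_period (n : int) : sin_primitive n (pi *+ 2) - sin_primitive n 0 = 0.
Proof.
rewrite /sin_primitive; case: eqP => _; first by rewrite subrr.
by rewrite (sincos_intr2pi n).2 mulr0 cos0 subrr.
Qed.

(** Harmonics of different orders are separated by the azimuthal factor, those
    of equal order and different degrees by the polar factor. *)
Lemma sphere_orthonormal l l' (q q' : int) : (`|q| <= l)%N -> (`|q'| <= l')%N ->
  \int[mu]_(t in `[0, pi]) (polar_part l q t * polar_part l' q' t * sin t) *
  (cos_primitive (q - q') (pi *+ 2) - cos_primitive (q - q') 0) = ((l == l') && (q == q'))%:R.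
Proof.
move=> ql ql'; rewrite cos_primitive_period subr_eq0.
have [qq'|qq'] := eqVneq q q'; last by rewrite andbF mulr0.
move: ql'; rewrite -qq' => ql'.
rewrite polar_part_orthonormal// andbT.
have : pi != 0 :> R by rewrite gt_eqF// pi_gt0.
by case: (l == l'); rewrite ?mul0r// mulr1n; move: pi => p p0; rewrite mulr2n; field.
Qed.

End angular.

(** * Complex integrals and the Christoffel sum *)

Section complex_integral.
Context (R : realType) (d : measure_display) (T : measurableType d).
Local Notation C := R[i].
Variables (Om : set T) (mu : {measure set T -> \bar R}).
Hypothesis mOm : measurable Om.
Implicit Types f g : T -> C.

Definition complex_integrable f : Prop :=
  mu.-integrable Om (EFin \o (fun x => complex.Re (f x))) /\
  mu.-integrable Om (EFin \o (fun x => complex.Im (f x))).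

Definition complex_integral f : C :=
  (\int[mu]_(x in Om) complex.Re (f x)) +i* (\int[mu]_(x in Om) complex.Im (f x)).

Lemma innerE f g : inner Om mu f g = complex_integral (fun x => f x * (g x)^* ).
Proof. by []. Qed.

Lemma eq_complex_integral f g : (forall x, Om x -> f x = g x) ->
  complex_integral f = complex_integral g.
Proof.
move=> fg; congr (_ +i* _); apply: eq_Rintegral => x; rewrite inE => /fg -> //.
Qed.

Lemma integrable_rlin (a b : R) (f g : T -> R) :
  mu.-integrable Om (EFin \o f) -> mu.-integrable Om (EFin \o g) ->
  mu.-integrable Om (EFin \o (fun x => a * f x + b * g x)) /\
  \int[mu]_(x in Om) (a * f x + b * g x) =
  a * (\int[mu]_(x in Om) f x) + b * (\int[mu]_(x in Om) g x).
Proof.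
move=> i_f ig.
have iZ (c : R) h : mu.-integrable Om (EFin \o h) ->
    mu.-integrable Om (EFin \o (fun x => c * h x)).
  move=> ih; rewrite (_ : _ \o _ = (fun x => c%:E * (EFin \o h) x)%E).
    exact: integrableZl.
  by apply/funext => x; rewrite /= EFinM.
have iaf := iZ a f i_f; have ibg := iZ b g ig.
split.
  rewrite (_ : _ \o _ = ((EFin \o (fun x => a * f x)%R) \+ (EFin \o (fun x => b * g x)%R))%E).
    exact: integrableD.
  by apply/funext => x; rewrite /= EFinD.
by rewrite RintegralD// !RintegralZl.
Qed.

Lemma complex_integralZ (c : C) f : complex_integrable f ->
  complex_integrable (fun x => c * f x) /\
  complex_integral (fun x => c * f x) = c * complex_integral f.
Proof.
case: c => a b [ir ii].
have reE x : complex.Re ((a +i* b) * f x) = a * complex.Re (f x) + (- b) * complex.Im (f x).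
  by case: (f x) => u v /=; ring.
have imE x : complex.Im ((a +i* b) * f x) = b * complex.Re (f x) + a * complex.Im (f x).
  by case: (f x) => u v /=; ring.
have [i1 e1] := integrable_rlin a (- b) ir ii.
have [i2 e2] := integrable_rlin b a ir ii.
rewrite /complex_integrable /complex_integral.
rewrite (_ : (fun x => complex.Re ((a +i* b) * f x)) = (fun x => a * complex.Re (f x) + (- b) * complex.Im (f x))); last exact/funext.
rewrite (_ : (fun x => complex.Im ((a +i* b) * f x)) = (fun x => b * complex.Re (f x) + a * complex.Im (f x))); last exact/funext.
by split=> //; rewrite e1 e2; simpc; congr (_ +i* _); ring.
Qed.

Lemma complex_integralD f g : complex_integrable f -> complex_integrable g ->
  complex_integrable (fun x => f x + g x) /\
  complex_integral (fun x => f x + g x) = complex_integral f + complex_integral g.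
Proof.
move=> [fr fi] [gr gi].
have [i1 e1] := integrable_rlin 1 1 fr gr.
have [i2 e2] := integrable_rlin 1 1 fi gi.
rewrite /complex_integrable /complex_integral.
rewrite (_ : (fun x => complex.Re (f x + g x)) = (fun x => 1 * complex.Re (f x) + 1 * complex.Re (g x))); last first.
  by apply/funext => x; case: (f x) (g x) => u v [u' v']; rewrite !mul1r.
rewrite (_ : (fun x => complex.Im (f x + g x)) = (fun x => 1 * complex.Im (f x) + 1 * complex.Im (g x))); last first.
  by apply/funext => x; case: (f x) (g x) => u v [u' v']; rewrite !mul1r.
by split=> //; rewrite e1 e2 !mul1r; simpc.
Qed.

Lemma complex_integral_sum (I : Type) (s : seq I) (c : I -> C) (h : I -> T -> C) :
  (forall i, complex_integrable (h i)) ->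
  complex_integrable (fun x => \sum_(i <- s) c i * h i x) /\
  complex_integral (fun x => \sum_(i <- s) c i * h i x) =
  \sum_(i <- s) c i * complex_integral (h i).
Proof.
move=> ih; elim: s => [|i s [IH1 IH2]].
  under eq_fun do rewrite big_nil; rewrite big_nil; split.
    by split; exact: integrable0.
  by rewrite /complex_integral /= Rintegral_cst// mul0r.
under eq_fun do rewrite big_cons.
have [i1 e1] := complex_integralZ (c i) (ih i).
have [i2 e2] := complex_integralD i1 IH1.
by split=> //; rewrite big_cons -e1 -IH2.
Qed.

End complex_integral.

Section christoffel_basis.
Context (R : realType) (d : measure_display) (T : measurableType d).
Local Notation C := R[i].
Variables (Om : set T) (mu : {measure set T -> \bar R}) (V : set (T -> C)) (m : nat).
Hypothesis mOm : measurable Om.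
Variable e : 'I_m -> T -> C.
Hypothesis eV : orthonormal_basis Om V mu e.
Hypothesis e_int : forall i j, complex_integrable Om mu (fun x => e i x * (e j x)^* ).

Lemma normc_sqr_conjE (z : C) : (ComplexField.Normc.normc z ^+ 2)%:C = z * z^*.
Proof.
case: z => a b /=; rewrite sqr_sqrtr ?addr_ge0 ?sqr_ge0//.
by simpc; congr (_ +i* _); ring.
Qed.

Lemma christoffel_sumE (L : 'I_m -> T -> C) x :
  (christoffel_sum L x)%:C = \sum_j L j x * (L j x)^*.
Proof. by rewrite /christoffel_sum rmorph_sum; apply: eq_bigr => j _; rewrite /= normc_sqr_conjE. Qed.

(** Let L = U e with a square matrix U.  Orthonormality of both families says
    that U times its adjoint is the identity; then so is the adjoint times U, and
    U preserves the sum of the squared moduli at every point of Om. *)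
Lemma christoffel_sum_basis (L : 'I_m -> T -> C) : orthonormal_basis Om V mu L ->
  forall x, Om x -> christoffel_sum L x = christoffel_sum e x.
Proof.
move=> [LV Lo _] x Ox; have [_ eo eg] := eV.
have [U LU] : {U : 'M[C]_m | forall i y, Om y -> L i y = \sum_j U i j * e j y}.
  have h i : {c : 'I_m -> C | forall y, Om y -> L i y = \sum_j c j * e j y}.
    exact/cid/eg/LV.
  exists (\matrix_(i, j) sval (h i) j) => i y Oy.
  rewrite (svalP (h i) y Oy); apply: eq_bigr => j _; by rewrite mxE.
have expand i k y : Om y -> L i y * (L k y)^* =
    \sum_(p : 'I_m * 'I_m) (U i p.1 * (U k p.2)^* ) * (e p.1 y * (e p.2 y)^* ).
  move=> Oy; rewrite !LU// rmorph_sum big_distrlr/= pair_bigA/=.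
  by apply: eq_bigr => p _; rewrite rmorphM mulrACA.
have UU : U *m (map_mx (fun z : C => z^* ) U)^T = 1%:M.
  apply/matrixP => i k; rewrite !mxE -Lo innerE.
  rewrite (eq_complex_integral mu (fun y Oy => expand i k y Oy)).
  have [_ ->] := complex_integral_sum mOm (index_enum _) (fun p : 'I_m * 'I_m => U i p.1 * (U k p.2)^* )
    (fun p => e_int p.1 p.2).
  rewrite -(pair_bigA _ (fun j j' => U i j * (U k j')^* * complex_integral Om mu (fun y => e j y * (e j' y)^* )))/=.
  apply: eq_bigr => j _; rewrite (bigD1 j)//= -innerE eo eqxx mulr1 big1 ?addr0 ?mxE// => j' jj'.
  by rewrite -innerE eo eq_sym (negbTE jj') mulr0.
have UU' := mulmx1C UU.
suff : (christoffel_sum L x)%:C = (christoffel_sum e x)%:C by move=> /(congr1 (@complex.Re R)).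
rewrite !christoffel_sumE.
under eq_bigr do rewrite expand//.
rewrite exchange_big/= -(pair_bigA _ (fun j j' => \sum_i U i j * (U i j')^* * (e j x * (e j' x)^* )))/=.
apply: eq_bigr => j _; rewrite (bigD1 j)//= [X in _ + X]big1 ?addr0.
  rewrite -mulr_suml (_ : \sum_i _ = 1) ?mul1r//.
  have := congr1 (fun A : 'M[C]_m => A j j) UU'; rewrite !mxE eqxx mulr1n => E; apply: etrans E.
  by apply: eq_bigr => i _; rewrite !mxE mulrC.
move=> j' jj'; rewrite -mulr_suml (_ : \sum_i _ = 0) ?mul0r//.
have := congr1 (fun A : 'M[C]_m => A j' j) UU'; rewrite !mxE (negbTE jj') mulr0n => E; apply: etrans E.
by apply: eq_bigr => i _; rewrite !mxE mulrC.
Qed.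

End christoffel_basis.

(** * Spherical Fourier-Bessel functions on the ball *)

Section complex_measurable.
Context (R : realType) (d : measure_display) (T : measurableType d).
Local Notation C := R[i].
Local Notation M := (measurableTypeR R).
Implicit Types f g : T -> C.

Definition complex_measurable f : Prop :=
  measurable_fun setT (fun x => complex.Re (f x) : M) /\
  measurable_fun setT (fun x => complex.Im (f x) : M).

Lemma complex_measurableM f g : complex_measurable f -> complex_measurable g ->
  complex_measurable (fun x => f x * g x).
Proof.
move=> [fr fi] [gr gi]; split.
  rewrite (_ : (fun _ => _) = (fun x => complex.Re (f x) * complex.Re (g x) - complex.Im (f x) * complex.Im (g x))).
    by apply: measurable_funB; exact: measurable_funM.
  by apply/funext => x; case: (f x) (g x) => a b [a' b'].
rewrite (_ : (fun _ => _) = (fun x => complex.Re (f x) * complex.Im (g x) + complex.Im (f x) * complex.Re (g x))).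
  by apply: measurable_funD; exact: measurable_funM.
by apply/funext => x; case: (f x) (g x) => a b [a' b'].
Qed.

Lemma complex_measurableJ f : complex_measurable f -> complex_measurable (fun x => (f x)^* ).
Proof.
move=> [fr fi]; split.
  by rewrite (_ : (fun _ => _) = (fun x => complex.Re (f x)))//; apply/funext => x; case: (f x).
rewrite (_ : (fun _ => _) = (fun x => - complex.Im (f x))); last by apply/funext => x; case: (f x).
exact: (measurable_funN fi).
Qed.

Lemma complex_measurable_real (h : T -> R) : measurable_fun setT (h : T -> M) ->
  complex_measurable (fun x => (h x)%:C).
Proof. by move=> mh; split => //; exact: measurable_cst. Qed.

Lemma complex_measurableX f k : complex_measurable f -> complex_measurable (fun x => f x ^+ k).
Proof.
move=> mf; elim: k => [|k IH].
  by split; exact: measurable_cst.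
under eq_fun do rewrite exprS; exact: complex_measurableM.
Qed.

Lemma complex_measurable_cst (c : C) : complex_measurable (fun _ => c).
Proof. by split; exact: measurable_cst. Qed.

End complex_measurable.

Section unit_directions.
Variable R : realType.
Local Notation normc := ComplexField.Normc.normc.
Implicit Types (l : nat) (q : int) (x : R3 R).

Definition direction x : R3 R := (norm3 x)^-1 *: (x : R * R * R).

Lemma norm3_eq0 x : (norm3 x == 0) = ((x : R * R * R) == 0).
Proof.
case: x => [[a b] c]; rewrite /norm3/= sqrtr_eq0.
apply/idP/idP => [h|/eqP[-> -> ->]]; last by rewrite expr0n/= !addr0.
have := sqr_ge0 a; have := sqr_ge0 b; have := sqr_ge0 c => hc hb ha.
have a0 : a ^+ 2 = 0 by lra.
have b0 : b ^+ 2 = 0 by lra.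
have c0 : c ^+ 2 = 0 by lra.
move/eqP: a0; move/eqP: b0; move/eqP: c0.
by rewrite !sqrf_eq0 => /eqP -> /eqP -> /eqP ->.
Qed.

Lemma norm3_ge0 x : 0 <= norm3 x. Proof. exact: sqrtr_ge0. Qed.

Lemma norm3Z (a : R) x : norm3 ((a *: (x : R * R * R)) : R3 R) = `|a| * norm3 x.
Proof.
rewrite /norm3/= -sqrtr_sqr -sqrtrM ?sqr_ge0//; congr Num.sqrt.
by rewrite /GRing.scale/=; ring.
Qed.

Lemma norm3_direction x : (x : R * R * R) != 0 -> norm3 (direction x) = 1.
Proof.
move=> x0; rewrite /direction norm3Z ger0_norm ?invr_ge0 ?norm3_ge0//.
by rewrite mulVf// norm3_eq0.
Qed.

(** One of the nonnegative terms of the addition theorem, with 4 pi >= 1. *)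
Lemma sph_harm_le l q x : (`|q| <= l)%N -> norm3 x = 1 ->
  normc (sph_harm l q x) ^+ 2 <= (2 * l + 1)%:R.
Proof.
move=> ql x1; have := sum_normc_sph_harm l x1.
have qi : (`|(q + l%:Z)%R|%N < (2 * l).+1)%N by lia.
rewrite (bigD1 (Ordinal qi))//= => E.
have -> : q = (`|(q + l%:Z)%R|%N)%:Z - l%:Z by lia.
apply: le_trans (_ : _ <= (2 * l + 1)%:R / (4 * pi)) _.
  by rewrite -E lerDl sumr_ge0// => i _; rewrite sqr_ge0.
rewrite ler_pdivrMr ?mulr_gt0 ?pi_gt0// ler_peMr//.
have := @pi_ge2 R; lra.
Qed.

End unit_directions.

Section ball_functions.
Variables (R : realType) (lambda : R).
Local Notation C := R[i].
Local Notation M := (measurableTypeR R).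
Implicit Types (l : nat) (q : int) (x : R3 R).

(** The product formula for [fourier_bessel] off the origin.  It is also correct
    at the origin, where no limit is needed: the radial factor vanishes there
    if l > 0, and the harmonic of degree 0 is constant. *)
Definition ball_function l q x : C :=
  (bessel_scale lambda l * radial lambda l (norm3 x))%:C * sph_harm l q (direction x).

Lemma measurable_sph_harm_direction l q : complex_measurable (fun x => sph_harm l q (direction x)).
Proof.
have m1 : measurable_fun [set: R3 R] (fun x => (direction x).1.1 : M).
  apply: measurable_funM; first by apply: measurable_funV; exact: measurable_norm3.
  exact: (measurableT_comp measurable_fst measurable_fst).
have m2 : measurable_fun [set: R3 R] (fun x => (direction x).1.2 : M).
  apply: measurable_funM; first by apply: measurable_funV; exact: measurable_norm3.
  exact: (measurableT_comp measurable_snd measurable_fst).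
have m3 : measurable_fun [set: R3 R] (fun x => (direction x).2 : M).
  apply: measurable_funM; first by apply: measurable_funV; exact: measurable_norm3.
  exact: measurable_snd.
have mn k : complex_measurable (fun x => sph_harm_nat l k (direction x)).
  apply: complex_measurableM; last by apply: complex_measurableX; split.
  apply: complex_measurable_real; apply: measurable_funM => //.
  apply: (measurableT_comp _ m3); apply: continuous_measurable_fun; exact: continuous_horner.
case: q => k; first exact: mn.
by apply: complex_measurableM; [exact: complex_measurable_cst|exact: complex_measurableJ].
Qed.

Lemma measurable_ball_function l q : complex_measurable (ball_function l q).
Proof.
apply: complex_measurableM; last exact: measurable_sph_harm_direction.
apply: complex_measurable_real; apply: measurable_funM => //.
apply: (measurableT_comp _ (@measurable_norm3 R)).
by apply: continuous_measurable_fun; exact: continuous_radial.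
Qed.

End ball_functions.

Section ball_functions.
Variables (R : realType) (lambda : R).
Hypothesis lambda_gt0 : 0 < lambda.
Local Notation C := R[i].
Local Notation normc := ComplexField.Normc.normc.
Implicit Types (l : nat) (q : int) (x : R3 R).

Lemma fourier_bessel_off_origin l q x : (x : R * R * R) != 0 -> norm3 x <= 1 ->
  sph_harm l q ((norm3 x)^-1 *: (x : R * R * R)) * (sph_bessel l (lambda * norm3 x))%:C =
  ball_function lambda l q x.
Proof.
move=> x0 x1; rewrite sph_besselE// 1?mulrC//.
by rewrite x1 andbT lt_neqAle norm3_ge0 eq_sym norm3_eq0 x0.
Qed.

Lemma norm3_0 : norm3 (0 : R * R * R) = 0 :> R.
Proof. by apply/eqP; rewrite norm3_eq0. Qed.

Lemma norm3_cvg0 : norm3 y @[y --> (0 : R * R * R)] --> (0 : R).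
Proof.
rewrite -[X in _ --> X]norm3_0.
apply: (@continuous_comp _ _ _ (fun y : R * R * R => y.1.1 ^+ 2 + y.1.2 ^+ 2 + y.2 ^+ 2) Num.sqrt 0);
  last exact: sqrt_continuous.
have cX (h : R * R * R -> R) : {for 0, continuous h} -> {for 0, continuous (fun y => h y ^+ 2)}.
  move=> ch; apply: (@continuous_comp _ _ _ h (fun z => z ^+ 2)) => //; exact: exprn_continuous.
apply: continuousD; first apply: continuousD; apply: cX.
- by apply: (@continuous_comp _ _ _ fst fst); exact: cvg_fst.
- by apply: (@continuous_comp _ _ _ fst snd); [exact: cvg_fst|exact: cvg_snd].
- exact: cvg_snd.
Qed.

(** For l > 0 the radial factor vanishes at 0, and for l = 0 the harmonic is
    constant: the direction attributed to the origin is immaterial. *)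
Lemma radial0_sph_harm l q (y z : R3 R) : (`|q| <= l)%N ->
  (radial lambda l 0)%:C * sph_harm l q y = (radial lambda l 0)%:C * sph_harm l q z.
Proof.
case: l => [|l] ql; last by rewrite /radial expr0n/= !mul0r.
have -> : q = 0 by lia.
congr (_ * _); rewrite /sph_harm /= /sph_harm_nat !expr0; congr (_%:C * _); congr (_ * _).
by rewrite /legendre_deriv !expr0 !hornerZ !hornerC.
Qed.

Lemma normc_le_sqr (z : C) (b : R) : 0 <= b -> normc z ^+ 2 <= b ^+ 2 -> normc z <= b.
Proof.
move=> b0; rewrite ler_pXn2r// nnegrE//.
by case: z => u v; exact: sqrtr_ge0.
Qed.

(** By [radial0_sph_harm] the difference to the limit is the increment of the
    radial factor times a harmonic, and the harmonics are bounded. *)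
Lemma fourier_bessel_cvg0 l q : (`|q| <= l)%N ->
  ((fun y : R * R * R => (sph_harm l q ((norm3 y)^-1 *: y) * (sph_bessel l (lambda * norm3 y))%:C : C^o))
    @ (0 : R * R * R)%type^') --> (ball_function lambda l q (0 : R * R * R) : C^o).
Proof.
move=> ql; apply/cvgrPdist_le => /= -[a b]; rewrite ltcE /= => /andP[/eqP -> a0].
have c0 := bessel_scale_gt0 lambda_gt0 l.
set c := bessel_scale lambda l in c0.
have n0 : 0 < (2 * l + 1)%:R :> R by rewrite ltr0n addn1.
have n1 : 1 <= (2 * l + 1)%:R :> R by rewrite ler1n addn1.
pose eta := a / (2 * l + 1)%:R / c.
have eta0 : 0 < eta by exact: divr_gt0 (divr_gt0 a0 n0) c0.
have cr : radial lambda l (norm3 y) @[y --> (0 : R * R * R)] --> radial lambda l 0.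
  by apply: cvg_comp norm3_cvg0 _; exact: continuous_radial.
have near_r : \forall y \near (0 : R * R * R), `|radial lambda l 0 - radial lambda l (norm3 y)| <= eta.
  by move/cvgrPdist_le : cr; apply.
have near_1 : \forall y \near (0 : R * R * R), norm3 y <= 1.
  have /cvgrPdist_le/(_ 1 ltr01) := norm3_cvg0.
  by apply: filterS => y; rewrite sub0r normrN ger0_norm// norm3_ge0.
near=> t.
have t0 : t != 0 by near: t; exact: nbhs_dnbhs_neq.
have t1 : norm3 t <= 1 by near: t; exact: nbhs_dnbhs.
have tr : `|radial lambda l 0 - radial lambda l (norm3 t)| <= eta by near: t; exact: nbhs_dnbhs.
rewrite fourier_bessel_off_origin//.
have -> : ball_function lambda l q 0 - ball_function lambda l q t =
    (c * (radial lambda l 0 - radial lambda l (norm3 t)))%:C * sph_harm l q (direction t).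
  have rM (u v : R) : (u * v)%:C = u%:C * v%:C by simpc.
  rewrite /ball_function norm3_0 -/c !(rM c) -mulrA (radial0_sph_harm _ (direction t) ql).
  by rewrite -[in RHS]mulrA -mulrA -mulrBr rmorphB mulrBl.
rewrite -[`|_|]/((normc _)%:C) -/(a%:C) lecR; apply: normc_le_sqr; first exact: ltW.
rewrite normc_sqrM normc_sqr_real.
have h1 : `|c * (radial lambda l 0 - radial lambda l (norm3 t))| <= a / (2 * l + 1)%:R.
  by rewrite normrM gtr0_norm// mulrC -ler_pdivlMr.
have h2 := sph_harm_le ql (norm3_direction t0).
have h3 : (c * (radial lambda l 0 - radial lambda l (norm3 t))) ^+ 2 <= (a / (2 * l + 1)%:R) ^+ 2.
  by rewrite -[leLHS]real_normK ?num_real// ler_pXn2r// nnegrE// divr_ge0// ltW.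
apply: (le_trans (ler_pM _ _ h3 h2)); rewrite ?sqr_ge0//.
rewrite exprMn -mulrA ler_piMr ?sqr_ge0// expr2 -mulrA mulVf ?mulr1 ?gt_eqF//.
by rewrite invf_le1.
Unshelve. all: by end_near. Qed.

(** The limit at the origin is unique only if the origin is not isolated; the
    line through (1, 0, 0) shows this. *)
Instance space_dnbhs0_proper : ProperFilter (0 : R * R * R)%type^'.
Proof.
apply: Build_ProperFilter_ex => A A0.
pose v : R * R * R := (1, 0, 0).
pose h (t : R) : R * R * R := t *: v.
have v0 : v != 0 by apply/eqP => -[/eqP]; rewrite oner_eq0.
have ch : h t @[t --> (0 : R)] --> (0 : R * R * R).
  by rewrite -[X in _ --> X](scale0r v); apply: cvgZl; exact: cvg_id.
have h0 : \forall t \near (0 : R), h t != 0 -> A (h t) by exact: (ch _ A0).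
have [t [t0 At]] : exists t : R, t != 0 /\ A (h t).
  apply: (@filter_ex _ (0 : R)^'); near=> t.
  have t0 : t != 0 by near: t; exact: nbhs_dnbhs_neq.
  split=> //.
  have : h t != 0 -> A (h t) by near: t; exact: nbhs_dnbhs.
  by apply; rewrite scaler_eq0 negb_or t0.
by exists (h t).
Unshelve. all: by end_near. Qed.

Lemma fourier_besselE l q x : (`|q| <= l)%N -> ball3 x ->
  fourier_bessel lambda l q x = ball_function lambda l q x.
Proof.
move=> ql bx; rewrite /fourier_bessel; case: ifPn => [/eqP x0|x0].
  rewrite x0; exact: (@cvg_lim C^o (@norm_hausdorff _ C^o) _ _ _ _ _ (fourier_bessel_cvg0 ql)).
exact: fourier_bessel_off_origin.
Qed.

End ball_functions.

Section inner_products.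
Variables (R : realType) (lambda : R).
Hypothesis lambda_gt0 : 0 < lambda.
Local Notation C := R[i].
Local Notation mu := (@lebesgue_measure R).
Local Notation normc := ComplexField.Normc.normc.
Implicit Types (l : nat) (q : int) (x : R3 R) (al : {i01 R}).

(** The origin is given the direction of the north pole, so that the addition
    theorem applies at every point of the ball. *)
Definition unit_direction x : R3 R :=
  if (x : R * R * R) == 0 then (0, 0, 1) else direction x.

Lemma norm3_unit_direction x : norm3 (unit_direction x) = 1.
Proof.
rewrite /unit_direction; case: ifPn => [_|]; last exact: norm3_direction.
by rewrite /norm3/= expr0n/= !add0r expr1n sqrtr1.
Qed.

Lemma ball_function_unit l q x : (`|q| <= l)%N ->
  ball_function lambda l q x =
  (bessel_scale lambda l * radial lambda l (norm3 x))%:C * sph_harm l q (unit_direction x).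
Proof.
move=> ql; rewrite /ball_function /unit_direction; case: ifPn => // x0.
have -> : norm3 x = 0 by apply/eqP; rewrite norm3_eq0.
have rM (u v : R) : (u * v)%:C = u%:C * v%:C by simpc.
by rewrite (rM (bessel_scale lambda l)) -!mulrA (radial0_sph_harm _ _ (0, 0, 1) ql).
Qed.

Lemma ball_function_bounded l q : (`|q| <= l)%N ->
  exists2 B, 0 <= B & forall x, ball3 x -> normc (ball_function lambda l q x) ^+ 2 <= B.
Proof.
move=> ql; have [B hB] := radial_bounded lambda l.
have B0 : 0 <= B by apply: le_trans (hB 0 _); rewrite ?sqr_ge0// lexx ler01.
exists (bessel_scale lambda l ^+ 2 * B * (2 * l + 1)%:R).
  by apply: mulr_ge0 (ler0n _ _); apply: mulr_ge0 B0; exact: sqr_ge0.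
move=> x bx; rewrite ball_function_unit// normc_sqrM normc_sqr_real exprMn.
apply: ler_pM; [by apply: mulr_ge0; exact: sqr_ge0|exact: sqr_ge0| |].
  by rewrite ler_wpM2l ?sqr_ge0// hB// norm3_ge0.
by apply: sph_harm_le => //; exact: norm3_unit_direction.
Qed.

Lemma ball_function_product_bounded l q l' q' : (`|q| <= l)%N -> (`|q'| <= l')%N ->
  exists K, forall x, ball3 x ->
    `|complex.Re (ball_function lambda l q x * (ball_function lambda l' q' x)^* )| <= K /\
    `|complex.Im (ball_function lambda l q x * (ball_function lambda l' q' x)^* )| <= K.
Proof.
move=> ql ql'; have [B B0 hB] := ball_function_bounded ql.
have [B' B0' hB'] := ball_function_bounded ql'.
(* |u| <= 1 + u^2 for the real and imaginary parts u *)
exists (1 + B * B') => x bx.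
have : normc (ball_function lambda l q x * (ball_function lambda l' q' x)^* ) ^+ 2 <= B * B'.
  rewrite normc_sqrM normc_sqr_conj.
  exact: ler_pM (sqr_ge0 _) (sqr_ge0 _) (hB x bx) (hB' x bx).
rewrite normc_sqr; move: (complex.Re _) (complex.Im _) (B * B') => u v b h.
have hu := sqr_ge0 (`|u| - 1); have hv := sqr_ge0 (`|v| - 1).
have nu2 : `|u| ^+ 2 = u ^+ 2 by rewrite real_normK ?num_real.
have nv2 : `|v| ^+ 2 = v ^+ 2 by rewrite real_normK ?num_real.
have := sqr_ge0 u; have := sqr_ge0 v.
have := normr_ge0 u; have := normr_ge0 v.
split; nra.
Qed.

(** 4 pi times the squared norm, in L^2 (nu al), of the product of
    [radial lambda l] and a harmonic of degree l, whatever its order. *)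
Definition mass al l : R :=
  (1 - al%:num) * 3 * radial_mass lambda l + al%:num * radial lambda l 1 ^+ 2.

Lemma direction_polar (r t s : R) : 0 < r ->
  direction (r * sin t * cos s, r * sin t * sin s, r * cos t) = spherical (t, s).
Proof.
move=> r0; have r1 : r != 0 by rewrite gt_eqF.
rewrite /direction norm3_polar ?ltW// /spherical; congr (_, _, _).
- by rewrite -[LHS]/(r^-1 * (r * sin t * cos s)) -mulrA mulKf.
- by rewrite -[LHS]/(r^-1 * (r * sin t * sin s)) -mulrA mulKf.
- by rewrite -[LHS]/(r^-1 * (r * cos t)) mulKf.
Qed.

Lemma ball_function_polar_product l q l' q' (r t s : R) : 0 < r <= 1 -> 0 <= t <= pi ->
  ball_function lambda l q (r * sin t * cos s, r * sin t * sin s, r * cos t) *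
  (ball_function lambda l' q' (r * sin t * cos s, r * sin t * sin s, r * cos t))^* =
  (((bessel_scale lambda l * radial lambda l r) * (bessel_scale lambda l' * radial lambda l' r)) *
     (polar_part l q t * polar_part l' q' t) * cos ((q - q')%:~R * s)) +i*
  (((bessel_scale lambda l * radial lambda l r) * (bessel_scale lambda l' * radial lambda l' r)) *
     (polar_part l q t * polar_part l' q' t) * sin ((q - q')%:~R * s)).
Proof.
move=> /andP[r0 _] tpi; rewrite /ball_function norm3_polar ?ltW// direction_polar//.
move: (bessel_scale _ _ * _) (bessel_scale _ _ * _) => a b.
have E := sph_harm_product l l' q q' s tpi.
transitivity ((a * b)%:C * (sph_harm l q (spherical (t, s)) * (sph_harm l' q' (spherical (t, s)))^* )).
  move: (sph_harm l q _) (sph_harm l' q' _) => [u v] [u' v'].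
  by simpc; congr (_ +i* _); ring.
by rewrite E; simpc; congr (_ +i* _); ring.
Qed.

Lemma continuous_scaled_product l l' :
  continuous (fun r => (bessel_scale lambda l * radial lambda l r) *
                       (bessel_scale lambda l' * radial lambda l' r)).
Proof.
by do 2! apply: continuous_mulr; [exact: continuous_cstr|exact: continuous_radial|
   exact: continuous_cstr|exact: continuous_radial].
Qed.

Lemma continuous_lin_comp (f : R -> R) (n : int) : continuous f -> continuous (fun s : R => f (n%:~R * s)).
Proof.
move=> cf; have cl : continuous (fun s : R => n%:~R * s).
  apply: (@continuous_mulr R (fun=> n%:~R) id); first exact: continuous_cstr.
  by move=> s; exact: cvg_id.
by move=> s; apply: (@continuous_comp _ _ _ (fun s : R => n%:~R * s) f); [exact: cl|exact: cf].
Qed.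

Let products_measurable l q l' q' : complex_measurable
  (fun x => ball_function lambda l q x * (ball_function lambda l' q' x)^* ).
Proof.
apply: complex_measurableM; first exact: measurable_ball_function.
by apply: complex_measurableJ; exact: measurable_ball_function.
Qed.

Lemma ball_function_integrable al l q l' q' : (`|q| <= l)%N -> (`|q'| <= l')%N ->
  complex_integrable (@ball3 R) (nu al)
    (fun x => ball_function lambda l q x * (ball_function lambda l' q' x)^* ).
Proof.
move=> ql ql'; have [K hK] := ball_function_product_bounded ql ql'.
have [mr mi] := products_measurable l q l' q'.
split; apply: (@nu_integrable R al _ K).
- exact: measurable_funTS.
- by move=> x /hK[].
- exact: measurable_funTS.
- by move=> x /hK[].
Qed.

Let split_inner (a b c d e f : R) : a / b * c = d -> (a / b * c) +i* (e * 0 / b * f) = d%:C.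
Proof. by move=> ->; rewrite mulr0 !mul0r. Qed.

Let zero_average (p a b : R) : false%:R / p * a = false%:R * b.
Proof. by rewrite !mul0r. Qed.

Let full_average (p a b c x r : R) :
  true%:R / p * (a * 3 * (c ^+ 2 * b) + x * (c * r * (c * r))) =
  true%:R * (c ^+ 2 / p * (a * 3 * b + x * r ^+ 2)).
Proof. by rewrite !mul1r; ring. Qed.

(** Both parts of the integrand separate in spherical coordinates.  The
    imaginary part integrates to 0 over the azimuth, and the real part is given
    by [sphere_orthonormal]. *)
Lemma ball_function_inner al l q l' q' : (`|q| <= l)%N -> (`|q'| <= l')%N ->
  inner (@ball3 R) (nu al) (ball_function lambda l q) (ball_function lambda l' q') =
  (((l == l') && (q == q'))%:R * (bessel_scale lambda l ^+ 2 / (4 * pi) * mass al l))%:C.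
Proof.
move=> ql ql'; have [K hK] := ball_function_product_bounded ql ql'.
have [mr mi] := products_measurable l q l' q'.
have cA : continuous (fun t => polar_part l q t * polar_part l' q' t : R).
  by apply: continuous_mulr; exact: continuous_polar_part.
have cG := @continuous_scaled_product l l'.
rewrite /inner.
rewrite (@nu_integral_separated R al _ K
  (fun r => (bessel_scale lambda l * radial lambda l r) *
            (bessel_scale lambda l' * radial lambda l' r))
  (fun t => polar_part l q t * polar_part l' q' t)
  (fun s => cos ((q - q')%:~R * s)) (@cos_primitive R (q - q')) (measurable_funTS mr)
  (fun x bx => proj1 (hK x bx)) cG cA (continuous_lin_comp (@continuous_cos R))
  (is_derive_cos_primitive _)); last first.
  by move=> r t s r01 tpi; rewrite ball_function_polar_product.
rewrite (@nu_integral_separated R al _ K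
  (fun r => (bessel_scale lambda l * radial lambda l r) *
            (bessel_scale lambda l' * radial lambda l' r))
  (fun t => polar_part l q t * polar_part l' q' t)
  (fun s => sin ((q - q')%:~R * s)) (@sin_primitive R (q - q')) (measurable_funTS mi)
  (fun x bx => proj2 (hK x bx)) cG cA (continuous_lin_comp (@continuous_sin R))
  (is_derive_sin_primitive _)); last first.
  by move=> r t s r01 tpi; rewrite ball_function_polar_product.
rewrite (@sin_primitive_period R (q - q')) (@sphere_orthonormal R l l' q q' ql ql').
apply: split_inner.
have [ll'|_] := eqVneq l l'; last exact: zero_average.
have [qq'|_] := eqVneq q q'; last exact: zero_average.
rewrite -ll' /mass.
have -> : \int[mu]_(r in `[0, 1]) (bessel_scale lambda l * radial lambda l r *
    (bessel_scale lambda l * radial lambda l r) * r ^+ 2) = bessel_scale lambda l ^+ 2 * radial_mass lambda l.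
  rewrite /radial_mass -RintegralZl//; last first.
    by apply: continuous_itv_integrable; exact: continuous_radial_sqr.
  by congr Rintegral; apply/funext => r; ring.
exact: full_average.
Qed.

Lemma mass_gt0 al l : al%:num < 1 -> 0 < mass al l.
Proof.
move=> al1; rewrite /mass ltr_wpDr//; first by rewrite mulr_ge0 ?sqr_ge0.
by rewrite !mulr_gt0 ?subr_gt0// radial_mass_gt0.
Qed.

End inner_products.

(** * The orthonormal basis and its Christoffel sum *)

Section harmonic_indices.
Variable L : nat.

(** The pairs (l, q) with l <= L and - l <= q <= l; the second component encodes
    q as q + l. *)
Definition harmonic_index : finType := {l : 'I_L.+1 & 'I_(2 * l).+1}.
Implicit Types p : harmonic_index.

Definition degree p : nat := tag p.
Definition azimuthal p : int := (tagged p : nat)%:Z - (tag p : nat)%:Z.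

Lemma card_harmonic_index : #|{: harmonic_index}| = ((L + 1) ^ 2)%N.
Proof.
rewrite card_tagged sumnE big_map big_enum/=.
under eq_bigr do rewrite card_ord.
elim: L => [|n IH]; first by rewrite big_ord1.
by rewrite big_ord_recr/= IH; lia.
Qed.

Lemma azimuthal_le p : (`|azimuthal p| <= degree p)%N.
Proof. by case: p => l j; rewrite /azimuthal /degree/=; have := ltn_ord j; lia. Qed.

Lemma degree_le p : (degree p <= L)%N.
Proof. by rewrite -ltnS ltn_ord. Qed.

Lemma harmonic_index_eq p p' : (p == p') = (degree p == degree p') && (azimuthal p == azimuthal p').
Proof.
apply/eqP/andP => [->|[/eqP + /eqP]]; first by rewrite !eqxx.
case: p p' => [l j] [l' j']; rewrite /degree /azimuthal/= => /ord_inj ll'.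
move: j'; rewrite -ll' => j' jj'; congr Tagged; apply: ord_inj; lia.
Qed.

Lemma harmonic_indexP (l : nat) (q : int) : (l <= L)%N -> (`|q| <= l)%N ->
  exists p, degree p = l /\ azimuthal p = q.
Proof.
move=> lL ql; have jl : (`|(q + l%:Z)%R| < (2 * l).+1)%N by lia.
exists (Tagged (fun l : 'I_L.+1 => 'I_(2 * l).+1)
  (Ordinal jl : 'I_(2 * (Ordinal (lL : (l < L.+1)%N))).+1)).
by rewrite /degree /azimuthal/=; split=> //; lia.
Qed.

Definition harmonic_of (j : 'I_((L + 1) ^ 2)) : harmonic_index :=
  enum_val (cast_ord (esym card_harmonic_index) j).

Lemma harmonic_of_bij : bijective harmonic_of.
Proof.
exists (fun p => cast_ord card_harmonic_index (enum_rank p)) => [j|p].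
  by rewrite /harmonic_of enum_valK cast_ordKV.
by rewrite /harmonic_of cast_ordK enum_rankK.
Qed.

End harmonic_indices.

Section harmonic_basis.
Variables (R : realType) (lambda : R).
Hypothesis lambda_gt0 : 0 < lambda.
Variables (al : {i01 R}) (L : nat).
Hypothesis al1 : al%:num < 1.
Local Notation C := R[i].
Local Notation normc := ComplexField.Normc.normc.
Local Notation m := ((L + 1) ^ 2)%N.

Definition basis_scale l : R :=
  Num.sqrt (4 * pi / mass lambda al l) / bessel_scale lambda l.

Lemma basis_scale_sqr l :
  basis_scale l ^+ 2 * bessel_scale lambda l ^+ 2 = 4 * pi / mass lambda al l.
Proof.
have c0 := bessel_scale_gt0 lambda_gt0 l.
have m0 := mass_gt0 lambda l al1.
have p0 : 0 <= 4 * pi / mass lambda al l.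
  by rewrite divr_ge0 ?ltW// mulr_gt0 ?pi_gt0.
rewrite /basis_scale; move: (bessel_scale _ _) c0 => c c0.
by rewrite -exprMn divfK ?gt_eqF// sqr_sqrtr.
Qed.

Lemma basis_scale_neq0 l : basis_scale l != 0.
Proof.
have c0 := bessel_scale_gt0 lambda_gt0 l.
have m0 := mass_gt0 lambda l al1.
apply: lt0r_neq0; rewrite /basis_scale divr_gt0// sqrtr_gt0 divr_gt0//.
by rewrite mulr_gt0 ?pi_gt0.
Qed.

Definition basis_function (j : 'I_m) (x : R3 R) : C :=
  (basis_scale (degree (harmonic_of j)))%:C *
  ball_function lambda (degree (harmonic_of j)) (azimuthal (harmonic_of j)) x.

Let basis_product (i j : 'I_m) x : basis_function i x * (basis_function j x)^* =
  (basis_scale (degree (harmonic_of i)) * basis_scale (degree (harmonic_of j)))%:C *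
  (ball_function lambda (degree (harmonic_of i)) (azimuthal (harmonic_of i)) x *
   (ball_function lambda (degree (harmonic_of j)) (azimuthal (harmonic_of j)) x)^* ).
Proof.
rewrite /basis_function.
move: (basis_scale _) (basis_scale _) => a b.
move: (ball_function _ _ _ _) (ball_function _ _ _ _) => [u v] [u' v'].
by simpc; congr (_ +i* _); ring.
Qed.

Let basis_product_integral (i j : 'I_m) :=
  complex_integralZ (@measurable_ball3 R)
    (basis_scale (degree (harmonic_of i)) * basis_scale (degree (harmonic_of j)))%:C
    (ball_function_integrable lambda_gt0 al (azimuthal_le (harmonic_of i)) (azimuthal_le (harmonic_of j))).

Lemma basis_function_integrable (i j : 'I_m) :
  complex_integrable (@ball3 R) (nu al) (fun x => basis_function i x * (basis_function j x)^* ).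
Proof.
under eq_fun do rewrite basis_product.
by case: (basis_product_integral i j).
Qed.

Let normalized (a c p n : R) : p != 0 -> n != 0 -> a ^+ 2 * c ^+ 2 = p / n ->
  (a * a)%:C * (true%:R * (c ^+ 2 / p * n))%:C = (1 : C).
Proof.
move=> p0 n0 E; rewrite mul1r -rmorphM/= -expr2.
rewrite (_ : a ^+ 2 * (c ^+ 2 / p * n) = a ^+ 2 * c ^+ 2 / p * n); last by rewrite !mulrA.
by rewrite E (_ : p / n / p * n = 1)//; field; rewrite p0 n0.
Qed.

Lemma basis_function_inner (i j : 'I_m) :
  inner (@ball3 R) (nu al) (basis_function i) (basis_function j) = (i == j)%:R.
Proof.
rewrite innerE.
under eq_fun do rewrite basis_product.
case: (basis_product_integral i j) => _ ->.
rewrite -innerE (ball_function_inner lambda_gt0 al (azimuthal_le _) (azimuthal_le _)).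
rewrite -harmonic_index_eq (bij_eq (harmonic_of_bij L)).
have [<-|_] := eqVneq i j.
  apply: normalized; [| |exact: basis_scale_sqr].
    by rewrite mulf_neq0 ?pnatr_eq0// gt_eqF// pi_gt0.
  by rewrite gt_eqF// mass_gt0.
by rewrite mul0r mulr0.
Qed.

Lemma basis_function_fourier_bessel (j : 'I_m) (x : R3 R) : ball3 x ->
  basis_function j x = (basis_scale (degree (harmonic_of j)))%:C *
    fourier_bessel lambda (degree (harmonic_of j)) (azimuthal (harmonic_of j)) x.
Proof. by move=> bx; rewrite fourier_besselE//; exact: azimuthal_le. Qed.

Lemma fourier_bessel_basis (l : nat) (q : int) : (l <= L)%N -> (`|q| <= l)%N ->
  exists c : 'I_m -> C, forall x, ball3 x ->
    fourier_bessel lambda l q x = \sum_j c j * basis_function j x.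
Proof.
move=> lL ql; have [p [pl pq]] := harmonic_indexP lL ql.
have [idx _ idxK] := harmonic_of_bij L.
exists (fun j => if j == idx p then ((basis_scale l)^-1)%:C else 0) => x bx.
rewrite (bigD1 (idx p))//= eqxx big1 ?addr0 => [|j /negbTE ->]; last by rewrite mul0r.
rewrite basis_function_fourier_bessel// idxK pl pq mulrA -rmorphM/=.
by rewrite mulVf ?basis_scale_neq0// mul1r.
Qed.

Lemma basis_function_basis :
  orthonormal_basis (@ball3 R) (V3 lambda L) (nu al) basis_function.
Proof.
split=> [j|i j|f [n [g [c [gS fE]]]]]; last 1 first.
- have h i : {u : 'I_m -> C | forall x, ball3 x -> g i x = \sum_j u j * basis_function j x}.
    apply: cid; have [l [q [lL ql ->]]] := gS i.
    by apply: fourier_bessel_basis => //; lia.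
  exists (fun j => \sum_i c i * sval (h i) j) => x bx; rewrite fE//.
  under eq_bigr => i _ do rewrite (svalP (h i) x bx) mulr_sumr.
  rewrite exchange_big/=; apply: eq_bigr => j _; rewrite mulr_suml.
  by apply: eq_bigr => i _; rewrite mulrA.
- exists 1%N, (fun=> fourier_bessel lambda (degree (harmonic_of j)) (azimuthal (harmonic_of j))).
  exists (fun=> (basis_scale (degree (harmonic_of j)))%:C); split=> [_|x bx].
    exists (degree (harmonic_of j)), (azimuthal (harmonic_of j)); split=> //; first exact: degree_le.
    by have := azimuthal_le (harmonic_of j); lia.
  by rewrite big_ord1 basis_function_fourier_bessel.
- exact: basis_function_inner.
Qed.

Definition radial_christoffel (r : R) : R :=
  \sum_(l < L.+1) (2 * l + 1)%:R * radial lambda l r ^+ 2 / mass lambda al l.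

Let christoffel_term l (q : int) (x : R3 R) : (`|q| <= l)%N ->
  normc ((basis_scale l)%:C * ball_function lambda l q x) ^+ 2 =
  4 * pi / mass lambda al l * radial lambda l (norm3 x) ^+ 2 *
  normc (sph_harm l q (unit_direction x)) ^+ 2.
Proof.
move=> ql; rewrite ball_function_unit// -basis_scale_sqr !normc_sqrM !normc_sqr_real.
move: (basis_scale l) (bessel_scale _ _) (radial _ _ _) (normc _) => a b c d.
by rewrite exprMn !mulrA.
Qed.

Let average_term (p n d r : R) : p != 0 -> p / n * r * (d / p) = d * r / n.
Proof.
move=> p0; rewrite (_ : p / n * r * (d / p) = p / p * (d * r / n)); last by ring.
by rewrite mulfV// mul1r.
Qed.

(** The addition theorem sums out the orders of each degree. *)
Lemma christoffel_sum_radial (x : R3 R) :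
  christoffel_sum basis_function x = radial_christoffel (norm3 x).
Proof.
rewrite /christoffel_sum.
under eq_bigr => j _ do rewrite /basis_function (christoffel_term x (azimuthal_le (harmonic_of j))).
pose F (p : harmonic_index L) := 4 * pi / mass lambda al (degree p) *
  radial lambda (degree p) (norm3 x) ^+ 2 *
  normc (sph_harm (degree p) (azimuthal p) (unit_direction x)) ^+ 2.
rewrite (_ : \sum_j _ = \sum_(p : harmonic_index L) F p); last first.
  by rewrite (reindex (@harmonic_of L))//; exact/onW_bij/harmonic_of_bij.
rewrite /radial_christoffel.
have -> : \sum_p F p = \sum_(l < L.+1) \sum_(j < (2 * l).+1)
    F (Tagged (fun l : 'I_L.+1 => 'I_(2 * l).+1) j).
  by rewrite sig_big_dep/=; apply: eq_bigr => -[].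
apply: eq_bigr => l _; rewrite /F /degree /azimuthal/= -mulr_sumr.
rewrite (sum_normc_sph_harm l (norm3_unit_direction x)) average_term//.
by rewrite mulf_neq0 ?pnatr_eq0// gt_eqF// pi_gt0.
Qed.

Lemma continuous_radial_christoffel : continuous radial_christoffel.
Proof.
rewrite /radial_christoffel; elim: L.+1 => [|n IH].
  by under eq_fun do rewrite big_ord0; exact: continuous_cstr.
under eq_fun do rewrite big_ord_recr/=.
apply: continuous_addr => //.
apply: continuous_mulr; last exact: continuous_cstr.
apply: continuous_mulr; first exact: continuous_cstr.
move=> r; apply: (@continuous_comp _ _ _ (radial lambda n) (fun y => y ^+ 2)).
  exact: continuous_radial.
exact: exprn_continuous.
Qed.

(** By [christoffel_sum_basis] a single orthonormal basis has to be considered,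
    and its Christoffel sum is a continuous function of the radius, whose
    maximum over [0, 1] is attained at a point (0, 0, r). *)
Lemma christoffel_max_exists : exists K : R,
  [/\ is_christoffel_max (@ball3 R) (V3 lambda L) (nu al) m K,
      forall r, 0 <= r <= 1 -> radial_christoffel r <= K &
      exists2 r, 0 <= r <= 1 & K = radial_christoffel r].
Proof.
have [r r01 rmax] : exists2 r, r \in `[0, 1]%R &
    forall t, t \in `[0, 1]%R -> radial_christoffel t <= radial_christoffel r.
  apply: EVT_max => //; apply: continuous_subspaceT; exact: continuous_radial_christoffel.
have norm01 x : ball3 x -> norm3 x \in `[0, 1]%R by rewrite in_itv/= norm3_ge0.
move: (r01); rewrite in_itv/= => r01'.
exists (radial_christoffel r); split=> [|t t01|]; last 2 first.
- by apply: rmax; rewrite in_itv.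
- by exists r.
split; first by exists basis_function; exact: basis_function_basis.
move=> B oB.
have E x : ball3 x -> christoffel_sum B x = radial_christoffel (norm3 x).
  move=> bx; rewrite -christoffel_sum_radial.
  exact: (christoffel_sum_basis (@measurable_ball3 R) basis_function_basis
    basis_function_integrable oB bx).
split=> [x bx|]; first by rewrite E// rmax// norm01.
have nr : norm3 ((0, 0, r) : R3 R) = r.
  rewrite /norm3/= expr0n/= !add0r sqrtr_sqr ger0_norm//.
  by case/andP: r01'.
have br : ball3 ((0, 0, r) : R3 R).
  by rewrite /ball3/= nr; case/andP: r01'.
by exists (0, 0, r) => //; rewrite E// nr.
Qed.

End harmonic_basis.

(** * Growth of the Christoffel maximum *)

Section growth.
Variable R : realType.
Implicit Types a f : nat -> R.

(** A comparison that holds for all large degrees costs only a constant. *)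
Lemma sum_le_tail a f l0 n : (forall l, 0 <= a l) -> (forall l, 0 <= f l) ->
  (forall l, (l0 <= l)%N -> a l <= f l) ->
  \sum_(l < n) a l <= \sum_(l < l0) a l + \sum_(l < n) f l.
Proof.
move=> a0 f0 af; have s0 : 0 <= \sum_(l < l0) a l by exact: sumr_ge0.
elim: n => [|n IH]; first by rewrite !big_ord0 addr0.
have [l0n|nl0] := leqP l0 n.
  by rewrite !big_ord_recr/= addrA lerD// af.
apply: (@le_trans _ _ (\sum_(l < l0) a l)); last by rewrite lerDl sumr_ge0.
rewrite -(subnKC nl0) [leRHS]big_split_ord/= lerDl; exact: sumr_ge0.
Qed.

Lemma sum_degrees n : \sum_(l < n) (2 * l + 1)%:R = (n ^ 2)%:R :> R.
Proof.
by rewrite -natr_sum; congr _%:R; elim: n => [|n IH]; rewrite ?big_ord0// big_ord_recr/= IH; lia.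
Qed.

(** (2 l + 1) (2 l + 3) >= 4 / 3 ((l + 1)^3 - l^3), and the right-hand sides
    telescope. *)
Lemma sum_cubic_ge n :
  n%:R ^+ 3 / 9 <= \sum_(l < n) (2 * l + 1)%:R * (2 * l + 3)%:R / 12 :> R.
Proof.
elim: n => [|n IH]; first by rewrite big_ord0 expr0n/= mul0r.
rewrite big_ord_recr/= -(natr1 n) !(natrD _ (2 * n)) natrM.
have := ler0n R n; move: IH; set s := \sum_(_ < _) _; move: (n%:R : R) => x; nra.
Qed.

Lemma powR_square_three_halves n : ((n ^ 2)%:R : R) `^ (3 / 2) = n%:R ^+ 3.
Proof.
rewrite natrX -!powR_mulrn// -powRrM; congr (_ `^ _); lra.
Qed.

End growth.

Section bounds.
Variables (R : realType) (lambda : R).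

(** On the unit sphere, [radial_mass_le] bounds the term of large degree l from
    below by (2 l + 1) (2 l + 3) / 12. *)
Lemma uniform_christoffel_ge (al : {i01 R}) : al%:num = 0 -> exists c0 : R, forall L,
  c0 + (L.+1)%:R ^+ 3 / 9 <= radial_christoffel lambda al L 1.
Proof.
move=> al0; have [l0 large] := large_degree_exists lambda.
have m0 l : 0 < mass lambda al l by apply: mass_gt0 => //; rewrite al0 ltr01.
exists (- \sum_(l < l0) (2 * l + 1)%:R * (2 * l + 3)%:R / 12) => L.
rewrite addrC lerBlDl; apply: le_trans (sum_cubic_ge R L.+1) _.
apply: (@sum_le_tail R (fun l => (2 * l + 1)%:R * (2 * l + 3)%:R / 12)
  (fun l => (2 * l + 1)%:R * radial lambda l 1 ^+ 2 / mass lambda al l)) => l.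
- by rewrite divr_ge0// mulr_ge0.
- exact: divr_ge0 (mulr_ge0 (ler0n _ _) (sqr_ge0 _)) (ltW (m0 l)).
move=> /large[l2 lip].
have := radial_mass_le lip.
have mE : mass lambda al l = 3 * radial_mass lambda l by rewrite /mass al0; ring.
have n0 : 0 < (2 * l + 3)%:R :> R by rewrite ltr0n addn3.
rewrite ler_pdivlMr// ler_pdivlMr// mE.
move: n0; move: (2 * l + 3)%:R (radial_mass lambda l) (radial lambda l 1 ^+ 2) => n a b n0 h.
rewrite [leLHS](_ : _ = (2 * l + 1)%:R * (a * n / 4)); last by field.
by rewrite ler_wpM2l//; lra.
Qed.

(** For large degrees the surface part of the mass is already at least
    al * radial (r)^2, for every r in [0, 1]. *)
Lemma mixed_christoffel_le (al : {i01 R}) : 0 < al%:num -> al%:num < 1 ->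
  exists C : R, forall L r, 0 <= r <= 1 ->
    radial_christoffel lambda al L r <= C + ((L + 1) ^ 2)%:R / al%:num.
Proof.
move=> al0 al1; have [l0 large] := large_degree_exists lambda.
have [B hB] := choice (radial_bounded lambda).
have m0 l : 0 < mass lambda al l by exact: mass_gt0.
exists (\sum_(l < l0) (2 * l + 1)%:R * B l / mass lambda al l) => L r r01.
rewrite addn1 -sum_degrees mulr_suml.
have := @sum_le_tail R (fun l => (2 * l + 1)%:R * radial lambda l r ^+ 2 / mass lambda al l)
  (fun l => (2 * l + 1)%:R / al%:num) l0 L.+1.
move=> h; apply: le_trans (h _ _ _) _ => [l|l|l /large[l2 lip]|].
- exact: divr_ge0 (mulr_ge0 (ler0n _ _) (sqr_ge0 _)) (ltW (m0 l)).
- by rewrite divr_ge0.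
- rewrite -mulrA ler_wpM2l// ler_pdivrMr// mulrC ler_pdivlMr// mulrC.
  rewrite (le_trans (ler_wpM2l (ltW al0) (radial_le_boundary l2 lip r01)))//.
  by rewrite /mass lerDr !mulr_ge0 ?subr_ge0 ?ltW// radial_mass_gt0.
rewrite lerD2r ler_sum// => l _.
by rewrite ler_pM2r ?invr_gt0// ler_wpM2l// hB.
Qed.

End bounds.

Local Close Scope complex_scope.
Local Close Scope classical_set_scope.

Theorem theorem4p3 (R : realType) (lambda : R) (lambda_gt0 : 0 < lambda) :
  (forall c1 : R, c1 < 1 / 9 ->
    exists (c0 : R) (M : nat), forall L : nat,
      let m := ((L + 1) ^ 2)%N in (M <= m)%N ->
      exists2 K : R,
        is_christoffel_max (@ball3 R) (V3 lambda L) (nu 0%:i01) m K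
        & c0 + c1 * m%:R `^ (3 / 2) <= K) /\
  (forall alpha : {i01 R}, 0 < alpha%:num -> alpha%:num < 1 ->
    exists (C : R) (M : nat), forall L : nat,
      let m := ((L + 1) ^ 2)%N in (M <= m)%N ->
      exists2 K : R,
        is_christoffel_max (@ball3 R) (V3 lambda L) (nu alpha) m K
        & K <= C + m%:R / alpha%:num).
Proof.
split=> [c1 c1lt|al al0 al1].
  have al1 : (0%:i01 : {i01 R})%:num < 1 :> R by exact: ltr01.
  have [c0 hc0] := uniform_christoffel_ge lambda (erefl : (0%:i01 : {i01 R})%:num = 0 :> R).
  exists c0, 0%N => L m _.
  have [K [Kmax KS _]] := christoffel_max_exists lambda_gt0 L al1.
  exists K => //; apply: le_trans (KS 1 _); last by rewrite ler01 lexx.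
  apply: le_trans (hc0 L); rewrite lerD2l /m powR_square_three_halves addn1 mulrC.
  by rewrite ler_wpM2l ?exprn_ge0//; lra.
have [C hC] := mixed_christoffel_le lambda al0 al1.
exists C, 0%N => L m _.
have [K [Kmax _ [r r01 KE]]] := christoffel_max_exists lambda_gt0 L al1.
by exists K => //; rewrite KE; exact: hC.
Qed.
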